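(* Assume the two phases intersect, i.e. $V_f=V_c=V$, and let $F\in(0,V\sigma_+)$. The constrained Riemann solver $\mathcal{R}_F\colon\Omega^2\to\mathbf{L}^\infty(\mathbb{R};\Omega)$ (defined in the context, for either of the models PT$^a$ and PT$^p$) is $\mathbf{L}^1_{\mathrm{loc}}$-continuous and is not consistent: it satisfies (II) but does not satisfy (I) of the definition of consistency.
   Context: **Model (intersecting phases, $V_f=V_c=V$).** Fix $V>0$ (maximal velocity) and $R>0$ (maximal density). States are $u=(\rho,q)$. One of two models is fixed; speed $v$ and flow $f(u)=\rho\,v(u)$ are given by: - PT$^a$: $v(u)=v^a_{eq}(\rho)(1+q)$, $v^a_{eq}(\rho)=\left(\frac R\rho-1\right)\left(\frac{V\sigma}{R-\sigma}+a(\sigma-\rho)\right)$ for $\rho\in(0,R]$, with fixed $a\in\mathbb{R}$, $\sigma\in(0,R)$, and $1+q>0$ in the congested phase; - PT$^p$: $v(u)=\frac q\rho-p(\rho)$, where $p\in C^2((0,R];\mathbb{R})$, $p'(\rho)>0$ and $2p'(\rho)+\rho p''(\rho)>0$ for all $\rho\in(0,R]$. Fix $q_-<q_+$, put $w_\pm=q_\pm/R$, and let $0<\sigma_-<\sigma_+<R$ satisfy $v(\sigma_\pm,w_\pm\sigma_\pm)=V$. For PT$^p$, $p(R)=w_+$ and $w_-$ is in the range of $p$. Let $Q(\rho)=\frac{(\rho-\sigma)[VR+a(R-\rho)(R-\sigma)]}{(R-\rho)[V\sigma+a(\sigma-\rho)(R-\sigma)]}$ for PT$^a$ and $Q(\rho)=\rho[V+p(\rho)]$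 for PT$^p$ (limit value at $\rho=0$); thus $v(\rho,Q(\rho))=V$. Set $\Omega_f=\{u: \rho\in[0,\sigma_+],\ q=Q(\rho)\}$ (free phase; $v=V$ on all of $\Omega_f$, including $\rho=0$, where $f=0$), $\Omega_c=\{u:\rho\in[\sigma_-,R],\ 0\le v(u)\le V,\ w_-\le q/\rho\le w_+\}$ (congested phase), $\Omega=\Omega_f\cup\Omega_c$, $\Omega_f^-=\{u\in\Omega_f:\rho<\sigma_-\}$, $\Omega_f^+=\{u\in\Omega_f:\rho\ge\sigma_-\}=\Omega_f\cap\Omega_c$, $\Omega_c^-=\Omega_c\setminus\Omega_f^+$. Let $w(u)=q/\rho$ on $\Omega_c$ and $w(u)=w_-+V(\rho/\sigma_--1)$ on $\Omega_f^-$. The underlying equations are $\rho_t+f(u)_x=0$, $v(u)=V$ in $\Omega_f$, and $\rho_t+f(u)_x=0$, $q_t+(q\,v(u))_x=0$ in $\Omega_c$. In $\Omega_c$ let $\lambda_1(u)=v(u)+u\cdot\nabla v(u)$ and $r_1(u)=(\rho,q)$. Standing assumptions: $\lambda_1(u)<0$ for all $u\in\Omega_c$; and $\nabla\lambda_1\cdot r_1\ne0$ everywhere in $\Omega_c$, except for PT$^a$ with $a=0$ (where it vanishes exactly when $w(u)=0$). For $w\in[w_-,w_+]$ let $L_w(\rho)=f(\rho,w\rho)$ for $\rho\in[\rho_1(w),\rho_1^0(w)]$, where $v(\rho_1(w),w\rho_1(w))=V$, and $\rho_1^0(w)=R$ (PT$^a$), $\rho_1^0(w)=p^{-1}(w)$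 (PT$^p$). Then $L_w'(\rho)=\lambda_1(\rho,w\rho)$. Notation: for $u_o\in\Omega_c$, $\psi_1(u_o)$ is the state $u\in\Omega_c$ with $w(u)=w(u_o)$, $v(u)=V$; for $u_o\in\Omega$, $\psi_2^\pm(u_o)$ is the state $u\in\Omega_c$ with $w(u)=w_\pm$, $v(u)=v(u_o)$; for $u_\ell,u_r\in\Omega_c$, $u_*(u_\ell,u_r)$ is the state $u\in\Omega_c$ with $w(u)=w(u_\ell)$, $v(u)=v(u_r)$; $\Lambda(u,u')=\frac{f(u')-f(u)}{\rho'-\rho}$ for $\rho\neq\rho'$. Waves (functions of $x/t$): a *1-wave* from $u_\ell$ to $u_r$ in $\Omega_c$ with $w(u_\ell)=w(u_r)=w$ is the Lax solution along the curve $\{w(u)=w\}$: if $L_w''<0$, a shock of speed $\Lambda(u_\ell,u_r)$ when $\rho_\ell<\rho_r$ and a rarefaction (state $u$ with $w(u)=w$ and $\lambda_1(u)=x/t$) when $\rho_\ell>\rho_r$; if $L_w''>0$ the roles are exchanged; if $L_w''=0$ a jump of speed $\Lambda(u_\ell,u_r)$. A *2-contact discontinuity* is a jump between states of $\Omega_c$ with equal $v$, with speed $v$. A *phase transition* from $u$ to $u'$ is a jump of speed $\Lambda(u,u')$. Trivial waves between equal states are allowed. **Riemann solver $\mathcal{R}$.** $\mathcal{R}[u_\ell,u_r]$ is the following function of $x$ (the self-similar solution is $(t,x)\mapsto\mathcal{R}[u_\ell,u_r](x/t)$): - (R.1) $u_\ell,u_r\in\Omega_f$: contact discontinuity from $u_\ell$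 to $u_r$ with speed $V$. - (R.2) $u_\ell,u_r\in\Omega_c$: 1-wave from $u_\ell$ to $u_*(u_\ell,u_r)$, then 2-contact discontinuity to $u_r$. - (R.3) $u_\ell\in\Omega_c^-$, $u_r\in\Omega_f^-$: 1-wave from $u_\ell$ to $\psi_1(u_\ell)$, then contact discontinuity (speed $V$) to $u_r$. - (R.4) $u_\ell\in\Omega_f^-$, $u_r\in\Omega_c^-$, $\Lambda(u_\ell,\psi_2^-(u_r))\ge\lambda_1(\psi_2^-(u_r))$: phase transition from $u_\ell$ to $\psi_2^-(u_r)$, then 2-contact discontinuity to $u_r$. - (R.5) $u_\ell\in\Omega_f^-$, $u_r\in\Omega_c^-$, $\Lambda(u_\ell,\psi_2^-(u_r))<\lambda_1(\psi_2^-(u_r))$: with $u_p$ the state satisfying $w(u_p)=w_-$, $\Lambda(u_\ell,u_p)=\lambda_1(u_p)$, phase transition from $u_\ell$ to $u_p$, then 1-rarefaction from $u_p$ to $\psi_2^-(u_r)$, then 2-contact discontinuity to $u_r$. Profiles are taken right-continuous in $x$. **Constrained Riemann solver $\mathcal{R}_F$.** Fix $F\in(0,V\sigma_+)$ (bound on the flow at $x=0$). Let $\mathcal{D}_1=\{(u_\ell,u_r)\in\Omega^2: f(\mathcal{R}[u_\ell,u_r](0^\pm))\le F\}$, $\mathcal{D}_2=\Omega^2\setminus\mathcal{D}_1$. On $\mathcal{D}_1$, $\mathcal{R}_F[u_\ell,u_r]=\mathcal{R}[u_\ell,u_r]$. On $\mathcal{D}_2$, $\mathcal{R}_F[u_\ell,u_r](x)=\mathcal{R}[u_\ell,\hat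 u](x)$ for $x<0$ and $=\mathcal{R}[\check u,u_r](x)$ for $x>0$, where $\hat u=\hat u(u_\ell,F)\in\Omega_c$ and $\check u=\check u(u_r,F)\in\Omega$ are uniquely determined by $f(\hat u)=f(\check u)=F$, $w(\hat u)=\max\{w(u_\ell),w_-\}$, $v(\check u)=V$ if $f(\psi_2^-(u_r))>F$ and $v(\check u)=v(u_r)$ if $f(\psi_2^-(u_r))\le F$. **Definitions.** A solver $\mathcal{T}\colon\Omega^2\to\mathbf{L}^\infty(\mathbb{R};\Omega)$ is $\mathbf{L}^1_{\mathrm{loc}}$-continuous if $(u_\ell^\varepsilon,u_r^\varepsilon)\to(u_\ell,u_r)$ in $\Omega^2$ implies $\mathcal{T}[u_\ell^\varepsilon,u_r^\varepsilon]\to\mathcal{T}[u_\ell,u_r]$ in $\mathbf{L}^1_{\mathrm{loc}}(\mathbb{R})$. It is consistent if for all $u_\ell,u_m,u_r\in\Omega$, $\bar x\in\mathbb{R}$: (I) $\mathcal{T}[u_\ell,u_r](\bar x)=u_m$ implies both: $\mathcal{T}[u_\ell,u_m](x)=\mathcal{T}[u_\ell,u_r](x)$ for $x<\bar x$ and $=u_m$ for $x\ge\bar x$; and $\mathcal{T}[u_m,u_r](x)=u_m$ for $x<\bar x$ and $=\mathcal{T}[u_\ell,u_r](x)$ for $x\ge\bar x$; (II) $\mathcal{T}[u_\ell,u_m](\bar x)=u_m=\mathcal{T}[u_m,u_r](\bar x)$ implies $\mathcal{T}[u_\ell,u_r](x)=\mathcal{T}[u_\ell,u_m](x)$ for $x<\bar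 x$ and $=\mathcal{T}[u_m,u_r](x)$ for $x\ge\bar x$. *)

(* Defs.v *)
From HB Require Import structures.
From mathcomp Require Import all_boot all_order all_algebra.
From mathcomp Require Import all_classical all_reals all_analysis.

Set Implicit Arguments.
Unset Strict Implicit.
Unset Printing Implicit Defensive.

Import Order.TTheory GRing.Theory Num.Theory.
Import numFieldNormedType.Exports.

Local Open Scope classical_set_scope.
Local Open Scope ring_scope.

(* In [PTp p] only the restriction of p to (0, rhomax] matters; p is total
   because a C^2 function on (0, rhomax] is the restriction of a C^2 function
   on (0, +oo), which makes the derivatives at rhomax two-sided. *)
Inductive velocity_law (R : realType) :=
| PTa (a sigma : R)
| PTp (p : R -> R).

(* vmax = V, rhomax = R, qm = q_-, qp = q_+, sm = sigma_-, sp = sigma_+. *)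
Record phase_data (R : realType) := PhaseData {
  law : velocity_law R;
  vmax : R;
  rhomax : R;
  qm : R;
  qp : R;
  sm : R;
  sp : R }.

Section Model.
Context {R : realType}.

(* A state is u = (rho, q). *)
Notation state := (R * R)%type.

Variable P : phase_data R.

Definition wm : R := qm P / rhomax P.
Definition wp : R := qp P / rhomax P.

Definition veq (a sigma rho : R) : R :=
  (rhomax P / rho - 1)
  * (vmax P * sigma / (rhomax P - sigma) + a * (sigma - rho)).

(* At vacuum the speed is V by convention (the vacuum state is free). *)
Definition speed (u : state) : R :=
  if u.1 == 0 then vmax P else
  match law P with
  | PTa a sigma => veq a sigma u.1 * (1 + u.2)
  | PTp p => u.2 / u.1 - p u.1
  end.

Definition flow (u : state) : R := u.1 * speed u.

Definition Qformula (rho : R) : R :=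
  match law P with
  | PTa a sigma =>
      ((rho - sigma)
        * (vmax P * rhomax P + a * (rhomax P - rho) * (rhomax P - sigma)))
      / ((rhomax P - rho)
        * (vmax P * sigma + a * (sigma - rho) * (rhomax P - sigma)))
  | PTp p => rho * (vmax P + p rho)
  end.

Definition Qfree (rho : R) : R :=
  if rho == 0 then lim (Qformula r @[r --> 0^'+]) else Qformula rho.

Definition Omega_f : set state :=
  [set u | 0 <= u.1 <= sp P /\ u.2 = Qfree u.1].

Definition Omega_c : set state :=
  [set u | [/\ sm P <= u.1 <= rhomax P,
               0 <= speed u <= vmax P &
               wm <= u.2 / u.1 <= wp]].

Definition Omega : set state := Omega_f `|` Omega_c.

Definition Omega_fm : set state := Omega_f `&` [set u | u.1 < sm P].
Definition Omega_fp : set state := Omega_f `&` [set u | sm P <= u.1].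
Definition Omega_cm : set state := Omega_c `\` Omega_fp.

(* Within Omega, the states with rho < sigma_- are exactly those of Omega_fm. *)
Definition wcoord (u : state) : R :=
  if u.1 < sm P then wm + vmax P * (u.1 / sm P - 1) else u.2 / u.1.

Definition partial_rho (g : state -> R) (u : state) : R :=
  derive1 (fun r => g (r, u.2)) u.1.
Definition partial_q (g : state -> R) (u : state) : R :=
  derive1 (fun q => g (u.1, q)) u.2.

(* u . grad g; with r_1(u) = u this is also grad g . r_1. *)
Definition grad_dot (g : state -> R) (u : state) : R :=
  u.1 * partial_rho g u + u.2 * partial_q g u.

Definition lambda1 (u : state) : R := speed u + grad_dot speed u.

Definition law_hypotheses : Prop :=
  match law P with
  | PTa a sigma =>
      [/\ 0 < sigma < rhomax P,
          forall u, Omega_c u -> 0 < 1 + u.2 &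
          forall u, Omega_c u ->
            if a == 0 then grad_dot lambda1 u = 0 <-> wcoord u = 0
            else grad_dot lambda1 u <> 0]
  | PTp p =>
      [/\ forall r, 0 < r ->
            [/\ derivable p r 1, derivable (derive1 p) r 1 &
                {for r, continuous (derive1n 2 p)}],
          forall r, 0 < r <= rhomax P ->
            0 < derive1 p r /\ 0 < 2 * derive1 p r + r * derive1n 2 p r,
          p (rhomax P) = wp,
          exists2 r, 0 < r <= rhomax P & p r = wm &
          forall u, Omega_c u -> grad_dot lambda1 u <> 0]
  end.

Definition standing_hypotheses : Prop :=
  [/\ [/\ 0 < vmax P, 0 < rhomax P & qm P < qp P],
      [/\ 0 < sm P, sm P < sp P & sp P < rhomax P],
      [/\ speed (sm P, wm * sm P) = vmax P,
          speed (sp P, wp * sp P) = vmax P &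
          (* For [PTa] this says that the denominator of Q does not vanish. *)
          forall r, 0 < r <= sp P -> speed (r, Qfree r) = vmax P],
      forall u, Omega_c u -> lambda1 u < 0 &
      law_hypotheses].

(* The notions below are given by uniqueness in the text; [get] picks an
   element of the defining set. *)
Definition psi1 (uo : state) : state :=
  get [set u | [/\ Omega_c u, wcoord u = wcoord uo & speed u = vmax P]].

Definition psi2m (uo : state) : state :=
  get [set u | [/\ Omega_c u, wcoord u = wm & speed u = speed uo]].

Definition ustar (ul ur : state) : state :=
  get [set u | [/\ Omega_c u, wcoord u = wcoord ul & speed u = speed ur]].

Definition Lambda (u u' : state) : R := (flow u' - flow u) / (u'.1 - u.1).

(* The state u_p of the tangent phase transition. *)
Definition utangent (ul : state) : state :=
  get [set u | [/\ Omega_c u, wcoord u = wm & Lambda ul u = lambda1 u]].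

(* L_w, on the set of rho with (rho, w rho) in Omega_c, i.e. on
   [rho_1(w), rho_1^0(w)]. *)
Definition Lcurve (w rho : R) : R := flow (rho, w * rho).
Definition Ldom (w : R) : set R := [set rho | Omega_c (rho, w * rho)].

Definition Lconcave (w : R) : Prop :=
  forall rho, Ldom w rho -> derive1n 2 (Lcurve w) rho < 0.
Definition Lconvex (w : R) : Prop :=
  forall rho, Ldom w rho -> 0 < derive1n 2 (Lcurve w) rho.

(* Right-continuous profiles, as functions of x = space / time. *)
Definition profile := R -> state.

(* [f] for x < s and [g] for x >= s. *)
Definition glue (s : R) (f g : profile) : profile :=
  fun x => if x < s then f x else g x.

Definition jump (s : R) (ul ur : state) : profile :=
  glue s (fun=> ul) (fun=> ur).

Definition rarefaction1 (ul ur : state) : profile := fun x =>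
  if x < lambda1 ul then ul
  else if x < lambda1 ur then
    get [set u | [/\ Omega_c u, wcoord u = wcoord ul & lambda1 u = x]]
  else ur.

Definition shock (ul ur : state) : profile := jump (Lambda ul ur) ul ur.

Definition wave1 (ul ur : state) : profile :=
  if `[< Lconcave (wcoord ul) >] then
    if ul.1 < ur.1 then shock ul ur else rarefaction1 ul ur
  else if `[< Lconvex (wcoord ul) >] then
    if ur.1 < ul.1 then shock ul ur else rarefaction1 ul ur
  else shock ul ur.

(* Clauses (R.1)-(R.5), which cover Omega^2; (R.1) and (R.2) overlap on
   Omega_fp^2, where they agree. The value outside Omega^2 is irrelevant. *)
Definition riemann (ul ur : state) : profile :=
  if (ul \in Omega_f) && (ur \in Omega_f) then jump (vmax P) ul ur
  else if (ul \in Omega_c) && (ur \in Omega_c) then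
    glue (speed ur) (wave1 ul (ustar ul ur)) (fun=> ur)
  else if (ul \in Omega_cm) && (ur \in Omega_fm) then
    glue (vmax P) (wave1 ul (psi1 ul)) (fun=> ur)
  else if (ul \in Omega_fm) && (ur \in Omega_cm) then
    if lambda1 (psi2m ur) <= Lambda ul (psi2m ur) then
      glue (speed ur) (shock ul (psi2m ur)) (fun=> ur)
    else
      glue (Lambda ul (utangent ul)) (fun=> ul)
        (glue (speed ur) (rarefaction1 (utangent ul) (psi2m ur)) (fun=> ur))
  else fun=> ur.

(* The trace of a profile: the limit along the filter G. *)
Definition trace (g : profile) (G : set_system R) : state :=
  get [set u : state | g x @[x --> G] --> u].

Variable F : R.

Definition uhat (ul : state) : state :=
  get [set u | [/\ Omega_c u, flow u = F &
                   wcoord u = Num.max (wcoord ul) wm]].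

Definition ucheck (ur : state) : state :=
  get [set u | [/\ Omega u, flow u = F &
                   speed u = if F < flow (psi2m ur) then vmax P
                             else speed ur]].

Definition D1 (ul ur : state) : Prop :=
  [/\ Omega ul, Omega ur,
      flow (trace (riemann ul ur) 0^'-) <= F &
      flow (trace (riemann ul ur) 0^'+) <= F].

Definition constrained_riemann (ul ur : state) : profile :=
  if `[< D1 ul ur >] then riemann ul ur
  else glue 0 (riemann ul (uhat ul)) (riemann (ucheck ur) ur).

End Model.

Section Solvers.
Context {R : realType}.
Notation state := (R * R)%type.
Notation mu := (@lebesgue_measure R).

Variables (Om : set state) (T : state -> state -> R -> state).

(* T maps Om^2 into L^oo(R; Om). *)
Definition Linfty_solver : Prop :=
  forall ul ur, Om ul -> Om ur ->
    [/\ forall x, Om (T ul ur x),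
        (fun x => (T ul ur x).1) \in Lfun mu +oo%E &
        (fun x => (T ul ur x).2) \in Lfun mu +oo%E].

Definition L1loc_cvg (g : nat -> R -> state) (h : R -> state) : Prop :=
  forall K : set R, compact K ->
    (\int[mu]_(x in K) (`|g n x - h x|)%:E)%E @[n --> \oo] --> 0%E.

Definition L1loc_continuous : Prop :=
  forall (ul ur : state) (uls urs : nat -> state),
    Om ul -> Om ur -> (forall n, Om (uls n)) -> (forall n, Om (urs n)) ->
    uls n @[n --> \oo] --> ul -> urs n @[n --> \oo] --> ur ->
    L1loc_cvg (fun n => T (uls n) (urs n)) (T ul ur).

Definition consistentI : Prop :=
  forall (ul um ur : state) (xbar : R), Om ul -> Om um -> Om ur ->
    T ul ur xbar = um ->
    T ul um =1 glue xbar (T ul ur) (fun=> um) /\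
    T um ur =1 glue xbar (fun=> um) (T ul ur).

Definition consistentII : Prop :=
  forall (ul um ur : state) (xbar : R), Om ul -> Om um -> Om ur ->
    T ul um xbar = um -> T um ur xbar = um ->
    T ul ur =1 glue xbar (T ul um) (T um ur).

Definition consistent : Prop := consistentI /\ consistentII.

End Solvers.

(* Main.v *)
(* On Omega_c use the coordinates (w, v), and extend each flux
   r |-> f(r, w r) below its free endpoint by the free branch r |-> V r. The
   Riemann solver R[ul, ur] is then, for x < v(ur), the right-continuous
   Lax--Oleinik solution of a scalar law on the curve w = max(w(ul), w_-), going
   from rho(ul) to the state of speed v(ur), and it equals ur for x >= v(ur).
   Shocks, rarefactions and phase transitions are all last minimisers (or
   maximisers) of r |-> G_w(r) - x r. Since 1-waves have negative speed, the
   flow at x = 0 is the minimum phi0 of the largest flow that ul can emit and of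
   the flow f_w(v(ur)) of the state of speed v(ur) on that curve. With
   phi = min(phi0, F), the constrained solver is: for x < 0 the scalar solution
   towards the state of flow min(f_w(v(ur)), F), for 0 <= x < v(ur) a profile
   depending only on (phi, v(ur)), and ur beyond. All these data depend continuously on
   (ul, ur); a limit of minimisers is a minimiser, and minimisers are unique
   for all but finitely many x, whence pointwise, hence L1_loc, convergence.
   Property (II) is the gluing property of last minimisers. Property (I) fails
   for ul = um = ur = (sigma_+, w_+ sigma_+), whose flow exceeds F. *)
Require Import Defs.
From HB Require Import structures.
From mathcomp Require Import all_boot all_order all_algebra.
From mathcomp Require Import all_classical all_reals all_analysis.
From mathcomp Require Import measurable_realfun ess_sup_inf.
From mathcomp Require Import ring lra.

Set Implicit Arguments.
Unset Strict Implicit.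
Unset Printing Implicit Defensive.

Import Order.TTheory GRing.Theory Num.Theory.
Import numFieldNormedType.Exports.

Local Open Scope classical_set_scope.
Local Open Scope ring_scope.

(** * The two velocity laws *)

(** Waves cannot be compared one by one: for PTa with a = 0 the sign of L_w'' is that of -w, so
    along a convergent sequence of data a curve may pass from concave to convex and a shock may have
    to be compared with a rarefaction. The variational form is indifferent to this. It needs only
    the sign of the slope on the congested part and one exceptional speed per side, since minimisers
    tie only at a jump and each scalar profile has at most one. The definition of the constrained
    solver also has seams: the border of [D1], and the switch of \check u from free to congested as
    F crosses v * [rho (wm P) v]. They disappear when each side gets its own scalar data. On the
    left the target can be cut at flow F even inside [D1]: if the cut changes it there, ul is a free
    state of flow at most F, which stays put for x < 0 with either target. On the right, ul enters
    only through the flow at x = 0. Two places need separate care: vacuum, where Q is defined by a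
    limit that has to be shown to exist, and speed zero at full density, where for PTa all curves
    meet and (flow, speed) no longer determines the state. *)

Section DeriveCalculus.
Context {R : realType}.
Implicit Types (f g : R -> R) (x k : R).

Lemma is_deriveD1 f g x df dg : is_derive x (1 : R) f df ->
  is_derive x (1 : R) g dg -> is_derive x (1 : R) (fun r => f r + g r) (df + dg).
Proof. by move=> ? ?; exact: is_deriveD. Qed.

Lemma is_deriveB1 f g x df dg : is_derive x (1 : R) f df ->
  is_derive x (1 : R) g dg -> is_derive x (1 : R) (fun r => f r - g r) (df - dg).
Proof. by move=> ? ?; exact: is_deriveB. Qed.

Lemma is_deriveN1 f x df : is_derive x (1 : R) f df ->
  is_derive x (1 : R) (fun r => - f r) (- df).
Proof. by move=> ?; exact: is_deriveN. Qed.

Lemma is_deriveM1 f g x df dg : is_derive x (1 : R) f df ->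
  is_derive x (1 : R) g dg ->
  is_derive x (1 : R) (fun r => f r * g r) (f x * dg + g x * df).
Proof. by move=> ? ?; exact: is_deriveM. Qed.

Lemma is_derivec x k : is_derive x (1 : R) (fun=> k) 0.
Proof. exact: is_derive_cst. Qed.

Lemma is_derive_idr x : is_derive x (1 : R) (fun r => r) 1.
Proof. exact: is_derive_id. Qed.

Lemma is_derive_invr x : x != 0 ->
  is_derive x (1 : R) (fun r => r^-1) (- x ^- 2).
Proof.
move=> x0; have := @is_deriveV R id x 1 1 x0 (is_derive_id _ _).
by move=> h; apply: is_derive_eq h _; rewrite /GRing.scale/= mulr1.
Qed.

(** [speed] has a special value at vacuum and the model formulas hold only for positive density, so
    derivatives are computed on an expression that agrees with the function near the point. *)
Lemma near_derive1 f g x df : (\forall y \near x, f y = g y) ->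
  is_derive x (1 : R) g df -> derive1 f x = df.
Proof.
move=> fg [gd <-]; rewrite derive1E; exact: near_eq_derive.
Qed.

Lemma near_pos x : 0 < x -> \forall y \near x, 0 < y.
Proof. by move=> x0; exact: lt_nbhsr. Qed.

End DeriveCalculus.

(** The derivative is assembled from the syntax of the function as an existential variable; its
    equality with the claimed value is a separate goal, left to [field] or [ring]. *)
Ltac derive_tac :=
  repeat first
    [ notypeclasses refine (is_derivec _ _)
    | notypeclasses refine (is_derive_idr _)
    | notypeclasses refine (is_deriveM1 _ _)
    | notypeclasses refine (is_deriveB1 _ _)
    | notypeclasses refine (is_deriveD1 _ _)
    | notypeclasses refine (is_deriveN1 _)
    | notypeclasses refine (is_derive_invr _) ].

Ltac derive_to := notypeclasses refine (is_derive_eq _ _);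
  [derive_tac; try assumption | idtac].

Section LawA.
Context {R : realType}.
Variables (P : phase_data R) (a sg : R).
Hypothesis lawP : law P = PTa a sg.
Implicit Types (r q w y : R).
Local Notation V := (vmax P).
Local Notation M := (rhomax P).
Hypothesis sgM : M - sg != 0.
Local Notation K r := (V * sg / (M - sg) + a * (sg - r)).

Lemma speed_PTa (u : R * R) : u.1 != 0 ->
  speed P u = (M / u.1 - 1) * K u.1 * (1 + u.2).
Proof. by move=> u0; rewrite /speed (negbTE u0) lawP. Qed.

Lemma lambda1_PTa r q : 0 < r ->
  lambda1 P (r, q)
  = (1 + q) * (- K r - a * (M - r)) + q * ((M / r - 1) * K r).
Proof.
move=> r0; have rn0 : r != 0 by rewrite gt_eqF.
have Hr : partial_rho (speed P) (r, q)
    = (1 + q) * (- (M / r ^+ 2) * K r - a * (M / r - 1)).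
  apply: (near_derive1 (g := fun y => (M / y - 1) * K y * (1 + q))).
    by near=> y; rewrite speed_PTa//= gt_eqF//; near: y; exact: near_pos.
  derive_to.
  by rewrite /GRing.scale/=; field; rewrite ?rn0 ?sgM.
have Hq : partial_q (speed P) (r, q) = (M / r - 1) * K r.
  apply: (near_derive1 (g := fun y => (M / r - 1) * K r * (1 + y))).
    by near=> y; rewrite speed_PTa.
  derive_to.
  by rewrite /GRing.scale/=; field; rewrite ?rn0 ?sgM.
rewrite /lambda1 /grad_dot Hr Hq speed_PTa//=.
by field; rewrite ?rn0 ?sgM.
Unshelve. all: by end_near. Qed.

Lemma grad_lambda1_PTa r q : 0 < r ->
  grad_dot (lambda1 P) (r, q)
  = 2 * a * r * (1 + q) - 2 * q * (K r + a * (M - r)).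
Proof.
move=> r0; have rn0 : r != 0 by rewrite gt_eqF.
have Hr : partial_rho (lambda1 P) (r, q)
    = (1 + q) * (2 * a) + q * (- (M / r ^+ 2) * K r - a * (M / r - 1)).
  apply: (near_derive1 (g := fun y =>
    (1 + q) * (- K y - a * (M - y)) + q * ((M / y - 1) * K y))).
    by near=> y; rewrite lambda1_PTa//; near: y; exact: near_pos.
  derive_to.
  by rewrite /GRing.scale/=; field; rewrite ?rn0 ?sgM.
have Hq : partial_q (lambda1 P) (r, q)
    = (- K r - a * (M - r)) + (M / r - 1) * K r.
  apply: (near_derive1 (g := fun y =>
    (1 + y) * (- K r - a * (M - r)) + y * ((M / r - 1) * K r))).
    by near=> y; rewrite lambda1_PTa.
  derive_to.
  by rewrite /GRing.scale/=; field; rewrite ?rn0 ?sgM.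
rewrite /grad_dot Hr Hq/=.
by field; rewrite ?rn0 ?sgM.
Unshelve. all: by end_near. Qed.

Lemma Lcurve_PTa w r : 0 < r -> Lcurve P w r = (M - r) * K r * (1 + w * r).
Proof.
move=> r0; have rn0 : r != 0 by rewrite gt_eqF.
by rewrite /Lcurve /flow speed_PTa//=; field; rewrite ?rn0 ?sgM.
Qed.

Lemma derive2_Lcurve_PTa w r : 0 < r ->
  derive1n 2 (Lcurve P w) r
  = 2 * (a * (1 + w * r) - w * (K r + a * (M - r))).
Proof.
move=> r0; rewrite /derive1n/=.
pose g y := w * (M - y) * K y + (1 + w * y) * (- K y - a * (M - y)).
apply: (near_derive1 (g := g)).
  near=> y.
  have y0 : 0 < y by near: y; exact: near_pos.
  have yn0 : y != 0 by rewrite gt_eqF.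
  apply: (near_derive1 (g := fun y => (M - y) * K y * (1 + w * y))).
    by near=> z; rewrite Lcurve_PTa//; near: z; exact: near_pos.
  derive_to.
  by rewrite /g /GRing.scale/=; field.
rewrite /g; derive_to.
by rewrite /GRing.scale/=; field.
Unshelve. all: by end_near. Qed.

(** L_w is a cubic for PTa, so L_w'' is affine and Taylor's formula is exact with L_w'' taken one
    third of the way from [y] to [r]. The sign of L_w'' thus decides on which side of its tangents
    the graph lies. *)
Lemma flow_PTa_tangent w r y : 0 < r -> 0 < y ->
  r * speed P (r, w * r) - y * speed P (y, w * y)
    - lambda1 P (y, w * y) * (r - y)
  = (r - y) ^+ 2 * (derive1n 2 (Lcurve P w) ((2 * y + r) / 3) / 2).
Proof.
move=> r0 y0.
rewrite derive2_Lcurve_PTa; last by rewrite divr_gt0// addr_gt0// mulr_gt0.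
rewrite !speed_PTa ?gt_eqF// lambda1_PTa//=.
by field; rewrite sgM !gt_eqF.
Qed.

End LawA.

Section LawP.
Context {R : realType}.
Variables (P : phase_data R) (p : R -> R).
Hypothesis lawP : law P = PTp p.
Implicit Types (r q w y : R).
Hypothesis p1 : forall r, 0 < r -> derivable p r 1.

Lemma speed_PTp (u : R * R) : u.1 != 0 -> speed P u = u.2 / u.1 - p u.1.
Proof. by move=> u0; rewrite /speed (negbTE u0) lawP. Qed.

Lemma is_derive_p r : 0 < r -> is_derive r (1 : R) p (derive1 p r).
Proof. by move=> r0; rewrite derive1E; exact/derivableP/p1. Qed.

Lemma lambda1_PTp r q : 0 < r ->
  lambda1 P (r, q) = q / r - p r - r * derive1 p r.
Proof.
move=> r0; have rn0 : r != 0 by rewrite gt_eqF.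
have Hr : partial_rho (speed P) (r, q) = - (q / r ^+ 2) - derive1 p r.
  apply: (near_derive1 (g := fun y => q / y - p y)).
    by near=> y; rewrite speed_PTp//= gt_eqF//; near: y; exact: near_pos.
  derive_to; first exact: is_derive_p.
  by rewrite /GRing.scale/=; field; rewrite ?rn0.
have Hq : partial_q (speed P) (r, q) = r^-1.
  apply: (near_derive1 (g := fun y => y / r - p r)).
    by near=> y; rewrite speed_PTp.
  derive_to.
  by rewrite /GRing.scale/=; field; rewrite ?rn0.
rewrite /lambda1 /grad_dot Hr Hq speed_PTp//=.
by field; rewrite ?rn0.
Unshelve. all: by end_near. Qed.

Hypothesis p2 : forall r, 0 < r -> derivable (derive1 p) r 1.

Lemma is_derive_dp r : 0 < r ->
  is_derive r (1 : R) (derive1 p) (derive1n 2 p r).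
Proof. by move=> r0; rewrite /derive1n/= derive1E; exact/derivableP/p2. Qed.

Lemma Lcurve_PTp w r : 0 < r -> Lcurve P w r = r * (w - p r).
Proof.
move=> r0; have rn0 : r != 0 by rewrite gt_eqF.
by rewrite /Lcurve /flow speed_PTp//=; field.
Qed.

Lemma is_derive_Lcurve_PTp w r : 0 < r ->
  is_derive r (1 : R) (Lcurve P w) (lambda1 P (r, w * r)).
Proof.
move=> r0; apply: (near_eq_is_derive (f := fun y => y * (w - p y))).
  by near=> z; rewrite Lcurve_PTp//; near: z; exact: near_pos.
derive_to; first exact: is_derive_p.
by rewrite lambda1_PTp// /GRing.scale/=; field; rewrite gt_eqF.
Unshelve. all: by end_near. Qed.

Lemma is_derive_lambda1_PTp w r : 0 < r ->
  is_derive r (1 : R) (fun y => lambda1 P (y, w * y))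
    (- (2 * derive1 p r + r * derive1n 2 p r)).
Proof.
move=> r0; apply: (near_eq_is_derive
    (f := fun y => w - p y - y * derive1 p y)).
  near=> z; have z0 : 0 < z by near: z; exact: near_pos.
  by rewrite lambda1_PTp// mulfK// gt_eqF.
derive_to; [exact: is_derive_p|exact: is_derive_dp|].
by rewrite /derive1n /GRing.scale/=; ring.
Unshelve. all: by end_near. Qed.

Lemma derive2_Lcurve_PTp w r : 0 < r ->
  derive1n 2 (Lcurve P w) r = - (2 * derive1 p r + r * derive1n 2 p r).
Proof.
move=> r0; rewrite [LHS]/derive1n/=.
apply: near_derive1; last exact: (is_derive_lambda1_PTp w r0).
near=> y; have y0 : 0 < y by near: y; exact: near_pos.
by have [_ <-] := is_derive_Lcurve_PTp w y0; rewrite derive1E.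
Unshelve. all: by end_near. Qed.

End LawP.

Section Basics.
Context {R : realType}.
Variable P : phase_data R.
Hypothesis hP : standing_hypotheses P.
Implicit Types (r q w y v : R) (u : R * R).
Local Notation V := (vmax P).
Local Notation M := (rhomax P).

Definition cspeed w r := speed P (r, w * r).
Definition clambda w r := lambda1 P (r, w * r).
Definition wrange w := wm P <= w <= wp P.

(** Strict concavity, and below it strict convexity and linearity, of L_w, expressed by the position
    of the graph relative to the tangent of slope [clambda]. No second derivative occurs, so both
    laws can be treated alike from here on. *)
Definition tangent_above w := forall r y, Omega_c P (r, w * r) ->
  Omega_c P (y, w * y) -> r != y ->
  r * cspeed w r < y * cspeed w y + clambda w y * (r - y).
Definition tangent_below w := forall r y, Omega_c P (r, w * r) ->
  Omega_c P (y, w * y) -> r != y ->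
  y * cspeed w y + clambda w y * (r - y) < r * cspeed w r.
Definition tangent_on w := forall r y, Omega_c P (r, w * r) ->
  Omega_c P (y, w * y) ->
  r * cspeed w r = y * cspeed w y + clambda w y * (r - y).

Lemma vmax_gt0 : 0 < V. Proof. by case: hP => -[]. Qed.
Lemma rhomax_gt0 : 0 < M. Proof. by case: hP => -[]. Qed.
Lemma sm_gt0 : 0 < sm P. Proof. by case: hP => _ []. Qed.
Lemma sm_lt_sp : sm P < sp P. Proof. by case: hP => _ []. Qed.
Lemma sp_lt_rhomax : sp P < M. Proof. by case: hP => _ []. Qed.
Lemma sm_lt_rhomax : sm P < M.
Proof. exact: lt_trans sm_lt_sp sp_lt_rhomax. Qed.
Lemma wm_lt_wp : wm P < wp P.
Proof.
by case: hP => -[_ M0 h] _ _ _ _; rewrite /wm /wp ltr_pM2r ?invr_gt0.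
Qed.
Lemma cspeed_sm : cspeed (wm P) (sm P) = V. Proof. by case: hP => _ _ []. Qed.
Lemma cspeed_sp : cspeed (wp P) (sp P) = V. Proof. by case: hP => _ _ []. Qed.
Lemma speed_Qfree r : 0 < r <= sp P -> speed P (r, Qfree P r) = V.
Proof. by case: hP => _ _ [_ _ h] _ _; exact: h. Qed.
Lemma lambda1_lt0 u : Omega_c P u -> lambda1 P u < 0.
Proof. by case: hP => _ _ _ h _; exact: h. Qed.

Lemma wm_range : wrange (wm P). Proof. by rewrite /wrange lexx ltW// wm_lt_wp. Qed.
Lemma wp_range : wrange (wp P). Proof. by rewrite /wrange lexx ltW// wm_lt_wp. Qed.

Lemma Omega_cE w r : Omega_c P (r, w * r) <->
  [/\ sm P <= r <= M, 0 <= cspeed w r <= V & wrange w].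
Proof.
rewrite /Omega_c/= /wrange; split => -[h1 h2 h3]; split => //; move: h3;
  by rewrite mulfK// gt_eqF// (lt_le_trans sm_gt0)//; case/andP: h1.
Qed.

Lemma Omega_c_rho_gt0 u : Omega_c P u -> 0 < u.1.
Proof. by case=> /andP[h _] _ _; exact: lt_le_trans sm_gt0 h. Qed.

Lemma Omega_c_eta u : Omega_c P u -> u = (u.1, u.2 / u.1 * u.1).
Proof.
move=> /Omega_c_rho_gt0 u0; rewrite divfK ?gt_eqF//; exact: surjective_pairing.
Qed.

Lemma Omega_c_sm : Omega_c P (sm P, wm P * sm P).
Proof.
apply/Omega_cE; rewrite cspeed_sm !lexx ltW ?ltW ?vmax_gt0 ?sm_lt_rhomax//.
by split => //; exact: wm_range.
Qed.

Lemma Omega_c_sp : Omega_c P (sp P, wp P * sp P).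
Proof.
apply/Omega_cE; rewrite cspeed_sp !lexx (ltW sm_lt_sp) (ltW sp_lt_rhomax).
by rewrite ltW ?vmax_gt0//; split => //; exact: wp_range.
Qed.

End Basics.

(** The expression is [u - l] times the value at [r] of the affine function with end values [f0] and
    [f1]. *)
Lemma affine_gt0 {R : realDomainType} (l u r f0 f1 : R) :
  l < u -> l <= r <= u -> 0 < f0 -> 0 < f1 ->
  0 < f0 * (u - r) + f1 * (r - l).
Proof.
move=> lu /andP[lr ru] f0p f1p; have [rl|rl] := ltP l r.
  by apply: ltr_wpDl; [apply: mulr_ge0|apply: mulr_gt0];
    rewrite ?subr_ge0 ?subr_gt0// ltW.
have -> : r = l by apply/le_anti; rewrite rl.
by rewrite subrr mulr0 addr0 mulr_gt0// subr_gt0.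
Qed.

Section FactsA.
Context {R : realType}.
Variable P : phase_data R.
Hypothesis hP : standing_hypotheses P.
Implicit Types (r q w y v : R) (u : R * R).
Local Notation V := (vmax P).
Local Notation M := (rhomax P).
Variables (a sg : R).
Hypothesis lawP : law P = PTa a sg.
Local Notation K r := (V * sg / (M - sg) + a * (sg - r)).

Lemma sg_range : 0 < sg < M.
Proof. by case: hP => _ _ _ _; rewrite /law_hypotheses lawP => -[]. Qed.

Lemma sgM : M - sg != 0.
Proof. by rewrite subr_eq0 gt_eqF//; case/andP: sg_range. Qed.

Lemma one_plus_q_gt0 u : Omega_c P u -> 0 < 1 + u.2.
Proof.
by case: hP => _ _ _ _; rewrite /law_hypotheses lawP => -[_ h _]; exact: h.
Qed.

Lemma cspeedA w r : 0 < r -> cspeed P w r = (M / r - 1) * K r * (1 + w * r).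
Proof. by move=> r0; rewrite /cspeed (speed_PTa lawP)//= gt_eqF. Qed.

Lemma cspeedA_rhomax w : cspeed P w M = 0.
Proof.
have M0 := rhomax_gt0 hP.
by rewrite cspeedA// divff ?gt_eqF// subrr !mul0r.
Qed.

Lemma Omega_cA_rhomax w : wrange P w -> Omega_c P (M, w * M).
Proof.
move=> Ww; apply/(Omega_cE hP); rewrite cspeedA_rhomax !lexx.
by rewrite (ltW (sm_lt_rhomax hP)) (ltW (vmax_gt0 hP)).
Qed.

Lemma ratio_gt0 r : 0 < r < M -> 0 < M / r - 1.
Proof. by case/andP=> r0 rM; rewrite subr_gt0 ltr_pdivlMr// mul1r. Qed.

(** The factor is affine in [r], so its end values suffice. At [sm P] the sign comes from the speed
    V > 0; at full density from [lambda1 < 0], which reads -(1 + q) K < 0 there. *)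
Lemma KA_gt0 r : sm P <= r <= M -> 0 < K r.
Proof.
move=> rr; have s0 := sm_gt0 hP; have sM := sm_lt_rhomax hP.
have Ks : 0 < K (sm P).
  have := vmax_gt0 hP; rewrite -{1}(cspeed_sm hP) cspeedA//.
  rewrite pmulr_lgt0; last exact: (one_plus_q_gt0 (Omega_c_sm hP)).
  by rewrite pmulr_rgt0// ratio_gt0// s0.
have KM : 0 < K M.
  have Oc := Omega_cA_rhomax (wm_range hP).
  have := lambda1_lt0 hP Oc; rewrite (lambda1_PTa lawP sgM) ?rhomax_gt0//.
  rewrite divff ?gt_eqF ?rhomax_gt0// !subrr mul0r !mulr0 addr0 subr0 mulrN.
  by rewrite oppr_lt0 pmulr_rgt0// (one_plus_q_gt0 Oc).
set c := V * sg / (M - sg) in Ks KM *.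
have e : (c + a * (sg - sm P)) * (M - r) + (c + a * (sg - M)) * (r - sm P)
  = (c + a * (sg - r)) * (M - sm P) by ring.
by have := affine_gt0 sM rr Ks KM; rewrite e pmulr_lgt0// subr_gt0.
Qed.

(** The state of density [sm P] on the curve [w] may be faster than V and so lie outside [Omega_c],
    where 1 + q > 0 is not known; at that end the bound comes from the curve w_-. *)
Lemma one_plus_wr_gt0 w r : wrange P w -> sm P <= r <= M -> 0 < 1 + w * r.
Proof.
move=> Ww rr; have s0 := sm_gt0 hP; have sM := sm_lt_rhomax hP.
have h1 := one_plus_q_gt0 (Omega_cA_rhomax Ww).
have h2 := one_plus_q_gt0 (Omega_c_sm hP); rewrite /= in h1 h2.
move: Ww => /andP[Ww _].
have hs : 0 < 1 + w * sm P.
  by apply: lt_le_trans h2 _; rewrite lerD2l ler_pM2r.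
have e : (1 + w * sm P) * (M - r) + (1 + w * M) * (r - sm P)
  = (1 + w * r) * (M - sm P) by ring.
by have := affine_gt0 sM rr hs h1; rewrite e pmulr_lgt0// subr_gt0.
Qed.

Lemma cspeedA_gt0 w r : wrange P w -> sm P <= r < M -> 0 < cspeed P w r.
Proof.
move=> Ww /andP[r1 r2]; have r0 := lt_le_trans (sm_gt0 hP) r1.
have rr : sm P <= r <= M by rewrite r1 ltW.
by rewrite cspeedA// !mulr_gt0// ?ratio_gt0 ?r0// ?KA_gt0 ?one_plus_wr_gt0.
Qed.

Lemma cspeedA_mono w1 w2 r : sm P <= r < M -> w1 < w2 ->
  cspeed P w1 r < cspeed P w2 r.
Proof.
move=> /andP[r1 r2] w12; have r0 := lt_le_trans (sm_gt0 hP) r1.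
have rr : sm P <= r <= M by rewrite r1 ltW.
rewrite !cspeedA// ltr_pM2l ?ltrD2l ?ltr_pM2r//.
by rewrite mulr_gt0// ?ratio_gt0 ?r0// KA_gt0.
Qed.

End FactsA.

Section SpeedContinuity.
Context {R : realType}.
Variable P : phase_data R.
Hypothesis hP : standing_hypotheses P.
Implicit Types (r q w y v : R) (u : R * R).
Local Notation V := (vmax P).
Local Notation M := (rhomax P).

Lemma PTp_derivable p r : law P = PTp p -> 0 < r -> derivable p r 1.
Proof.
by move=> lawP r0; case: hP => _ _ _ _; rewrite /law_hypotheses lawP
  => -[/(_ _ r0)[]].
Qed.

Lemma PTp_derivable2 p r : law P = PTp p -> 0 < r ->
  derivable (derive1 p) r 1.
Proof.
by move=> lawP r0; case: hP => _ _ _ _; rewrite /law_hypotheses lawP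
  => -[/(_ _ r0)[]].
Qed.

Lemma derivable_continuous (f : R -> R) r : derivable f r 1 ->
  {for r, continuous f}.
Proof. by move=> /derivable1_diffP /differentiable_continuous. Qed.

Lemma speed_cvg {T} {F : set_system T} {FF : Filter F} (f g : T -> R) r q :
  0 < r -> f t @[t --> F] --> r -> g t @[t --> F] --> q ->
  speed P (f t, g t) @[t --> F] --> speed P (r, q).
Proof.
move=> r0 fr gq; have fpos : \forall t \near F, 0 < f t.
  exact: (fr _ (near_pos r0)).
case lawP : (law P) => [a sg|p].
  rewrite (speed_PTa lawP) /= ?gt_eqF//.
  apply: cvg_trans.
    apply: (near_eq_cvg (f := fun t => (M / f t - 1)
      * (V * sg / (M - sg) + a * (sg - f t)) * (1 + g t))).
    near=> t; rewrite (speed_PTa lawP)//= gt_eqF//.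
    by near: t.
  apply: cvgM; last by apply: cvgD => //; exact: cvg_cst.
  apply: cvgM; last first.
    apply: cvgD; first exact: cvg_cst.
    by apply: cvgM; [exact: cvg_cst|apply: cvgB => //; exact: cvg_cst].
  apply: cvgB; last exact: cvg_cst.
  apply: cvgM; first exact: cvg_cst.
  by apply: cvgV => //; rewrite gt_eqF.
rewrite (speed_PTp lawP) /= ?gt_eqF//.
apply: cvg_trans.
  apply: (near_eq_cvg (f := fun t => g t / f t - p (f t))).
  near=> t; rewrite (speed_PTp lawP)//= gt_eqF//.
  by near: t.
apply: cvgB.
  by apply: cvgM => //; apply: cvgV => //; rewrite gt_eqF.
by apply: cvg_comp fr _; apply: derivable_continuous; exact: PTp_derivable.
Unshelve. all: by end_near. Qed.

Lemma cspeed_cvg {T} {F : set_system T} {FF : Filter F} (f g : T -> R) r w :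
  0 < r -> f t @[t --> F] --> w -> g t @[t --> F] --> r ->
  cspeed P (f t) (g t) @[t --> F] --> cspeed P w r.
Proof. by move=> r0 fw gr; apply: speed_cvg => //; exact: cvgM. Qed.

Lemma cspeed_continuous w r : 0 < r -> {for r, continuous (cspeed P w)}.
Proof. by move=> r0; apply: cspeed_cvg => //; exact: cvg_cst. Qed.

Lemma cspeed_within w l b : 0 < l ->
  {within `[l, b], continuous (cspeed P w)}.
Proof.
move=> l0; apply: continuous_in_subspaceT => r; rewrite inE/= in_itv/=.
by move=> /andP[lr _]; apply: cspeed_continuous; exact: lt_le_trans lr.
Qed.

Lemma clambda_continuous w r : 0 < r -> {for r, continuous (clambda P w)}.
Proof.
move=> r0; have rr : y @[y --> r] --> r by exact: cvg_id.
have wr : w * y @[y --> r] --> w * r by apply: cvgM => //; exact: cvg_cst.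
rewrite /prop_for/continuous_at /clambda; case lawP : (law P) => [a sg|p].
  have sgM := sgM hP lawP.
  rewrite (lambda1_PTa lawP sgM)//.
  apply: cvg_trans.
    apply: (near_eq_cvg (f := fun y => (1 + w * y) *
      (- (V * sg / (M - sg) + a * (sg - y)) - a * (M - y)) + w * y *
      ((M / y - 1) * (V * sg / (M - sg) + a * (sg - y))))).
    near=> y; rewrite (lambda1_PTa lawP sgM)//; near: y; exact: near_pos.
  have h1 : V * sg / (M - sg) + a * (sg - y) @[y --> r]
      --> V * sg / (M - sg) + a * (sg - r).
    apply: cvgD; first exact: cvg_cst.
    by apply: cvgM; [exact: cvg_cst|apply: cvgB => //; exact: cvg_cst].
  apply: cvgD; apply: cvgM => //.
  - by apply: cvgD => //; exact: cvg_cst.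
  - apply: cvgB; first exact: cvgN.
    by apply: cvgM; [exact: cvg_cst|apply: cvgB => //; exact: cvg_cst].
  - apply: cvgM => //; apply: cvgB; last exact: cvg_cst.
    apply: cvgM; first exact: cvg_cst.
    by apply: cvgV => //; rewrite gt_eqF.
have p1 y : 0 < y -> derivable p y 1 by exact: PTp_derivable.
rewrite (lambda1_PTp lawP p1)//.
apply: cvg_trans.
  apply: (near_eq_cvg (f := fun y => w * y / y - p y - y * derive1 p y)).
  near=> y; rewrite (lambda1_PTp lawP p1)//; near: y; exact: near_pos.
apply: cvgB; last first.
  apply: cvgM => //; apply: derivable_continuous.
  exact: (PTp_derivable2 lawP).
apply: cvgB; last by apply: derivable_continuous; exact: p1.
by apply: cvgM => //; apply: cvgV => //; rewrite gt_eqF.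
Unshelve. all: by end_near. Qed.

End SpeedContinuity.

(** * Monotonicity of the speed in the density and in w *)

Section Decreasing.
Context {R : realType}.
Variable P : phase_data R.
Hypothesis hP : standing_hypotheses P.
Implicit Types (r q w y v : R) (u : R * R).
Local Notation V := (vmax P).
Local Notation M := (rhomax P).

Lemma quadratic_drop (A B C d : R) : A < 0 -> 0 < d ->
  exists2 e, 0 < e <= d & e * A + e ^+ 2 * (B + C * e) < 0.
Proof.
(* [N] dominates [B + C * e] for [e] up to [d]; a step of at most half of [- A / N] leaves the
   linear term in control. *)
move=> A0 d0; pose N := `|B| + `|C| * d + 1.
have N0 : 0 < N by rewrite ltr_wpDl// addr_ge0// mulr_ge0// ltW.
pose e := Num.min d (- A / (2 * N)).
have e0 : 0 < e by rewrite lt_min d0 divr_gt0 ?oppr_gt0// mulr_gt0.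
have ed : e <= d by rewrite ge_min lexx.
have eN : e * N < - A.
  apply: (@le_lt_trans _ _ (- A / (2 * N) * N)).
    by rewrite ler_pM2r// ge_min lexx orbT.
  have -> : - A / (2 * N) * N = - A / 2 by field; rewrite gt_eqF.
  lra.
exists e; first by rewrite e0.
rewrite expr2 -mulrA -mulrDr pmulr_rlt0//.
have : B + C * e < N.
  apply: le_lt_trans (_ : `|B| + `|C| * d < N); last by rewrite ltrDl.
  apply: lerD; first exact: ler_norm.
  apply: le_trans (ler_norm _) _; rewrite normrM ler_wpM2l//.
  by rewrite gtr0_norm.
move=> h; have {}h : e * (B + C * e) < e * N by rewrite ltr_pM2l.
lra.
Qed.

(* A minimum point of the speed on [r1, r2] cannot lie left of r2, because
   lambda1 < 0 makes the speed decrease strictly there. *)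
Lemma cspeedA_decr a sg w r1 r2 : law P = PTa a sg -> wrange P w ->
  sm P <= r1 -> r1 < r2 -> r2 <= M -> cspeed P w r1 <= V ->
  cspeed P w r2 < cspeed P w r1.
Proof.
move=> lawP Ww r1s r12 r2M v1V.
have pos r : r1 <= r -> 0 < r.
  by move=> h; apply: lt_le_trans (sm_gt0 hP) (le_trans r1s h).
have drop c : r1 <= c -> c < r2 -> cspeed P w c <= V ->
    exists2 t, c < t <= r2 & cspeed P w t < cspeed P w c.
  move=> r1c cr2 cV; have c0 := pos _ r1c.
  have Oc : Omega_c P (c, w * c).
    apply/(Omega_cE hP); split => //; apply/andP; split => //.
    - exact: le_trans r1c.
    - exact: ltW (lt_le_trans cr2 r2M).
    apply: ltW; apply: (cspeedA_gt0 hP lawP) => //.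
    by rewrite (le_trans r1s)//= (lt_le_trans cr2).
  have sgM := sgM hP lawP.
  have l0 := lambda1_lt0 hP Oc.
  (* L_w'' has slope 6 a w, so half of it, taken one third of the way from [c] to [c + e], is
     [B + C * e]. *)
  pose B := derive1n 2 (Lcurve P w) c / 2; pose C := a * w.
  have [e /andP[e0 er] he] := @quadratic_drop (lambda1 P (c, w * c)) B C
    (r2 - c) l0 (ltac:(by rewrite subr_gt0)).
  exists (c + e); first by rewrite ltrDl e0 -lerBrDl.
  have ce0 : 0 < c + e by rewrite addr_gt0.
  have := flow_PTa_tangent lawP sgM w ce0 c0.
  rewrite -[speed P (c, _)]/(cspeed P w c) -[speed P _]/(cspeed P w (c + e)).
  rewrite (addrC c e) addrK.
  have -> : derive1n 2 (Lcurve P w) ((2 * c + (e + c)) / 3) / 2 = B + C * e.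
    have z0 : 0 < (2 * c + (e + c)) / 3.
      by rewrite divr_gt0// addr_gt0 ?mulr_gt0// addr_gt0.
    by rewrite /B /C !(derive2_Lcurve_PTa lawP sgM)//; field.
  (* The flow drops while the density grows, hence the speed drops. *)
  move=> h; have : (e + c) * cspeed P w (e + c) < c * cspeed P w c by lra.
  have : 0 <= cspeed P w c by case/(Omega_cE hP): Oc => _ /andP[].
  move=> vc0 lt1; rewrite -(ltr_pM2l ce0) (addrC c e); apply: lt_le_trans lt1 _.
  by rewrite mulrDl lerDr mulr_ge0// ltW.
have [c] := EVT_min (ltW r12) (cspeed_within hP (w := w) (b := r2) (pos _ (lexx _))).
rewrite in_itv/= => /andP[r1c cr2] cmin.
have cV : cspeed P w c <= V.
  by apply: le_trans v1V; apply: cmin; rewrite in_itv/= lexx ltW.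
move: cr2; rewrite le_eqVlt => /orP[/eqP cr2|cr2]; last first.
  have [t /andP[ct tr]] := drop _ r1c cr2 cV.
  by rewrite ltNge cmin// in_itv/= tr andbT (le_trans r1c)// ltW.
(* A minimum at [r2] gives only a weak inequality; one drop starting from [r1] makes it strict. *)
have [t /andP[r1t tr]] := drop _ (lexx _) r12 v1V.
apply: le_lt_trans; rewrite -cr2; apply: cmin.
by rewrite in_itv/= tr ltW.
Qed.

Lemma PTp_dp_gt0 p r : law P = PTp p -> 0 < r <= M -> 0 < derive1 p r.
Proof.
move=> lawP r0; case: hP => _ _ _ _; rewrite /law_hypotheses lawP => -[_ h _ _ _].
by have [] := h _ r0.
Qed.

Lemma PTp_convex p r : law P = PTp p -> 0 < r <= M ->
  0 < 2 * derive1 p r + r * derive1n 2 p r.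
Proof.
move=> lawP r0; case: hP => _ _ _ _; rewrite /law_hypotheses lawP => -[_ h _ _ _].
by have [] := h _ r0.
Qed.

Lemma mean_value (f df : R -> R) (x y : R) : x < y ->
  (forall z, x <= z <= y -> is_derive z (1 : R) f (df z)) ->
  exists2 c, x < c < y & f y - f x = df c * (y - x).
Proof.
move=> xy fd; have [z|z|c] := @MVT R f df x y xy.
- by rewrite in_itv/= => /andP[/ltW xz /ltW zy]; apply: fd; rewrite xz.
- apply: continuous_in_subspaceT => {}z; rewrite inE/= in_itv/= => xzy.
  by apply: derivable_continuous; have [] := fd _ xzy.
by rewrite in_itv/=; exists c.
Qed.

Lemma PTp_incr p r1 r2 : law P = PTp p -> 0 < r1 -> r1 < r2 -> r2 <= M ->
  p r1 < p r2.
Proof.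
move=> lawP r10 r12 r2M.
have [z /andP[r1z zr2]|c /andP[r1c cr2] h] :=
    @mean_value p (derive1 p) r1 r2 r12.
  apply: is_derive_p; last exact: lt_le_trans r1z.
  by move=> y y0; exact: PTp_derivable lawP y0.
rewrite -subr_gt0 h mulr_gt0 ?subr_gt0//; apply: (PTp_dp_gt0 lawP).
by rewrite (lt_trans r10)//= (le_trans (ltW cr2)).
Qed.

Lemma cspeedP p w r : law P = PTp p -> 0 < r -> cspeed P w r = w - p r.
Proof.
by move=> lawP r0; rewrite /cspeed (speed_PTp lawP) ?gt_eqF//= mulfK// gt_eqF.
Qed.

Lemma cspeed_decr w r1 r2 : wrange P w -> sm P <= r1 -> r1 < r2 -> r2 <= M ->
  cspeed P w r1 <= V -> cspeed P w r2 < cspeed P w r1.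
Proof.
case lawP : (law P) => [a sg|p]; first exact: cspeedA_decr lawP.
move=> Ww r1s r12 r2M _.
have r10 := lt_le_trans (sm_gt0 hP) r1s.
rewrite !(cspeedP _ lawP)// ?(lt_trans r10)// ltrD2l ltrN2.
exact: (PTp_incr lawP).
Qed.

Lemma cspeed_incr w1 w2 r : sm P <= r < M -> w1 < w2 ->
  cspeed P w1 r < cspeed P w2 r.
Proof.
case lawP : (law P) => [a sg|p]; first exact: (cspeedA_mono hP lawP).
move=> /andP[rs _] w12; rewrite !(cspeedP _ lawP) ?ltrD2r//;
  exact: lt_le_trans (sm_gt0 hP) rs.
Qed.

(** For PTa all curves meet at full density with speed zero, so monotonicity in w degenerates there;
    for PTp it stays strict. *)
Lemma cspeed_rhomax w1 w2 : w1 < w2 ->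
  cspeed P w1 M < cspeed P w2 M \/ (cspeed P w1 M = 0 /\ cspeed P w2 M = 0).
Proof.
case lawP : (law P) => [a sg|p] w12.
  by right; rewrite !(cspeedA_rhomax hP lawP).
by left; rewrite !(cspeedP _ lawP) ?ltrD2r// rhomax_gt0.
Qed.

(** For PTa full density works. For PTp the equation is p(r) = w, and p runs from w_- - V at [sm P]
    to w_+ at full density. *)
Lemma cspeed_zero w : wrange P w ->
  exists2 r, sm P <= r <= M & cspeed P w r = 0.
Proof.
move=> Ww; have s0 := sm_gt0 hP; have sM := sm_lt_rhomax hP.
case lawP : (law P) => [a sg|p].
  by exists M; rewrite ?lexx ?(ltW sM)// (cspeedA_rhomax hP lawP).
have pM : p M = wp P.
  by case: hP => _ _ _ _; rewrite /law_hypotheses lawP => -[].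
have ps : p (sm P) = wm P - V.
  by have := cspeed_sm hP; rewrite (cspeedP _ lawP)//; lra.
have [| |r] := @IVT R p (sm P) M w (ltW sM).
- apply: continuous_in_subspaceT => r; rewrite inE/= in_itv/= => /andP[sr _].
  apply: derivable_continuous; apply: (PTp_derivable hP lawP).
  exact: lt_le_trans s0 sr.
- case/andP: Ww => w1 w2; rewrite ge_min le_max pM ps w2 orbT andbT.
  have V0 := vmax_gt0 hP; apply/orP; left; lra.
rewrite in_itv/= => rr pr; exists r => //.
by rewrite (cspeedP _ lawP) ?pr ?subrr// (lt_le_trans s0)//; case/andP: rr.
Qed.

End Decreasing.

(** * Curvature of the flux curves *)

Section Trichotomy.
Context {R : realType}.
Variable P : phase_data R.
Hypothesis hP : standing_hypotheses P.
Implicit Types (r q w y v : R) (u : R * R).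
Local Notation V := (vmax P).
Local Notation M := (rhomax P).
Local Notation D w r := (Omega_c P (r, w * r)).

(** The speed decreases along a curve, so between two congested states it stays between their
    speeds. *)
Lemma Omega_c_interval w r1 r2 r : D w r1 -> D w r2 -> r1 <= r <= r2 -> D w r.
Proof.
move=> /(Omega_cE hP)[/andP[s1 _] /andP[_ v1] Ww].
move=> /(Omega_cE hP)[/andP[_ s2] /andP[v2 _] _] /andP[r1r rr2].
apply/(Omega_cE hP); split => //; first by rewrite (le_trans s1)//= (le_trans rr2).
have vV : cspeed P w r <= V.
  move: (r1r); rewrite le_eqVlt => /predU1P[<-//|r1r'].
  by apply: (le_trans _ v1); apply/ltW/(cspeed_decr hP) => //; exact: le_trans rr2 s2.
rewrite vV andbT; move: rr2; rewrite le_eqVlt => /predU1P[->//|rr2].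
by apply: (le_trans v2); apply/ltW/(cspeed_decr hP) => //; exact: le_trans s1 r1r.
Qed.

Lemma Omega_c_ex w : wrange P w -> exists r, D w r.
Proof.
move=> Ww; have [r rr r0] := cspeed_zero hP Ww; exists r; apply/(Omega_cE hP).
by split => //; rewrite r0 lexx ltW// vmax_gt0.
Qed.

Lemma affine_sign (al be : R) (I : R -> Prop) :
  (forall x y z, I x -> I y -> x <= z <= y -> I z) ->
  (forall x, I x -> al + be * x != 0) ->
  (forall x, I x -> 0 < al + be * x) \/ (forall x, I x -> al + be * x < 0).
Proof.
move=> Iconv I0.
have [[x [Ix x0]]|nx] := pselect (exists x, I x /\ al + be * x < 0); last first.
  left=> x Ix; rewrite lt_def I0//= leNgt; apply/negP => h; apply: nx.
  by exists x.
right=> y Iy; rewrite lt_def eq_sym I0//= leNgt; apply/negP => y0.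
have be0 : be != 0.
  by apply/eqP => be0; move: x0 y0; rewrite be0 !mul0r addr0 => /lt_trans h /h;
     rewrite ltxx.
pose z := - al / be; have ez : al + be * z = 0 by rewrite /z; field.
have Iz : I z.
  have bz t : al + be * t = be * (t - z).
    by rewrite mulrBr; rewrite (_ : be * z = - al)//; lra.
  rewrite !bz in x0 y0.
  have [bp|bn|b0] := ltgtP 0 be; last by rewrite b0 eqxx in be0.
  - rewrite pmulr_rgt0// subr_gt0 in y0; rewrite pmulr_rlt0// subr_lt0 in x0.
    by apply: Iconv Ix Iy _; rewrite !ltW.
  - rewrite nmulr_rgt0// subr_lt0 in y0; rewrite nmulr_rlt0// subr_gt0 in x0.
    by apply: Iconv Iy Ix _; rewrite !ltW.
by have := I0 _ Iz; rewrite ez eqxx.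
Qed.

(** The standing assumption concerns r L_w'', which is the derivative of [lambda1] along r_1 ([gL]).
    As L_w'' is affine in the density ([L2]), having no zero on the interval forces one sign; for a
    = 0 it is the constant [al], whose sign is that of -w. *)
Lemma curvature_PTa a sg w : law P = PTa a sg -> wrange P w ->
  [\/ Lconvex P w, Lconcave P w |
      forall r, D w r -> derive1n 2 (Lcurve P w) r = 0].
Proof.
move=> lawP Ww; have sgM := sgM hP lawP.
have pos r : D w r -> 0 < r by move=> /(Omega_c_rho_gt0 hP).
have ag u : Omega_c P u -> if a == 0
    then grad_dot (lambda1 P) u = 0 <-> wcoord P u = 0
    else grad_dot (lambda1 P) u <> 0.
  by case: hP => _ _ _ _; rewrite /law_hypotheses lawP => -[_ _]; exact.
pose al := 2 * (a - w * (V * sg / (M - sg) + a * sg + a * M)).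
pose be := 2 * (3 * (a * w)).
have L2 r : 0 < r -> derive1n 2 (Lcurve P w) r = al + be * r.
  by move=> r0; rewrite (derive2_Lcurve_PTa lawP sgM)// /al /be; field.
have gL r : 0 < r ->
    grad_dot (lambda1 P) (r, w * r) = r * derive1n 2 (Lcurve P w) r.
  move=> r0; rewrite (derive2_Lcurve_PTa lawP sgM)//.
  by rewrite (grad_lambda1_PTa lawP sgM)//; field.
have [a0|a0] := eqVneq a 0.
  have c0 : 0 < V * sg / (M - sg).
    have /andP[h1 h2] := sg_range hP lawP.
    by rewrite divr_gt0 ?subr_gt0// mulr_gt0// vmax_gt0.
  have be0 : be = 0 by rewrite /be a0 mul0r !mulr0.
  have al0 : al = - (2 * (V * sg / (M - sg)) * w) by rewrite /al a0; field.
  have [w0|w0|w0] := ltgtP w 0.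
  - apply: Or31 => r Dr; rewrite (L2 _ (pos _ Dr)) be0 mul0r addr0 al0.
    by rewrite oppr_gt0 pmulr_rlt0// mulr_gt0.
  - apply: Or32 => r Dr; rewrite (L2 _ (pos _ Dr)) be0 mul0r addr0 al0.
    by rewrite oppr_lt0 pmulr_rgt0// mulr_gt0.
  - apply: Or33 => r Dr; rewrite (L2 _ (pos _ Dr)) be0 mul0r addr0 al0 w0 mulr0.
    by rewrite oppr0.
have [||h|h] := @affine_sign al be (fun r => D w r).
- by move=> x y z Dx Dy; exact: Omega_c_interval.
- move=> x Dx; have := ag _ Dx; rewrite (negbTE a0) (gL _ (pos _ Dx)) (L2 _ (pos _ Dx)).
  by move=> h; apply/eqP => e; apply: h; rewrite e mulr0.
- by apply: Or31 => r Dr; rewrite (L2 _ (pos _ Dr)); exact: h.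
- by apply: Or32 => r Dr; rewrite (L2 _ (pos _ Dr)); exact: h.
Qed.

(** L_w'' = -(2 p' + r p'') is negative by hypothesis. The tangent inequality takes two mean value
    arguments, one for L_w and one for its slope. *)
Lemma tangent_above_PTp p w : law P = PTp p -> Lconcave P w /\ tangent_above P w.
Proof.
move=> lawP; have p1 := fun r => @PTp_derivable R P hP p r lawP.
have p2 := fun r => @PTp_derivable2 R P hP p r lawP.
have pos r : D w r -> 0 < r <= M.
  move=> Dr; rewrite (Omega_c_rho_gt0 hP Dr)/=.
  by case/(Omega_cE hP): Dr => /andP[].
split=> [r /pos r0|].
  rewrite (derive2_Lcurve_PTp lawP p1 p2); last by case/andP: r0.
  by rewrite oppr_lt0; exact: (PTp_convex hP lawP).
have ldecr r y : 0 < r -> y <= M -> r < y -> clambda P w y < clambda P w r.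
  move=> r0 yM ry; have [z /andP[rz _]|c /andP[rc cy] h] :=
    mean_value (f := clambda P w)
      (df := fun z => - (2 * derive1 p z + z * derive1n 2 p z)) ry.
    exact: (is_derive_lambda1_PTp lawP p1 p2 _ (lt_le_trans r0 rz)).
  rewrite -subr_lt0 h pmulr_llt0 ?subr_gt0// oppr_lt0.
  by apply: (PTp_convex hP lawP) => //; rewrite (lt_trans r0)//= (le_trans (ltW cy)).
have mv r y : 0 < r -> r < y -> exists2 c, r < c < y &
    y * cspeed P w y - r * cspeed P w r = clambda P w c * (y - r).
  move=> r0 ry; have [z /andP[rz _]|c rcy h] :=
    mean_value (f := Lcurve P w) (df := clambda P w) ry.
    exact: (is_derive_Lcurve_PTp lawP p1 _ (lt_le_trans r0 rz)).
  by exists c.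
move=> r y /pos /andP[r0 rM] /pos /andP[y0 yM].
rewrite neq_lt => /orP[ry|yr].
  have [c /andP[rc cy] h] := mv _ _ r0 ry.
  have := ldecr _ _ (lt_trans r0 rc) yM cy.
  rewrite -(ltr_pM2r (_ : 0 < y - r)) ?subr_gt0// => h'; lra.
have [c /andP[yc cr] h] := mv _ _ y0 yr.
have := ldecr _ _ y0 (le_trans (ltW cr) rM) yc.
rewrite -(ltr_pM2r (_ : 0 < r - y)) ?subr_gt0// => h'; lra.
Qed.

(** The negations follow the tests made by [wave1], which asks for concavity first and for convexity
    second. They hold because the domain of L_w is not empty. *)
Lemma Lcurve_trichotomy w : wrange P w ->
  [\/ Lconcave P w /\ tangent_above P w,
      [/\ ~ Lconcave P w, Lconvex P w & tangent_below P w] |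
      [/\ ~ Lconcave P w, ~ Lconvex P w & tangent_on P w]].
Proof.
move=> Ww; case lawP : (law P) => [a sg|p]; last first.
  by apply: Or31; exact: tangent_above_PTp lawP.
have sgM := sgM hP lawP; have [r0 D0] := Omega_c_ex Ww.
have pos r : D w r -> 0 < r by move=> /(Omega_c_rho_gt0 hP).
have mid r y : D w r -> D w y -> D w ((2 * y + r) / 3).
  move=> Dr Dy; have [ry|yr] := leP r y.
    by apply: Omega_c_interval Dr Dy _; lra.
  by apply: Omega_c_interval Dy Dr _; lra.
have tan r y : D w r -> D w y ->
    r * cspeed P w r - y * cspeed P w y - clambda P w y * (r - y)
    = (r - y) ^+ 2 * (derive1n 2 (Lcurve P w) ((2 * y + r) / 3) / 2).
  by move=> Dr Dy; apply: (flow_PTa_tangent lawP sgM); exact: pos.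
have [h|h|h] := curvature_PTa lawP Ww.
- apply: Or32; split => //.
    by move=> /(_ _ D0); rewrite ltNge ltW// h.
  move=> r y Dr Dy ry; have := tan _ _ Dr Dy.
  have : 0 < (r - y) ^+ 2 * (derive1n 2 (Lcurve P w) ((2 * y + r) / 3) / 2).
    rewrite mulr_gt0 ?divr_gt0 ?h//; last exact: mid.
    by rewrite exprn_even_gt0//= subr_eq0.
  by move=> /[swap] <- h'; lra.
- apply: Or31; split => //.
  move=> r y Dr Dy ry; have := tan _ _ Dr Dy.
  have : (r - y) ^+ 2 * (derive1n 2 (Lcurve P w) ((2 * y + r) / 3) / 2) < 0.
    rewrite pmulr_rlt0 ?pmulr_llt0 ?h//; first exact: mid.
    by rewrite exprn_even_gt0//= subr_eq0.
  by move=> /[swap] <- h'; lra.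
- apply: Or33; split.
  + by move=> /(_ _ D0); rewrite h// ltxx.
  + by move=> /(_ _ D0); rewrite h// ltxx.
  move=> r y Dr Dy; have := tan _ _ Dr Dy.
  by rewrite h ?mul0r ?mulr0; [|exact: mid] => h'; lra.
Qed.

End Trichotomy.

(** * The free phase *)

Section FreePhase.
Context {R : realType}.

Lemma cvg_minr {T} {F : set_system T} {FF : Filter F} (f g : T -> R) (x y : R) :
  f t @[t --> F] --> x -> g t @[t --> F] --> y ->
  Num.min (f t) (g t) @[t --> F] --> Num.min x y.
Proof.
move=> fx gy; under eq_fun do rewrite minr_absE.
rewrite minr_absE; apply: cvgM; last exact: cvg_cst.
by apply: cvgD; [exact: cvgD|apply: cvgN; apply: cvg_norm; exact: cvgB].
Qed.

Lemma cvg_maxr {T} {F : set_system T} {FF : Filter F} (f g : T -> R) (x y : R) :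
  f t @[t --> F] --> x -> g t @[t --> F] --> y ->
  Num.max (f t) (g t) @[t --> F] --> Num.max x y.
Proof.
move=> fx gy; under eq_fun do rewrite maxr_absE.
rewrite maxr_absE; apply: cvgM; last exact: cvg_cst.
by apply: cvgD; [exact: cvgD|apply: cvg_norm; exact: cvgB].
Qed.

Variable P : phase_data R.
Hypothesis hP : standing_hypotheses P.
Implicit Types (r q w y v : R) (u : R * R).
Local Notation V := (vmax P).
Local Notation M := (rhomax P).

Lemma Qfree_formula r : 0 < r -> Qfree P r = Qformula P r.
Proof. by move=> r0; rewrite /Qfree gt_eqF. Qed.

Lemma Qformula_cvg_PTa a sg r : law P = PTa a sg -> r < M ->
  V * sg / (M - sg) + a * (sg - r) != 0 ->
  Qformula P y @[y --> r] --> Qformula P r.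
Proof.
move=> lawP rM K0; have sgM := sgM hP lawP; rewrite /Qformula lawP.
have rr : y @[y --> r] --> r by exact: cvg_id.
apply: cvgM.
  apply: cvgM; first by apply: cvgB => //; exact: cvg_cst.
  apply: cvgD; [exact: cvg_cst|apply: cvgM; [apply: cvgM; [exact: cvg_cst|
    by apply: cvgB; [exact: cvg_cst|]]|exact: cvg_cst]].
apply: cvgV; last first.
  apply: cvgM; first by apply: cvgB => //; exact: cvg_cst.
  apply: cvgD; [exact: cvg_cst|apply: cvgM; [apply: cvgM; [exact: cvg_cst|
    by apply: cvgB; [exact: cvg_cst|]]|exact: cvg_cst]].
have -> : V * sg + a * (sg - r) * (M - sg)
  = (V * sg / (M - sg) + a * (sg - r)) * (M - sg) by field.
by rewrite mulf_neq0 ?(mulf_neq0 K0 sgM)// subr_eq0 gt_eqF.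
Qed.

(** For PTa the denominator of Q cannot vanish: its second factor is a multiple of a factor of the
    speed, which is V > 0 at (r, Q(r)). *)
Lemma Qformula_cvg r : 0 < r <= sp P ->
  Qformula P y @[y --> r] --> Qformula P r.
Proof.
move=> rs; have /andP[r0 rsp] := rs.
have rM : r < M := le_lt_trans rsp (sp_lt_rhomax hP).
case lawP : (law P) => [a sg|p].
  apply: (Qformula_cvg_PTa lawP) => //; apply/eqP => K0.
  have := speed_Qfree hP rs; rewrite (speed_PTa lawP) ?gt_eqF//= K0 mulr0 mul0r.
  by move=> V0; have := vmax_gt0 hP; rewrite -V0 ltxx.
rewrite /Qformula lawP; apply: cvgM; first exact: cvg_id.
apply: cvgD; first exact: cvg_cst.
by apply: derivable_continuous; exact: (PTp_derivable hP lawP).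
Qed.

(* Here p may be unbounded near 0, but r |-> r p(r) is convex and bounded
   above, so that Q has a limit at vacuum. *)
Lemma mul_p_cvg0 p : law P = PTp p -> cvg (r * p r @[r --> 0^'+]).
Proof.
move=> lawP; have M0 := rhomax_gt0 hP.
have p1 r : 0 < r -> derivable p r 1 := PTp_derivable hP lawP.
have p2 r : 0 < r -> derivable (derive1 p) r 1 := PTp_derivable2 hP lawP.
(* [dh] is the derivative of r p(r), increasing up to [M]. Subtracting the line of slope [dh M]
   leaves the nonincreasing function [k], so an upper bound near vacuum suffices for a limit. *)
pose dh r := p r + r * derive1 p r.
pose k r := r * p r - dh M * r.
have kd r : 0 < r -> is_derive r (1 : R) k (dh r - dh M).
  move=> r0; rewrite /k; derive_to; first exact: is_derive_p.
  by rewrite /dh /=; ring.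
have dhd r : 0 < r -> is_derive r (1 : R) dh
    (2 * derive1 p r + r * derive1n 2 p r).
  move=> r0; rewrite /dh; derive_to;
    [exact: is_derive_p|exact: is_derive_dp|].
  by rewrite /=; ring.
have dhM r : 0 < r -> r < M -> dh r < dh M.
  move=> r0 rM; have [z /andP[rz _]|c /andP[rc cM] h] := mean_value
    (f := dh) (df := fun z => 2 * derive1 p z + z * derive1n 2 p z) rM.
    by apply: dhd; exact: lt_le_trans rz.
  rewrite -subr_gt0 h mulr_gt0 ?subr_gt0//; apply: (PTp_convex hP lawP).
  by rewrite (lt_trans r0)//= ltW.
have ck : cvg (k r @[r --> 0^'+]).
  apply: nonincreasing_at_right_is_cvgr.
    near=> x => y z; rewrite !in_itv/= => /andP[y0 yx] /andP[z0 zx].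
    rewrite le_eqVlt => /predU1P[->//|yz].
    have [t /andP[yt _]|c /andP[yc cz] h] := mean_value
      (f := k) (df := fun z => dh z - dh M) yz.
      by apply: kd; exact: lt_le_trans yt.
    rewrite -subr_le0 h mulr_le0_ge0 ?subr_ge0 ?ltW// subr_lt0.
    apply: dhM; first exact: lt_trans yc.
    by apply: lt_trans (lt_trans cz zx) _; near: x; exact: nbhs_right_lt.
  near=> x; exists (`|p M - dh M| * M) => _ /= [y + <-].
  rewrite in_itv/= => /andP[y0 yx].
  have yM : y < M by apply: lt_trans yx _; near: x; exact: nbhs_right_lt.
  rewrite /k (mulrC (dh M)) -mulrBr.
  apply: (@le_trans _ _ (y * `|p M - dh M|)).
    rewrite ler_pM2l//; apply: le_trans (ler_norm _); rewrite lerD2r ltW//.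
    exact: (PTp_incr hP lawP).
  by rewrite mulrC ler_wpM2l// ltW.
have -> : (fun r => r * p r) = (fun r => k r + dh M * r).
  by apply/funext => r; rewrite /k subrK.
apply: is_cvgD; first exact: ck.
apply: is_cvgM; first exact: is_cvg_cst.
apply: cvgP; apply: cvg_at_right_filter; exact: cvg_id.
Unshelve. all: by end_near. Qed.

Lemma Qfree_cvg0 : Qformula P r @[r --> 0^'+] --> Qfree P 0.
Proof.
suff : cvg (Qformula P r @[r --> 0^'+]) by rewrite /Qfree eqxx.
have M0 := rhomax_gt0 hP.
case lawP : (law P) => [a sg|p]; last first.
  rewrite /Qformula lawP.
  under eq_fun do rewrite mulrDr.
  apply: is_cvgD; last exact: mul_p_cvg0.
  apply: is_cvgM; last exact: is_cvg_cst.
  by apply: cvgP; apply: cvg_at_right_filter; exact: cvg_id.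
have sgM := sgM hP lawP.
(* If this factor vanishes at vacuum, then V = -a (M - sg), both brackets of Q equal -a r (M - sg),
   and Q(r) = (r - sg) / (M - r): the singularity is removable. *)
have [K0|K0] := eqVneq (V * sg / (M - sg) + a * (sg - 0)) 0; last first.
  by apply: cvgP; apply: cvg_at_right_filter; exact: (Qformula_cvg_PTa lawP).
have /andP[sg0 sgM'] := sg_range hP lawP.
have eV : V = - (a * (M - sg)).
  apply: (mulIf (lt0r_neq0 sg0)); move: K0; rewrite subr0.
  move/(congr1 (fun t => t * (M - sg))); rewrite mulrDl mul0r divfK//.
  by move=> K0; lra.
have a0 : a != 0.
  by apply/eqP => a0; have := vmax_gt0 hP; rewrite eV a0 mul0r oppr0 ltxx.
have ce : (r - sg) / (M - r) @[r --> 0^'+] --> (0 - sg) / (M - 0).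
  apply: cvg_at_right_filter; apply: cvgM.
    by apply: cvgB; [exact: cvg_id|exact: cvg_cst].
  apply: cvgV; first by rewrite subr0 gt_eqF.
  by apply: cvgB; [exact: cvg_cst|exact: cvg_id].
apply: cvgP; apply: cvg_trans ce; apply: near_eq_cvg; near=> r.
have r0 : 0 < r by near: r; exact: nbhs_right_gt.
have rM : r < M by near: r; exact: nbhs_right_lt.
rewrite /Qformula lawP eV; field.
have -> : - (a * (M - sg)) * sg + a * (sg - r) * (M - sg)
  = - (a * r * (M - sg)) by ring.
by rewrite oppr_eq0 !mulf_neq0 ?sgM// ?subr_eq0 ?(gt_eqF rM) ?(gt_eqF r0).
Unshelve. all: by end_near. Qed.

(* Q, made constant outside [0, sigma_+] in order to be continuous on R. *)
Definition Qext r := Qfree P (Num.max 0 (Num.min r (sp P))).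

Lemma Qext_Qfree r : 0 <= r <= sp P -> Qext r = Qfree P r.
Proof. by case/andP => r0 rs; rewrite /Qext min_l// max_r. Qed.

Lemma Qext_cvg {T} {F : set_system T} {FF : Filter F} (f : T -> R) r :
  f t @[t --> F] --> r -> Qext (f t) @[t --> F] --> Qext r.
Proof.
move=> fr; pose g t := Num.max 0 (Num.min (f t) (sp P)).
pose c := Num.max 0 (Num.min r (sp P)).
have sp0 : 0 < sp P := lt_trans (sm_gt0 hP) (sm_lt_sp hP).
have gc : g t @[t --> F] --> c.
  by apply: cvg_maxr; [exact: cvg_cst|apply: cvg_minr => //; exact: cvg_cst].
have c0 : 0 <= c by rewrite le_max lexx.
have cs : c <= sp P by rewrite ge_max (ltW sp0) ge_min lexx orbT.
have g0 t : 0 <= g t by rewrite le_max lexx.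
rewrite -[Qext r]/(Qfree P c) -[X in X @ _ --> _]/(Qfree P \o g).
(* At vacuum only a limit from the right is available; it suffices because the clamped argument [g]
   is never negative and equals zero only where the claim is trivial. *)
have [cp|] := ltP 0 c; last first.
  move=> c0'; have c00 : c = 0 by apply/eqP; rewrite eq_le c0' c0.
  rewrite c00; apply/cvgrPdist_lt => e e0.
  have /cvgrPdist_lt /(_ e e0) := Qfree_cvg0.
  rewrite near_withinE => Q0; rewrite c00 in gc.
  have {}Q0 : \forall t \near F, 0 < g t -> `|Qfree P 0 - Qformula P (g t)| < e.
    exact: (gc _ Q0).
  apply: filterS Q0 => t /= h.
  have := g0 t; rewrite le_eqVlt => /predU1P[<-|gt0]; first by rewrite subrr normr0.
  by rewrite (Qfree_formula gt0); exact: h.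
apply: cvg_trans.
  apply: (near_eq_cvg (f := Qformula P \o g)).
  have : \forall t \near F, 0 < g t by exact: (gc _ (near_pos cp)).
  by apply: filterS => t gt0; rewrite /= Qfree_formula.
rewrite (Qfree_formula cp); apply: (cvg_comp _ _ gc); apply: Qformula_cvg.
by rewrite cp.
Qed.
End FreePhase.

(** * Coordinates and extended fluxes *)

Lemma cvg_pairR {R : realType} {T} {F : set_system T} {FF : Filter F}
    (f g : T -> R) (x y : R) :
  f t @[t --> F] --> x -> g t @[t --> F] --> y ->
  (f t, g t) @[t --> F] --> (x, y).
Proof.
by move=> fx gy; exact: (@cvg_pair _ _ _ F (nbhs x) (nbhs y) _ _ _ f g fx gy).
Qed.

Section Coordinates.
Context {R : realType}.
Variable P : phase_data R.
Hypothesis hP : standing_hypotheses P.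
Implicit Types (r q w y v : R) (u : R * R).
Local Notation V := (vmax P).
Local Notation M := (rhomax P).
Local Notation D w r := (Omega_c P (r, w * r)).

Definition wbar u := Num.max (wcoord P u) (wm P).
Definition rho w v := get [set r | D w r /\ cspeed P w r = v].
(* Equal to f(r, w r) on Omega_c and, since v >= V on the left of that domain,
   to V r for 0 <= r <= sigma_-. *)
Definition Gflux w r := r * Num.min V (cspeed P w (Num.max r (sm P))).
(* The state of density r on the curve of parameter w, continued for
   w = w_- by the free states of density below sigma_-. *)
Definition state_on w r : R * R :=
  (r, Qext P (Num.min r (sm P)) - wm P * sm P + w * Num.max r (sm P)).

Lemma cspeed_le w1 w2 r : sm P <= r <= M -> w1 <= w2 ->
  cspeed P w1 r <= cspeed P w2 r.
Proof.
move=> /andP[sr]; rewrite !le_eqVlt => /predU1P[->|rM] /predU1P[->|w12];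
  rewrite ?eqxx//.
  by have [->|[-> ->]] := cspeed_rhomax hP w12; rewrite ?orbT ?eqxx.
by rewrite cspeed_incr ?orbT// sr.
Qed.

(** Positive speed excludes the common end point of the PTa curves at full density. *)
Lemma cspeed_w_inj w1 w2 r : sm P <= r <= M -> 0 < cspeed P w1 r ->
  cspeed P w1 r = cspeed P w2 r -> w1 = w2.
Proof.
move=> sr v0 e; wlog w12 : w1 w2 v0 e / w1 < w2.
  move=> h; have [w12|w21|//] := ltgtP w1 w2; first exact: h.
  by apply/esym; apply: h => //; rewrite -e.
move: sr => /andP[sr]; rewrite le_eqVlt => /predU1P[rM|rM].
  have := cspeed_rhomax hP w12; rewrite -rM e ltxx => -[//|[h _]].
  by rewrite e h ltxx in v0.
by have := @cspeed_incr _ _ hP w1 w2 r; rewrite sr rM e ltxx => /(_ isT w12).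
Qed.

Lemma cspeed_inj w r1 r2 : D w r1 -> D w r2 ->
  cspeed P w r1 = cspeed P w r2 -> r1 = r2.
Proof.
move=> D1 D2 e; wlog r12 : r1 r2 D1 D2 e / r1 < r2.
  move=> h; have [r12|r21|//] := ltgtP r1 r2; first exact: h.
  by apply/esym; apply: h.
move/(Omega_cE hP): D1 => [/andP[s1 _] /andP[_ v1] Ww].
move/(Omega_cE hP): D2 => [/andP[_ s2] _ _].
by have := cspeed_decr hP Ww s1 r12 s2 v1; rewrite e ltxx.
Qed.

Lemma vmax_le_cspeed_sm w : wrange P w -> V <= cspeed P w (sm P).
Proof.
move=> /andP[ww _]; rewrite -[leLHS](cspeed_sm hP); apply: cspeed_le => //.
by rewrite lexx ltW// sm_lt_rhomax.
Qed.

Lemma rho_ex w v : wrange P w -> 0 <= v <= V ->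
  exists r, D w r /\ cspeed P w r = v.
Proof.
move=> Ww /andP[v0 vV]; have [r0 /andP[sr0 r0M] cr0] := cspeed_zero hP Ww.
have := vmax_le_cspeed_sm Ww => Vs.
have [| |r] := @IVT R (cspeed P w) (sm P) r0 v sr0.
- exact: (cspeed_within hP (sm_gt0 hP)).
- by rewrite cr0 ge_min v0 orbT le_max (le_trans vV).
rewrite in_itv/= => /andP[sr rr0] e; exists r; split => //.
apply/(Omega_cE hP); rewrite sr (le_trans rr0 r0M) e v0 vV; split => //.
Qed.

Lemma rhoP w v : wrange P w -> 0 <= v <= V ->
  D w (rho w v) /\ cspeed P w (rho w v) = v.
Proof.
by move=> Ww vV; have h := rho_ex Ww vV; exact: (@getPex _ [set r | D w r /\ _]).
Qed.

Lemma rho_D w v : wrange P w -> 0 <= v <= V -> D w (rho w v).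
Proof. by move=> Ww vV; have [] := rhoP Ww vV. Qed.

Lemma cspeed_rho w v : wrange P w -> 0 <= v <= V -> cspeed P w (rho w v) = v.
Proof. by move=> Ww vV; have [] := rhoP Ww vV. Qed.

Lemma rho_cspeed w r : D w r -> rho w (cspeed P w r) = r.
Proof.
move=> Dr; have [h1 h2 Ww] := (Omega_cE hP _ _).1 Dr.
exact: (cspeed_inj (rho_D Ww h2) Dr (cspeed_rho Ww h2)).
Qed.

Lemma rho_wm_vmax : rho (wm P) V = sm P.
Proof. by have := rho_cspeed (Omega_c_sm hP); rewrite (cspeed_sm hP). Qed.

Lemma rho_wp_vmax : rho (wp P) V = sp P.
Proof. by have := rho_cspeed (Omega_c_sp hP); rewrite (cspeed_sp hP). Qed.

Lemma D_bounds w r : D w r -> sm P <= r <= M.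
Proof. by move/(Omega_cE hP) => -[]. Qed.

Lemma D_range w r : D w r -> wrange P w.
Proof. by move/(Omega_cE hP) => -[]. Qed.

Lemma D_speed w r : D w r -> 0 <= cspeed P w r <= V.
Proof. by move/(Omega_cE hP) => -[]. Qed.

Lemma D_gt0 w r : D w r -> 0 < r.
Proof. exact: Omega_c_rho_gt0. Qed.

Lemma rho_le w1 w2 v : wrange P w1 -> wrange P w2 -> 0 <= v <= V ->
  w1 <= w2 -> rho w1 v <= rho w2 v.
Proof.
move=> W1 W2 vV w12; rewrite leNgt; apply/negP => r21.
have /andP[s2 M2] := D_bounds (rho_D W2 vV).
have /andP[s1 M1] := D_bounds (rho_D W1 vV).
have h : cspeed P w1 (rho w2 v) <= v.
  by rewrite -[leRHS](cspeed_rho W2 vV); apply: cspeed_le => //; rewrite s2.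
have /andP[_ vV'] := vV.
have := cspeed_decr hP W1 s2 r21 M1 (le_trans h vV').
by rewrite (cspeed_rho W1 vV) ltNge h.
Qed.

Lemma Gflux_D w r : D w r -> Gflux w r = r * cspeed P w r.
Proof.
move=> Dr; have /andP[sr _] := D_bounds Dr; have /andP[_ vV] := D_speed Dr.
by rewrite /Gflux max_l// min_r.
Qed.

Lemma Gflux_free w r : wrange P w -> r <= sm P -> Gflux w r = r * V.
Proof.
by move=> Ww rs; rewrite /Gflux max_r// min_l// vmax_le_cspeed_sm.
Qed.

Lemma Gflux_cvg {T} {F : set_system T} {FF : Filter F} (f g : T -> R) w r :
  f t @[t --> F] --> w -> g t @[t --> F] --> r ->
  Gflux (f t) (g t) @[t --> F] --> Gflux w r.
Proof.
move=> fw gr; apply: cvgM => //; apply: cvg_minr; first exact: cvg_cst.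
apply: (cspeed_cvg hP) => //.
  by rewrite lt_max (sm_gt0 hP) orbT.
by apply: cvg_maxr => //; exact: cvg_cst.
Qed.

Lemma state_on_cvg {T} {F : set_system T} {FF : Filter F} (f g : T -> R) w r :
  f t @[t --> F] --> w -> g t @[t --> F] --> r ->
  state_on (f t) (g t) @[t --> F] --> state_on w r.
Proof.
move=> fw gr; apply: cvg_pairR => //.
apply: cvgD.
  apply: cvgB; last exact: cvg_cst.
  by apply: (Qext_cvg hP); apply: cvg_minr => //; exact: cvg_cst.
by apply: cvgM => //; apply: cvg_maxr => //; exact: cvg_cst.
Qed.

(** A secant slope is at most the left end slope for a concave graph and at most the right end slope
    for a convex one; the maximum serves every curvature. *)
Lemma flow_slope w r1 r2 : D w r1 -> D w r2 -> r1 < r2 ->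
  r2 * cspeed P w r2 - r1 * cspeed P w r1
    <= Num.max (clambda P w r1) (clambda P w r2) * (r2 - r1).
Proof.
move=> D1 D2 r12; have d0 : 0 < r2 - r1 by rewrite subr_gt0.
have n12 : r1 != r2 by rewrite lt_eqF.
have m1 : clambda P w r1 <= Num.max (clambda P w r1) (clambda P w r2).
  by rewrite le_max lexx.
have m2 : clambda P w r2 <= Num.max (clambda P w r1) (clambda P w r2).
  by rewrite le_max lexx orbT.
rewrite -(ler_pM2r d0) in m1; rewrite -(ler_pM2r d0) in m2.
case: (Lcurve_trichotomy hP (D_range D1)) => [[_ t]|[_ _ t]|[_ _ t]].
- apply: le_trans m1; have := t _ _ D2 D1; rewrite eq_sym n12 => /(_ isT).
  by move=> h; lra.
- by apply: le_trans m2; have := t _ _ D1 D2 n12 => h; lra.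
- by apply: le_trans m1; have := t _ _ D2 D1 => h; lra.
Qed.

Lemma clambda_lt0 w r : D w r -> clambda P w r < 0.
Proof. exact: lambda1_lt0. Qed.

Lemma flow_decr w r1 r2 : D w r1 -> D w r2 -> r1 < r2 ->
  r2 * cspeed P w r2 < r1 * cspeed P w r1.
Proof.
move=> D1 D2 r12; rewrite -subr_lt0; apply: le_lt_trans (flow_slope D1 D2 r12) _.
by rewrite pmulr_llt0 ?subr_gt0// gt_max !clambda_lt0.
Qed.

(** Adding the tangent inequalities at two points, each evaluated at the other, shows that the slope
    is monotone, in a direction depending on the curvature. *)
Lemma clambda_le_max w l b r : D w l -> D w b -> l <= r <= b ->
  clambda P w r <= Num.max (clambda P w l) (clambda P w b).
Proof.
move=> Dl Du lru; have Dr := Omega_c_interval hP Dl Du lru.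
have /andP[lr ru] := lru; rewrite le_max.
case: (Lcurve_trichotomy hP (D_range Dl)) => [[_ t]|[_ _ t]|[_ _ t]].
- move: lr; rewrite le_eqVlt => /predU1P[->|lr]; first by rewrite lexx.
  have h1 := t _ _ Dr Dl; have h2 := t _ _ Dl Dr.
  have {}h1 := h1 (ltac:(by rewrite gt_eqF)).
  have {}h2 := h2 (ltac:(by rewrite lt_eqF)).
  apply/orP; left; rewrite -(ler_pM2r (_ : 0 < r - l)) ?subr_gt0//; lra.
- move: ru; rewrite le_eqVlt => /predU1P[->|ru]; first by rewrite lexx orbT.
  have h1 := t _ _ Dr Du; have h2 := t _ _ Du Dr.
  have {}h1 := h1 (ltac:(by rewrite lt_eqF)).
  have {}h2 := h2 (ltac:(by rewrite gt_eqF)).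
  apply/orP; right; rewrite -(ler_pM2r (_ : 0 < b - r)) ?subr_gt0//; lra.
- move: lr; rewrite le_eqVlt => /predU1P[->|lr]; first by rewrite lexx.
  have h1 := t _ _ Dr Dl; have h2 := t _ _ Dl Dr.
  apply/orP; left; rewrite -(ler_pM2r (_ : 0 < r - l)) ?subr_gt0//; lra.
Qed.

End Coordinates.

(** * Last minimisers *)

Section CompactConvergence.
Context {R : realType}.

(** The filter version of: a sequence in a compact set with [c] as its only subsequential limit
    converges to [c]. Finer filters replace subsequences; an ultrafilter on the set of bad indices
    would converge to a point other than [c]. *)
Lemma compact_unique_cvg {T} {F : set_system T} {FF : Filter F} (y : T -> R)
    (a b c : R) :
  (\forall t \near F, a <= y t <= b) ->
  (forall U : set_system T, ProperFilter U -> F `<=` U ->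
     forall c' : R, y t @[t --> U] --> c' -> c' = c) ->
  y t @[t --> F] --> c.
Proof.
move=> yab uc; apply/cvgrPdist_lt => e e0; apply: contrapT => nF.
pose A := [set t | ~ `|c - y t| < e].
have PA : ProperFilter (within A F).
  apply: Build_ProperFilter_ex => B BF; apply: contrapT => nB; apply: nF.
  move: BF; rewrite /within/=; apply: filterS => t AB; apply: contrapT => nt.
  by apply: nB; exists t; exact: AB.
have [U [UU FU]] := ultraFilterLemma PA.
have UF : F `<=` U.
  by move=> B FB; apply: FU; rewrite /within/=; apply: filterS FB => t Bt _.
have [c' [_ clc]] : `[a, b] `&` cluster (y @ U) !=set0.
  by apply: segment_compact; apply: UF; apply: filterS yab => t /=; rewrite in_itv.
have yc : y t @[t --> U] --> c'.
  move=> N nN; have [//|UN] := in_ultra_setVsetC (y @^-1` N) UU.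
  have UyN : (y @ U) (~` N) by exact: UN.
  have [z [nz Nz]] := clc _ _ UyN nN; case: (nz Nz).
move: (yc); rewrite (uc U _ UF c' yc) => /cvgrPdist_lt /(_ e e0) yce.
have UA : U A by apply: FU; rewrite /within/=; apply: filterE => t.
by have [t [h /h]] := filter_ex (filterI UA yce).
Qed.

End CompactConvergence.

(* [Ol G x l m y]: among the minimisers on [l, m] (maximisers on [m, l] when
   m < l) of r |-> G r - x r, y is the one closest to m. This is the value at x
   of the right-continuous Lax--Oleinik solution of the Riemann problem (l, m)
   with flux G. *)
Section LastMinimizer.
Context {R : realType}.
Implicit Types (G : R -> R) (x l m y r : R).

Definition Ol G x l m y : Prop :=
  if l <= m then
    [/\ l <= y <= m, forall r, l <= r <= y -> G y - x * y <= G r - x * r &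
        forall r, y < r <= m -> G y - x * y < G r - x * r]
  else
    [/\ m <= y <= l, forall r, y <= r <= l -> G r - x * r <= G y - x * y &
        forall r, m <= r < y -> G r - x * r < G y - x * y].

(** Uniqueness of the optimiser, which is what passes to perturbed data. [Ol] itself allows ties
    towards [l], since at the speed of a jump both ends are optimal and right-continuity selects the
    later one. *)
Definition Ol_strict G x l m y : Prop :=
  if l <= m then
    l <= y <= m /\
    forall r, l <= r <= m -> r != y -> G y - x * y < G r - x * r
  else
    m <= y <= l /\
    forall r, m <= r <= l -> r != y -> G r - x * r < G y - x * y.

Lemma Ol_strictW G x l m y : Ol_strict G x l m y -> Ol G x l m y.
Proof.
rewrite /Ol_strict /Ol; case: leP => lm [/andP[ly ym] h]; split=> //.
- by rewrite ly.
- move=> r /andP[lr]; rewrite le_eqVlt => /predU1P[->//|ry].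
  by rewrite ltW// h ?lt_eqF// lr (le_trans (ltW ry)).
- move=> r /andP[yr rm]; rewrite h ?gt_eqF//.
  by rewrite rm (le_trans ly)// ltW.
- by rewrite ly.
- move=> r /andP[]; rewrite le_eqVlt => /predU1P[<-//|yr rl].
  by rewrite ltW// h ?gt_eqF// rl (le_trans ly)// ltW.
- move=> r /andP[mr ry]; rewrite h ?lt_eqF//.
  by rewrite mr (le_trans (ltW ry)).
Qed.

Lemma Ol_up G x l m y : l <= m -> l <= y <= m ->
  (forall r, l <= r <= y -> G y - x * y <= G r - x * r) ->
  (forall r, y < r <= m -> G y - x * y < G r - x * r) -> Ol G x l m y.
Proof. by rewrite /Ol => ->. Qed.

Lemma Ol_strict_up G x l m y : l <= m -> l <= y <= m ->
  (forall r, l <= r <= m -> r != y -> G y - x * y < G r - x * r) ->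
  Ol_strict G x l m y.
Proof. by rewrite /Ol_strict => ->. Qed.

Lemma Ol_down G x l m y : m < l -> m <= y <= l ->
  (forall r, y <= r <= l -> G r - x * r <= G y - x * y) ->
  (forall r, m <= r < y -> G r - x * r < G y - x * y) -> Ol G x l m y.
Proof. by rewrite /Ol => /lt_geF ->. Qed.

Lemma Ol_weak G x l m y : Ol G x l m y ->
  if l <= m then forall r, l <= r <= m -> G y - x * y <= G r - x * r
  else forall r, m <= r <= l -> G r - x * r <= G y - x * y.
Proof.
rewrite /Ol; case: leP => lm [/andP[ly ym] h1 h2] r /andP[r1 r2].
  by have [ry|yr] := leP r y; [apply: h1; rewrite r1|apply/ltW/h2; rewrite yr].
by have [yr|ry] := leP y r; [apply: h1; rewrite yr|apply/ltW/h2; rewrite r1].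
Qed.

Lemma Ol_uniq G x l m y z : Ol G x l m y -> Ol G x l m z -> y = z.
Proof.
rewrite /Ol; case: leP => lm [/andP[ly ym] y1 y2] [/andP[lz zm] z1 z2].
  have [yz|zy|//] := ltgtP y z.
    by have := y2 z; rewrite yz zm => /(_ isT); rewrite ltNge z1// ly ltW.
  by have := z2 y; rewrite zy ym => /(_ isT); rewrite ltNge y1// lz ltW.
have [yz|zy|//] := ltgtP y z.
  by have := z2 y; rewrite yz ly => /(_ isT); rewrite ltNge y1// zm ltW.
by have := y2 z; rewrite zy lz => /(_ isT); rewrite ltNge z1// ym ltW.
Qed.

Lemma Ol_between G x l m y : Ol G x l m y -> Num.min l m <= y <= Num.max l m.
Proof. by rewrite /Ol; case: leP => lm []. Qed.

Lemma Ol_refl G x l y : Ol G x l l y -> y = l.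
Proof. by move/Ol_between; rewrite minxx maxxx => /le_anti. Qed.

(** Reflecting both axes turns maximisation on a descending interval into minimisation on an
    ascending one, so the gluing argument is carried out only for ascending data. *)
Lemma Ol_opp G x l m y :
  Ol (fun r => - G (- r)) x (- l) (- m) (- y) <-> Ol G x l m y.
Proof.
rewrite /Ol !lerN2.
case: (ltgtP l m) => [lm|ml|<-]; split=> -[/andP[h h'] h1 h2]; split.
- lra.
- by move=> r rr; have := h1 (- r) (ltac:(lra)); rewrite !opprK; lra.
- by move=> r rr; have := h2 (- r) (ltac:(lra)); rewrite !opprK; lra.
- lra.
- by move=> r rr; have := h1 (- r) (ltac:(lra)); rewrite !opprK; lra.
- by move=> r rr; have := h2 (- r) (ltac:(lra)); rewrite !opprK; lra.
- lra.
- by move=> r rr; have := h1 (- r) (ltac:(lra)); rewrite !opprK; lra.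
- by move=> r rr; have := h2 (- r) (ltac:(lra)); rewrite !opprK; lra.
- lra.
- by move=> r rr; have := h1 (- r) (ltac:(lra)); rewrite !opprK; lra.
- by move=> r rr; have := h2 (- r) (ltac:(lra)); rewrite !opprK; lra.
- lra.
- by move=> r rr; have -> : r = y by lra.
- by move=> r rr; lra.
- lra.
- by move=> r rr; have -> : r = - y by lra.
- by move=> r rr; lra.
Qed.

(** A profile still at its initial value at speed [z] has not moved earlier: lowering x only
    penalises points away from [l]. *)
Lemma Ol_start G x z l m : x < z -> Ol G z l m l -> Ol G x l m l.
Proof.
move=> xz; rewrite /Ol; case: leP => lm [h h1 h2]; split => //.
- by move=> r rr; have -> : r = l by lra.
- by move=> r rr; have := h2 r rr; nra.
- by move=> r rr; have -> : r = l by lra.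
- by move=> r rr; have := h2 r rr; nra.
Qed.

(** Exchange argument: comparing each optimiser with the other one and adding bounds the sign of (x2
    - x1)(y1 - y2). *)
Lemma Ol_mono G x1 x2 l m y1 y2 : x1 <= x2 ->
  Ol G x1 l m y1 -> Ol G x2 l m y2 ->
  if l <= m then y1 <= y2 else y2 <= y1.
Proof.
move=> x12; rewrite /Ol; case: leP => lm [/andP[ly ym] h1 h2] [/andP[lz zm] z1 z2].
  rewrite leNgt; apply/negP => y21.
  have := h1 y2; rewrite lz (ltW y21) => /(_ isT).
  by have := z2 y1; rewrite y21 ym => /(_ isT); nra.
rewrite leNgt; apply/negP => y21.
have := h1 y2; rewrite zm (ltW y21) => /(_ isT).
by have := z2 y1; rewrite y21 ly => /(_ isT); nra.
Qed.

(** At [xb] the point [y] beats everything beyond it, hence it does so at every smaller x and the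
    change of target from [m2] to [m1] is invisible there; it also does no worse than everything
    before it, hence at larger x the search may start at [y]. *)
Let Ol_glue_up G xb l m1 m2 y : l <= y ->
  Ol G xb l m2 y -> Ol G xb y m1 y ->
  (forall x z, x < xb -> Ol G x l m2 z -> Ol G x l m1 z) /\
  (forall x z, xb <= x -> Ol G x y m1 z -> Ol G x l m1 z).
Proof.
rewrite le_eqVlt => /predU1P[<- O2 O1|ly O2 O1].
  split=> // x z xx Oz; have := Ol_start xx O2 => /(Ol_uniq Oz) ->.
  exact: Ol_start xx O1.
have lm2 : l <= m2.
  rewrite leNgt; apply/negP => m2l; have := Ol_between O2.
  by rewrite (min_r (ltW m2l)) (max_l (ltW m2l)) => h; lra.
move: (O2); rewrite /Ol lm2 => -[/andP[_ ym2] a1 a2].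
(* The second wave cannot turn back: otherwise some point before [y] would lose to [y] both as a
   minimiser and strictly as a maximiser. *)
have ym1 : y <= m1.
  move: O1; rewrite /Ol; case: leP => // m1y [_ _ b2].
  have [lm1|m1l] := leP l m1.
    by have := a1 m1; have := b2 m1; lra.
  by have := a1 l; have := b2 l; lra.
have lm1 : l <= m1 by lra.
move: (O1); rewrite /Ol ym1 lm1 => -[_ b1 b2]; split=> x z xx [/andP[z1 z2] c1 c2].
  have zy : z <= y.
    rewrite leNgt; apply/negP => yz.
    by have := a2 z; have := c1 y; nra.
  split => //; first by rewrite z1; lra.
  move=> r rr; have [rm|mr] := leP r m2; first by apply: c2; lra.
  have := b2 r (ltac:(lra)).
  have [->|yz] := eqVneq z y; first nra.
  have := c2 y; rewrite lt_neqAle yz zy ym2 => /(_ isT); nra.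
split.
- by rewrite z2; lra.
- move=> r rr; have [yr|ry] := leP y r; first by apply: c1; lra.
  have := c1 y; rewrite lexx z1 => /(_ isT).
  have := a1 r (ltac:(lra)); nra.
- by move=> r rr; apply: c2; lra.
Qed.

Lemma Ol_glue G xb l m1 m2 y : Ol G xb l m2 y -> Ol G xb y m1 y ->
  (forall x z, x < xb -> Ol G x l m2 z -> Ol G x l m1 z) /\
  (forall x z, xb <= x -> Ol G x y m1 z -> Ol G x l m1 z).
Proof.
have [ly|yl] := leP l y; first exact: Ol_glue_up.
move=> /Ol_opp O2 /Ol_opp O1.
have [] := Ol_glue_up _ O2 O1; first by rewrite lerN2 ltW.
move=> h1 h2; split=> x z xx /Ol_opp Oz; apply/Ol_opp; [exact: h1|exact: h2].
Qed.

(** The entropy condition in chord form, common to shocks and phase transitions. At [x = s] both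
    ends tie, and the value [m] is the right-continuous choice. *)
Lemma Ol_jump G x l m : l != m ->
  let s := (G m - G l) / (m - l) in
  (if l <= m then forall r, l <= r <= m -> G l + s * (r - l) <= G r
   else forall r, m <= r <= l -> G r <= G l + s * (r - l)) ->
  Ol G x l m (if x < s then l else m) /\
  (x != s -> Ol_strict G x l m (if x < s then l else m)).
Proof.
move=> lm s h.
have es : G m = G l + s * (m - l) by rewrite /s; field; rewrite subr_eq0 eq_sym.
clearbody s; have lm0 : (l <= m) = false -> m < l by move/negbT; rewrite -ltNge.
have st : x != s -> Ol_strict G x l m (if x < s then l else m).
  rewrite neq_lt /Ol_strict; case lm' : (l <= m) in h *;
    case: ltgtP => [xs _|xs _|_ //]; split.
  - lra.
  - move=> r rr; have := h r rr; rewrite neq_lt => + /orP[|]; nra.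
  - lra.
  - move=> r rr; have := h r rr; rewrite neq_lt => + /orP[|]; nra.
  - lra.
  - move=> r rr; have := h r rr; rewrite neq_lt => + /orP[|]; nra.
  - lra.
  - move=> r rr; have := h r rr; rewrite neq_lt => + /orP[|]; nra.
split=> //; have [xs|/st/Ol_strictW//] := eqVneq x s.
rewrite xs ltxx /Ol; case lm' : (l <= m) in h *; split.
- lra.
- by move=> r rr; have := h r rr; lra.
- by move=> r rr; lra.
- lra.
- by move=> r rr; have := h r rr; lra.
- by move=> r rr; lra.
Qed.

(** Inside the fan [lam y = x], and the tangent inequality says that [y] is optimal. At an end of
    the fan a one-sided comparison of slopes is enough; hence the two disjunctions. *)
Lemma Ol_rarefaction G lam x l m y :
  (if l <= m then forall r z, l <= r <= m -> l <= z <= m -> r != z ->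
     G z + lam z * (r - z) < G r
   else forall r z, m <= r <= l -> m <= z <= l -> r != z ->
     G r < G z + lam z * (r - z)) ->
  Num.min l m <= y <= Num.max l m ->
  y = l \/ lam y <= x -> y = m \/ x <= lam y -> Ol_strict G x l m y.
Proof.
move=> h yy yl ym; rewrite /Ol_strict; move: h yy.
case: leP => lm h yy; split=> // r rr ry.
  have := h r y rr yy ry; move: ry; rewrite neq_lt => /orP[ry|yr].
    by case: yl => [yl|yl]; [lra|nra].
  by case: ym => [ym|ym]; [lra|nra].
have := h r y rr yy ry; move: ry; rewrite neq_lt => /orP[ry|yr].
  by case: ym => [ym|ym]; [lra|nra].
by case: yl => [yl|yl]; [lra|nra].
Qed.

End LastMinimizer.

(** * The Riemann solver as a scalar law *)

Section States.
Context {R : realType}.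
Variable P : phase_data R.
Hypothesis hP : standing_hypotheses P.
Implicit Types (r q w y v : R) (u : R * R).
Local Notation V := (vmax P).
Local Notation M := (rhomax P).
Local Notation D w r := (Omega_c P (r, w * r)).

Lemma speed_D w r : D w r -> speed P (r, w * r) = cspeed P w r.
Proof. by []. Qed.

(** The curves w_- and w_+ attain speed V at [sm P] and [sp P]. As the speed decreases in the
    density and increases in w, a curve attaining V between these densities has w between w_- and
    w_+. *)
Lemma Qfree_w r : sm P <= r <= sp P ->
  exists w, [/\ D w r, cspeed P w r = V & Qfree P r = w * r].
Proof.
move=> /andP[sr rs]; have r0 := lt_le_trans (sm_gt0 hP) sr.
have rM : r < M := le_lt_trans rs (sp_lt_rhomax hP).
have V0 := vmax_gt0 hP.
pose w := Qfree P r / r; have ew : w * r = Qfree P r by rewrite divfK// gt_eqF.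
have cV : cspeed P w r = V by rewrite /cspeed ew (speed_Qfree hP)// r0.
exists w; split=> //; apply/(Omega_cE hP); split.
- by rewrite sr ltW.
- by rewrite cV lexx ltW.
apply/andP; split; rewrite leNgt; apply/negP => ww.
  have := @cspeed_incr _ _ hP w (wm P) r; rewrite sr rM cV => /(_ isT ww).
  rewrite ltNge => /negP; apply.
  move: sr; rewrite le_eqVlt => /predU1P[<-|sr]; first by rewrite (cspeed_sm hP).
  rewrite -[leRHS](cspeed_sm hP) ltW//; apply: (cspeed_decr hP) => //.
  - exact: wm_range.
  - exact: ltW.
  - by rewrite (cspeed_sm hP).
have := @cspeed_incr _ _ hP (wp P) w r; rewrite sr rM cV => /(_ isT ww) h.
move: rs; rewrite le_eqVlt => /predU1P[e|rs].
  by move: h; rewrite e (cspeed_sp hP) ltxx.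
have := cspeed_decr hP (wp_range hP) sr rs (ltW (sp_lt_rhomax hP)) (ltW h).
by rewrite (cspeed_sp hP) => /(lt_trans h); rewrite ltxx.
Qed.

Lemma Qfree_sm : Qfree P (sm P) = wm P * sm P.
Proof.
have [] := @Qfree_w (sm P); first by rewrite lexx ltW// sm_lt_sp.
move=> w [Dw cV ->]; congr (_ * _); apply: (cspeed_w_inj hP (D_bounds hP Dw)).
  by rewrite cV vmax_gt0.
by rewrite cV (cspeed_sm hP).
Qed.

Lemma state_on_D w r : D w r -> state_on P w r = (r, w * r).
Proof.
move=> /(D_bounds hP)/andP[sr _]; rewrite /state_on min_r// max_l// Qext_Qfree.
  by rewrite Qfree_sm subrr add0r.
by rewrite (ltW (sm_gt0 hP)) ltW// sm_lt_sp.
Qed.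

Lemma state_on_free r : 0 <= r <= sm P -> state_on P (wm P) r = (r, Qfree P r).
Proof.
move=> /andP[r0 rs]; rewrite /state_on min_l// max_r// Qext_Qfree.
  by rewrite addrAC addrK || rewrite subrK.
by rewrite r0 (le_trans rs)// ltW// sm_lt_sp.
Qed.

Lemma speed_free r : 0 <= r <= sp P -> speed P (r, Qfree P r) = V.
Proof.
move=> /andP[]; rewrite le_eqVlt => /predU1P[<- _|r0 rs].
  by rewrite /speed/= eqxx.
by rewrite (speed_Qfree hP)// r0.
Qed.

Lemma Omega_f_speed u : Omega_f P u -> speed P u = V.
Proof. by case: u => r q -[/= h ->]; exact: speed_free. Qed.

Lemma Omega_f_c u : Omega_f P u -> sm P <= u.1 -> Omega_c P u.
Proof.
case: u => r q -[/= /andP[_ rs] ->] sr.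
by have [|w [Dw _ ->]] := @Qfree_w r; first by rewrite sr.
Qed.

Lemma Omega_sm_le u : Omega P u -> sm P <= u.1 -> Omega_c P u.
Proof. by case=> // Of; exact: Omega_f_c. Qed.

Lemma Omega_lt_sm u : Omega P u -> u.1 < sm P -> Omega_f P u.
Proof. by case=> // -[/andP[h _] _ _]; rewrite ltNge h. Qed.

Lemma wbar_c u : Omega_c P u -> wbar P u = u.2 / u.1.
Proof.
case=> /andP[h _] _ /andP[h' _]; rewrite /wbar /wcoord ltNge h/=.
by rewrite max_l.
Qed.

Lemma wcoord_c u : Omega_c P u -> wcoord P u = u.2 / u.1.
Proof. by case=> /andP[h _] _ _; rewrite /wcoord ltNge h. Qed.

Lemma wcoord_D w r : D w r -> wcoord P (r, w * r) = w.
Proof. by move=> Dw; rewrite wcoord_c//= mulfK// gt_eqF// (D_gt0 hP Dw). Qed.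

Lemma wbar_D w r : D w r -> wbar P (r, w * r) = w.
Proof. by move=> Dw; rewrite wbar_c//= mulfK// gt_eqF// (D_gt0 hP Dw). Qed.

Lemma wbar_f u : Omega_f P u -> u.1 < sm P -> wbar P u = wm P.
Proof.
move=> _ us; rewrite /wbar /wcoord us max_r// gerDl.
rewrite mulr_ge0_le0 ?(ltW (vmax_gt0 hP))// subr_le0 ler_pdivrMr ?mul1r ?ltW//.
exact: sm_gt0.
Qed.

Lemma Omega_cP u : Omega_c P u ->
  exists w r, [/\ D w r, u = (r, w * r) & wbar P u = w].
Proof.
move=> Ou; exists (u.2 / u.1), u.1; rewrite -(Omega_c_eta hP Ou).
by split=> //; exact: wbar_c.
Qed.

Lemma wbar_range u : Omega P u -> wrange P (wbar P u).
Proof.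
move=> Ou; have [us|su] := ltP u.1 (sm P).
  by rewrite wbar_f//; [exact: wm_range|exact: Omega_lt_sm].
have [w [r [Dw _ ->]]] := Omega_cP (Omega_sm_le Ou su).
exact: (D_range hP Dw).
Qed.

Lemma Omega_state u : Omega P u -> u = state_on P (wbar P u) u.1.
Proof.
move=> Ou; have [us|su] := ltP u.1 (sm P).
  have Of := Omega_lt_sm Ou us; rewrite wbar_f//; case: Of => /andP[u0 _] e.
  by rewrite state_on_free ?u0 ?ltW// -e; exact: surjective_pairing.
have [w [r [Dw e ->]]] := Omega_cP (Omega_sm_le Ou su).
by rewrite e state_on_D.
Qed.

Lemma Omega_speed u : Omega P u -> 0 <= speed P u <= V.
Proof.
case=> [/Omega_f_speed ->|[]//]; by rewrite lexx ltW// vmax_gt0.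
Qed.

Lemma Omega_rho u : Omega P u -> 0 <= u.1 <= M.
Proof.
case=> [[/andP[h1 h2] _]|[/andP[h1 h2] _ _]].
  by rewrite h1 (le_trans h2)// ltW// sp_lt_rhomax.
by rewrite h2 andbT (le_trans _ h1)// ltW// sm_gt0.
Qed.

(** At density [sm P] every curve has speed at least V, with equality only for w_-. This makes the
    definitions by cases at [sm P] match there. *)
Lemma D_sm w : D w (sm P) -> w = wm P.
Proof.
move=> Dw; have [Dm _ _] := (Omega_cE hP _ _).1 Dw.
apply/esym/(cspeed_w_inj hP Dm); rewrite (cspeed_sm hP); first exact: vmax_gt0.
apply/le_anti; rewrite (vmax_le_cspeed_sm hP (D_range hP Dw)).
by have /andP[_ ->] := D_speed hP Dw.
Qed.

Lemma rho_vmax_le w r : D w r -> rho P w V <= r.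
Proof.
move=> Dw; have Ww := D_range hP Dw.
have VV : 0 <= V <= V by rewrite lexx ltW// vmax_gt0.
rewrite leNgt; apply/negP => h.
have /andP[_ cV] := D_speed hP Dw.
have /andP[sr _] := D_bounds hP Dw.
have /andP[_ rM] := D_bounds hP (rho_D hP Ww VV).
have := cspeed_decr hP Ww sr h rM cV; rewrite (cspeed_rho hP Ww VV).
by rewrite ltNge cV.
Qed.

(** Evaluates [psi1], [psi2m] and [ustar] at once. *)
Lemma get_state w v : wrange P w -> 0 <= v <= V ->
  get [set u | [/\ Omega_c P u, wcoord P u = w & speed P u = v]]
  = (rho P w v, w * rho P w v).
Proof.
move=> Ww vV; have Dw := rho_D hP Ww vV.
have : exists u, [set u | [/\ Omega_c P u, wcoord P u = w & speed P u = v]] u.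
  by exists (rho P w v, w * rho P w v); split; rewrite ?wcoord_D// speed_D// cspeed_rho.
move=> /getPex; set u := get _ => -[Ou].
have [w' [r [Dr -> _]]] := Omega_cP Ou; rewrite wcoord_D// speed_D// => <- <-.
by rewrite rho_cspeed.
Qed.

Lemma flow_state_on w r : wrange P w ->
  D w r \/ [/\ w = wm P, 0 <= r & r <= sm P] ->
  flow P (state_on P w r) = Gflux P w r.
Proof.
move=> Ww [Dr|[-> r0 rs]]; first by rewrite state_on_D// /flow speed_D// Gflux_D.
rewrite state_on_free ?r0// /flow speed_free; last first.
  by rewrite r0 (le_trans rs)// ltW// sm_lt_sp.
by rewrite (Gflux_free hP)//; exact: wm_range.
Qed.

End States.

Section Waves.
Context {R : realType}.
Variable P : phase_data R.
Hypothesis hP : standing_hypotheses P.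
Implicit Types (r q w y v x l m : R) (u : R * R).
Local Notation V := (vmax P).
Local Notation M := (rhomax P).
Local Notation D w r := (Omega_c P (r, w * r)).
Local Notation G := (Gflux P).

Lemma clambda_inj w r y : tangent_above P w \/ tangent_below P w ->
  D w r -> D w y -> clambda P w r = clambda P w y -> r = y.
Proof.
move=> t Dr Dy e; apply/eqP/negPn/negP => ry; have yr : y != r by rewrite eq_sym.
by case: t => t; have := t _ _ Dr Dy ry; have := t _ _ Dy Dr yr; rewrite e; lra.
Qed.

Lemma D_between w l m r : D w l -> D w m ->
  Num.min l m <= r <= Num.max l m -> D w r.
Proof.
move=> Dl Dm; case: (leP l m) => lm; first exact: (Omega_c_interval hP Dl Dm).
exact: (Omega_c_interval hP Dm Dl).
Qed.

Lemma clambda_IVT w l m x : D w l -> D w m ->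
  clambda P w l <= x <= clambda P w m ->
  exists y, Num.min l m <= y <= Num.max l m /\ clambda P w y = x.
Proof.
move=> Dl Dm xx.
have cont a b : D w a -> {within `[a, b], continuous (clambda P w)}.
  move=> Da; apply: continuous_in_subspaceT => r; rewrite inE/= in_itv/=.
  move=> /andP[ar _]; apply: (clambda_continuous hP).
  exact: lt_le_trans (D_gt0 hP Da) ar.
have /andP[x1 x2] := xx.
case: (leP l m) => [lm|/ltW ml].
  have [| |y] := @IVT R (clambda P w) l m x lm; first exact: cont.
    by rewrite ge_min le_max x1 x2 orbT.
  by rewrite in_itv/= => yy e; exists y.
have [| |y] := @IVT R (clambda P w) m l x ml; first exact: cont.
  by rewrite ge_min le_max x1 x2 orbT.
by rewrite in_itv/= => yy e; exists y.
Qed.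

(** The curvature for which the slope increases on the way from [l] to [m], as it must in a
    rarefaction. *)
Definition tangent_dir w l m :=
  if l <= m then tangent_below P w else tangent_above P w.

Lemma rarefaction_profile w l m x : D w l -> D w m -> l != m ->
  tangent_dir w l m -> exists y,
  [/\ rarefaction1 P (l, w * l) (m, w * m) x = (y, w * y),
      Num.min l m <= y <= Num.max l m,
      y = l \/ clambda P w y <= x & y = m \/ x <= clambda P w y].
Proof.
move=> Dl Dm lm td; rewrite /rarefaction1.
rewrite -[lambda1 P (l, _)]/(clambda P w l) -[lambda1 P (m, _)]/(clambda P w m).
case: ltP => [xl|lx].
  exists l; split=> //; [by rewrite ge_min le_max !lexx|by left|right].
  exact: ltW.
case: ltP => [xm|mx]; last first.
  exists m; split=> //; [by rewrite ge_min le_max !lexx !orbT|by right|by left].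
have [|y [yy ey]] := @clambda_IVT w l m x Dl Dm; first by rewrite lx ltW.
have Dy : D w y := D_between Dl Dm yy.
exists y; split=> //; [|by right; rewrite ey|by right; rewrite ey].
rewrite (wcoord_D hP Dl); set A := [set u | _].
have : A (get A).
  by apply: getPex; exists (y, w * y); split; rewrite ?(wcoord_D hP)//.
case=> Ou; have [w' [r [Dr -> _]]] := Omega_cP hP Ou.
rewrite (wcoord_D hP Dr) => ew; rewrite ew in Dr * => er.
suff -> : r = y by [].
apply: (@clambda_inj w) => //; last by rewrite ey.
by move: td; rewrite /tangent_dir; case: (leP l m); [right|left].
Qed.

Lemma rarefaction_Ol w l m x y : D w l -> D w m -> tangent_dir w l m ->
  Num.min l m <= y <= Num.max l m ->
  y = l \/ clambda P w y <= x -> y = m \/ x <= clambda P w y ->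
  Ol_strict (G w) x l m y.
Proof.
move=> Dl Dm td; apply: Ol_rarefaction.
move: td; rewrite /tangent_dir; case: (leP l m) => [lm|ml] t r z rr zz rz.
  have Dr := Omega_c_interval hP Dl Dm rr; have Dz := Omega_c_interval hP Dl Dm zz.
  by rewrite !(Gflux_D hP)//; exact: t.
have Dr := Omega_c_interval hP Dm Dl rr; have Dz := Omega_c_interval hP Dm Dl zz.
by rewrite !(Gflux_D hP)//; exact: t.
Qed.

Lemma Lambda_D w l m : D w l -> D w m ->
  Lambda P (l, w * l) (m, w * m) = (G w m - G w l) / (m - l).
Proof. by move=> Dl Dm; rewrite /Lambda /flow !(Gflux_D hP). Qed.

(** The tangent at [r] bounds both end values; the weights [m - r] and [r - l] eliminate its
    slope. *)
Lemma chord_above w l m r : tangent_above P w \/ tangent_on P w ->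
  D w l -> D w m -> l <= r <= m ->
  (r - l) * G w m + (m - r) * G w l <= (m - l) * G w r.
Proof.
move=> t Dl Dm rr; have Dr := Omega_c_interval hP Dl Dm rr.
have /andP[lr rm] := rr; rewrite !(Gflux_D hP)//.
case: t => t; last first.
  by have := t _ _ Dl Dr; have := t _ _ Dm Dr; nra.
move: lr; rewrite le_eqVlt => /predU1P[->|lr]; first by rewrite subrr; lra.
move: rm; rewrite le_eqVlt => /predU1P[<-|rm]; first by rewrite subrr; lra.
have h1 := t _ _ Dl Dr (ltac:(by rewrite lt_eqF)).
have h2 := t _ _ Dm Dr (ltac:(by rewrite gt_eqF)).
nra.
Qed.

Lemma chord_below w l m r : tangent_below P w \/ tangent_on P w ->
  D w l -> D w m -> l <= r <= m ->
  (m - l) * G w r <= (r - l) * G w m + (m - r) * G w l.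
Proof.
move=> t Dl Dm rr; have Dr := Omega_c_interval hP Dl Dm rr.
have /andP[lr rm] := rr; rewrite !(Gflux_D hP)//.
case: t => t; last first.
  by have := t _ _ Dl Dr; have := t _ _ Dm Dr; nra.
move: lr; rewrite le_eqVlt => /predU1P[->|lr]; first by rewrite subrr; lra.
move: rm; rewrite le_eqVlt => /predU1P[<-|rm]; first by rewrite subrr; lra.
have h1 := t _ _ Dl Dr (ltac:(by rewrite lt_eqF)).
have h2 := t _ _ Dm Dr (ltac:(by rewrite gt_eqF)).
nra.
Qed.

(** [e] is the speed of the only jump, where optimisers may tie; elsewhere uniqueness is recorded
    for the passage to the limit. *)
Definition is_profile w l m (f : R -> R * R) (Q : R -> Prop) :=
  exists e, forall x, Q x -> exists y, [/\ f x = state_on P w y,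
    Ol (G w) x l m y & x != e -> Ol_strict (G w) x l m y].

Lemma shock_profile w l m : D w l -> D w m -> l != m ->
  (if l <= m then tangent_above P w \/ tangent_on P w
   else tangent_below P w \/ tangent_on P w) ->
  is_profile w l m (shock P (l, w * l) (m, w * m)) setT.
Proof.
move=> Dl Dm lm t; exists (Lambda P (l, w * l) (m, w * m)) => x _.
rewrite /shock /jump /Defs.glue (Lambda_D Dl Dm); set s := _ / _.
have es : G w m = G w l + s * (m - l).
  by rewrite /s; field; rewrite subr_eq0 eq_sym.
have [] := @Ol_jump _ (G w) x l m lm; rewrite -/s.
  move: lm t; rewrite neq_lt; case: (leP l m) => lm' /= lm t r rr.
    have ml : 0 < m - l.
      rewrite subr_gt0 lt_neqAle lm' andbT lt_eqF//.
      by case/orP: lm => //; rewrite ltNge lm'.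
    by have h := chord_above t Dl Dm rr; rewrite es in h; rewrite -(ler_pM2l ml); lra.
  have ml : 0 < l - m by rewrite subr_gt0.
  by have h := chord_below t Dm Dl rr; rewrite es in h; rewrite -(ler_pM2l ml); lra.
move=> h1 h2; exists (if x < s then l else m); split => //.
by case: ifP; rewrite (state_on_D hP).
Qed.

Lemma wave1_profile w l m : D w l -> D w m ->
  is_profile w l m (wave1 P (l, w * l) (m, w * m)) setT.
Proof.
move=> Dl Dm; have [<-|lm] := eqVneq l m.
  exists 0 => x _; exists l; suff h : Ol_strict (G w) x l l l.
    split=> //; last exact: Ol_strictW.
    rewrite (state_on_D hP)// /wave1 !ltxx /shock /jump /Defs.glue /rarefaction1.
    by case: ifP => _; [|case: ifP => _]; case: ltP.
  rewrite /Ol_strict lexx; split=> // r /le_anti ->.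
  by rewrite eqxx.
have rar : tangent_dir w l m ->
    is_profile w l m (rarefaction1 P (l, w * l) (m, w * m)) setT.
  move=> td; exists 0 => x _; have [y [e yy yl ym]] := rarefaction_profile x Dl Dm lm td.
  have := rarefaction_Ol Dl Dm td yy yl ym => h.
  exists y; split=> //; last exact: Ol_strictW.
  by rewrite e (state_on_D hP)//; exact: D_between yy.
rewrite /wave1 (wcoord_D hP Dl).
case: (Lcurve_trichotomy hP (D_range hP Dl)) => [[c t]|[nc c t]|[nc c t]].
- rewrite (asboolT c)/=;
  have [lm'|ml|e] := ltgtP l m; last by rewrite e eqxx in lm.
    by apply: shock_profile => //; rewrite (ltW lm'); left.
  by apply: rar; rewrite /tangent_dir leNgt ml.
- rewrite (asboolF nc) (asboolT c)/=;
  have [lm'|ml|e] := ltgtP l m; last by rewrite e eqxx in lm.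
    by apply: rar; rewrite /tangent_dir ltW.
  by apply: shock_profile => //; rewrite leNgt ml; left.
- rewrite (asboolF nc) (asboolF c)/=; apply: shock_profile => //.
  by case: ifP; right.
Qed.

End Waves.

(** * Phase transitions as minimisers *)

Section Riemann.
Context {R : realType}.
Variable P : phase_data R.
Hypothesis hP : standing_hypotheses P.
Implicit Types (r q w y v x l m : R) (u : R * R).
Local Notation V := (vmax P).
Local Notation M := (rhomax P).
Local Notation D w r := (Omega_c P (r, w * r)).
Local Notation G := (Gflux P).

Lemma Gflux_wm_free l : l <= sm P -> G (wm P) l = l * V.
Proof. by move=> ls; rewrite (Gflux_free hP)//; exact: wm_range. Qed.

Lemma Lambda_free l m : 0 <= l < sm P -> D (wm P) m ->
  Lambda P (l, Qfree P l) (m, wm P * m)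
  = (G (wm P) m - G (wm P) l) / (m - l).
Proof.
move=> /andP[l0 ls] Dm; rewrite /Lambda /flow (Gflux_D hP)//=.
rewrite (speed_free hP) ?Gflux_wm_free ?(ltW ls)//.
by rewrite l0 ltW// (lt_trans ls)// sm_lt_sp.
Qed.

(** The condition of (R.4) makes the transition admissible. On the free branch the graph rises with
    slope V >= s. Beyond [sm P] a concave or linear graph lies above the chord joining [sm P] to
    [m], and a convex one above its tangent at [m], of slope at most s. *)
Lemma chord_phase l m r s : l < sm P -> D (wm P) m ->
  G (wm P) m = G (wm P) l + s * (m - l) -> clambda P (wm P) m <= s ->
  l <= r <= m -> G (wm P) l + s * (r - l) <= G (wm P) r.
Proof.
move=> ls Dm es sl /andP[lr rm]; have Ds := Omega_c_sm hP.
have V0 := vmax_gt0 hP.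
have /andP[sm_m _] := D_bounds hP Dm; have lm : l < m by lra.
have sV : s <= V.
  have h : G (wm P) m <= m * V.
    by rewrite (Gflux_D hP)// ler_pM2l ?(D_gt0 hP Dm)//; have /andP[] := D_speed hP Dm.
  have ml : 0 < m - l by lra.
  rewrite -(ler_pM2r ml); move: h; rewrite es (Gflux_wm_free (ltW ls)); lra.
have [rs|sr] := leP r (sm P).
  by rewrite !Gflux_wm_free ?(ltW ls)//; nra.
have h : G (wm P) l + s * (sm P - l) <= G (wm P) (sm P).
  by rewrite !Gflux_wm_free ?(ltW ls)//; nra.
have Dr : D (wm P) r by apply: (Omega_c_interval hP Ds Dm); rewrite ltW.
have sm_lt_m : 0 < m - sm P by lra.
have ca (t : tangent_above P (wm P) \/ tangent_on P (wm P)) :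
    (m - sm P) * (G (wm P) l + s * (r - l)) <= (m - sm P) * G (wm P) r.
  have := chord_above hP t Ds Dm (r := r); rewrite (ltW sr) rm => /(_ isT).
  apply: le_trans; rewrite es; nra.
case: (Lcurve_trichotomy hP (wm_range hP)) => [[_ t]|[_ _ t]|[_ _ t]].
- by rewrite -(ler_pM2l sm_lt_m); apply: ca; left.
- move: rm; rewrite le_eqVlt => /predU1P[->|rm]; first by rewrite es.
  have := t _ _ Dr Dm (ltac:(by rewrite lt_eqF)).
  rewrite -!(Gflux_D hP)// es => h'.
  have : (clambda P (wm P) m - s) * (r - m) >= 0 by nra.
  lra.
- by rewrite -(ler_pM2l sm_lt_m); apply: ca; right.
Qed.

(* Clause (R.5) occurs only when L_{w_-} is strictly convex. *)
Lemma tangent_point l m : 0 <= l < sm P -> D (wm P) m ->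
  let s := Lambda P (l, Qfree P l) (m, wm P * m) in
  s < clambda P (wm P) m ->
  [/\ sm P < m, tangent_below P (wm P) &
   exists p, [/\ sm P <= p <= m, utangent P (l, Qfree P l) = (p, wm P * p) &
    G (wm P) p = G (wm P) l + clambda P (wm P) p * (p - l)]].
Proof.
move=> lr Dm; rewrite (Lambda_free lr Dm) /=; set s := _ / _ => sl.
have /andP[l0 ls] := lr.
have Ds := Omega_c_sm hP; have V0 := vmax_gt0 hP.
have /andP[sm_m _] := D_bounds hP Dm; have lm : l < m by lra.
have es : G (wm P) m = G (wm P) l + s * (m - l).
  by rewrite /s; field; rewrite gt_eqF// subr_gt0.
clearbody s.
have l_lt0 r : D (wm P) r -> clambda P (wm P) r < 0 := @clambda_lt0 _ _ hP _ _.
have Gs := Gflux_wm_free (lexx (sm P)); have Gl := Gflux_wm_free (ltW ls).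
have sm_lt_m : sm P < m.
  move: sm_m; rewrite le_eqVlt => /predU1P[e|//].
  have e' : s = V.
    have ml : m - l != 0 by rewrite subr_eq0 gt_eqF.
    by apply: (mulIf ml); move: es; rewrite -e Gs Gl => h; lra.
  by have := l_lt0 _ Dm; lra.
(* Since s < lambda1 < 0 at [m], the tangent at [m] takes at [sm P] a value below [V * l], hence
   below the graph; concave and linear graphs are thereby excluded. *)
have tb : tangent_below P (wm P).
  have imp : G (wm P) (sm P) <=
      G (wm P) m + clambda P (wm P) m * (sm P - m) -> tangent_below P (wm P).
    move=> h; exfalso.
    have h2 : s < 0 by apply: lt_trans sl (l_lt0 _ Dm).
    move: h; rewrite Gs es Gl => h.
    have : (s - clambda P (wm P) m) * (m - sm P) < 0 by nra.
    nra.
  case: (Lcurve_trichotomy hP (wm_range hP)) => [[_ t]|[_ _ t]//|[_ _ t]].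
  - apply: imp; rewrite !(Gflux_D hP)//; apply/ltW/t => //.
    by rewrite lt_eqF.
  - by apply: imp; rewrite !(Gflux_D hP)// -t.
split=> //.
(* A zero of [f] is a point whose tangent passes through the free state. At [sm P] the slope is
   negative while the chord has slope V; at [m] the sign of [f] is the condition of (R.5). *)
pose f r := clambda P (wm P) r * (r - l) - (r * cspeed P (wm P) r - G (wm P) l).
have fs : f (sm P) < 0.
  by rewrite /f Gl (cspeed_sm hP); have := l_lt0 _ Ds; nra.
have fm : 0 < f m.
  have ml : 0 < m - l by rewrite subr_gt0.
  by rewrite /f -(Gflux_D hP)// es; have := sl; rewrite -(ltr_pM2r ml); lra.
have cid (r : R) : y @[y --> r] --> r by exact: cvg_id.
have [| |p] := @IVT R f (sm P) m 0 sm_m.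
- apply: continuous_in_subspaceT => r; rewrite inE/= in_itv/= => /andP[sr _].
  have r0 : 0 < r := lt_le_trans (sm_gt0 hP) sr.
  apply: cvgB.
    apply: cvgM; first exact: (clambda_continuous hP).
    by apply: cvgB; [exact: cid|exact: cvg_cst].
  apply: cvgB; last exact: cvg_cst.
  by apply: cvgM; [exact: cid|exact: (cspeed_continuous hP)].
- by rewrite ge_min le_max (ltW fs) (ltW fm) orbT.
rewrite in_itv/= => pp fp.
have Dp : D (wm P) p := Omega_c_interval hP Ds Dm pp.
have tang r : D (wm P) r -> l < r ->
    Lambda P (l, Qfree P l) (r, wm P * r) = clambda P (wm P) r ->
    G (wm P) r = G (wm P) l + clambda P (wm P) r * (r - l).
  move=> Dr lr'; rewrite (Lambda_free lr Dr) => <-; field.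
  by rewrite subr_eq0 gt_eqF.
set A := [set u | [/\ Omega_c P u, wcoord P u = wm P
  & Lambda P (l, Qfree P l) u = lambda1 P u]].
have [] : A (get A).
  apply: getPex; exists (p, wm P * p); split=> //; first exact: wcoord_D.
  rewrite (Lambda_free lr Dp) -[RHS]/(clambda P (wm P) p).
  have pl : 0 < p - l by lra.
  apply: (mulIf (lt0r_neq0 pl)); rewrite divfK ?gt_eqF// (Gflux_D hP Dp).
  by move: fp; rewrite /f; lra.
rewrite -/(utangent P (l, Qfree P l)) => Ou.
have [w [r [Dr -> _]]] := Omega_cP hP Ou.
rewrite (wcoord_D hP Dr) => ew; rewrite {}ew in Dr *.
have /andP[sr _] := D_bounds hP Dr.
have lr' : l < r := lt_le_trans ls sr.
move=> /(tang _ Dr lr') er; exists r; split=> //.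
(* The tangent point picked by [get] need not be [p]; strict convexity rules out one beyond [m]. *)
rewrite sr/= leNgt; apply/negP => mr.
have h1 := tb _ _ Dm Dr (ltac:(by rewrite lt_eqF)).
have h2 := tb _ _ Dr Dm (ltac:(by rewrite gt_eqF)).
rewrite -!(Gflux_D hP)// es er in h1 h2.
have h3 : clambda P (wm P) r < s.
  by rewrite -(ltr_pM2r (_ : 0 < m - l)) ?subr_gt0//; lra.
have h4 : s * (r - m) < clambda P (wm P) m * (r - m).
  by rewrite ltr_pM2r// subr_gt0.
have : s < clambda P (wm P) r.
  by rewrite -(ltr_pM2r (_ : 0 < r - l)) ?subr_gt0//; lra.
lra.
Qed.

(** In (R.5) the line from [l] tangent at [p] supports the graph from below. Left of its slope [s]
    the minimiser is therefore [l]; from [s] on, [p] does no worse than everything on [[l, p]], so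
    the rarefaction minimiser on [[p, m]] is global. *)
Lemma phase_profile l m : 0 <= l < sm P -> D (wm P) m ->
  let ul := (l, Qfree P l) in let um := (m, wm P * m) in
  is_profile P (wm P) l m
    (if lambda1 P um <= Lambda P ul um then shock P ul um
     else Defs.glue (Lambda P ul (utangent P ul)) (fun=> ul)
            (rarefaction1 P (utangent P ul) um)) setT.
Proof.
move=> lr Dm /=; have /andP[l0 ls] := lr.
have /andP[sm_m _] := D_bounds hP Dm; have lm : l < m := lt_le_trans ls sm_m.
have Ul : state_on P (wm P) l = (l, Qfree P l) by rewrite (state_on_free hP)// l0 ltW.
have Um : state_on P (wm P) m = (m, wm P * m) by rewrite (state_on_D hP).
rewrite -[lambda1 P _]/(clambda P (wm P) m).
case: leP => [sl|sl].
  exists (Lambda P (l, Qfree P l) (m, wm P * m)) => x _.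
  rewrite (Lambda_free lr Dm) in sl *; set s := _ / _ in sl *.
  have es : G (wm P) m = G (wm P) l + s * (m - l).
    by rewrite /s; field; rewrite gt_eqF// subr_gt0.
  have [] := @Ol_jump _ (G (wm P)) x l m (ltac:(by rewrite lt_eqF)); rewrite -/s.
    by rewrite ltW// => r rr; exact: (chord_phase ls Dm es sl rr).
  move=> h1 h2; exists (if x < s then l else m); split => //.
  rewrite /shock /jump /Defs.glue (Lambda_free lr Dm) -/s.
  by case: ifP; rewrite ?Ul ?Um.
have [sm_lt_m tb [p [pp -> ep]]] := tangent_point lr Dm sl.
have Dp : D (wm P) p := Omega_c_interval hP (Omega_c_sm hP) Dm pp.
have /andP[sp pm] := pp; have lp : l < p by lra.
set s := clambda P (wm P) p in ep.
have -> : Lambda P (l, Qfree P l) (p, wm P * p) = s.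
  by rewrite (Lambda_free lr Dp) ep; field; rewrite gt_eqF// subr_gt0.
have s0 : s < 0 by exact: (clambda_lt0 hP Dp).
have chord r : l <= r <= m -> G (wm P) l + s * (r - l) <= G (wm P) r.
  move=> /andP[lr' rm]; have [rs|sr] := leP r (sm P).
    by rewrite !Gflux_wm_free ?(ltW ls)//; have := vmax_gt0 hP; nra.
  have Dr : D (wm P) r.
    by apply: (Omega_c_interval hP (Omega_c_sm hP) Dm); rewrite rm ltW.
  have [->|rp] := eqVneq r p; first by rewrite ep.
  have := tb _ _ Dr Dp rp; rewrite -!(Gflux_D hP)// -/s ep; lra.
clearbody s; exists s => x _; rewrite /Defs.glue; case: ltP => [xs|sx].
  exists l; have h : Ol_strict (G (wm P)) x l m l.
    apply: Ol_strict_up; rewrite ?lexx ?(ltW lm)// => r rr rl.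
    have := chord _ rr; have : 0 < r - l.
      by rewrite subr_gt0 lt_neqAle eq_sym rl; case/andP: rr.
    by nra.
  by split=> //; exact: Ol_strictW.
have [pm'|pm'] := eqVneq p m.
  exists m; rewrite pm' in ep *.
  have ge r : l <= r <= m -> G (wm P) m - x * m <= G (wm P) r - x * r.
    by move=> rr; have := chord _ rr; nra.
  split.
  - rewrite Um /rarefaction1; case: ltP => // h; case: ltP.
  - by apply: Ol_up; rewrite ?lexx ?(ltW lm)// => r rr; lra.
  - move=> xs; apply: Ol_strict_up; rewrite ?lexx ?(ltW lm)// => r rr rm.
    have := chord _ rr; have : r < m by rewrite lt_neqAle rm; case/andP: rr.
    have : s < x by rewrite lt_neqAle eq_sym xs.
    by nra.
have pm'' : p < m by rewrite lt_neqAle pm'.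
have td : tangent_dir P (wm P) p m by rewrite /tangent_dir pm.
have [y [ey yy yl ym]] := rarefaction_profile hP x Dp Dm pm' td.
have := rarefaction_Ol hP Dp Dm td yy yl ym.
rewrite (min_l pm) (max_r pm) in yy; have /andP[py ym'] := yy.
rewrite /Ol_strict pm => -[_ st].
have Dy : D (wm P) y := Omega_c_interval hP Dp Dm yy.
have gep r : l <= r <= p -> G (wm P) p - x * p <= G (wm P) r - x * r.
  by move=> rr; have := chord r (ltac:(lra)); nra.
have gey : G (wm P) y - x * y <= G (wm P) p - x * p.
  have [->//|yp] := eqVneq y p; apply/ltW/st; first by rewrite lexx pm.
  by rewrite eq_sym.
exists y; split; first by rewrite ey (state_on_D hP).
- apply: Ol_up (ltW lm) _ _ _; first lra.
  + move=> r rr; have [rp|pr] := leP r p.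
      by apply: le_trans gey _; apply: gep; lra.
    have [->//|ry] := eqVneq r y; apply/ltW/st => //; lra.
  + move=> r rr; apply: st; first lra.
    by rewrite gt_eqF//; case/andP: rr.
- move=> xs; apply: Ol_strict_up (ltW lm) _ _; first lra.
  move=> r rr ry; have [pr|rp] := leP p r; first by apply: st => //; lra.
  apply: le_lt_trans gey _.
  have : s < x by rewrite lt_neqAle eq_sym xs.
  by have := chord r (ltac:(lra)); nra.
Qed.

End Riemann.

(** * All clauses of the Riemann solver as one scalar problem *)

Section RiemannForm.
Context {R : realType}.
Variable P : phase_data R.
Hypothesis hP : standing_hypotheses P.
Implicit Types (r q w y v x l m : R) (u : R * R).
Local Notation V := (vmax P).
Local Notation M := (rhomax P).
Local Notation D w r := (Omega_c P (r, w * r)).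
Local Notation G := (Gflux P).

Lemma is_profile_glue w l m f g v : is_profile P w l m f setT ->
  is_profile P w l m (Defs.glue v f g) (fun x => x < v).
Proof.
by case=> e h; exists e => x xv; rewrite /Defs.glue xv; exact: h.
Qed.

(** Two free states: the scalar target is [sm P], up to which the flux has slope V, so for x < V
    nothing moves. *)
Lemma is_profile_rest w l : 0 <= l < sm P ->
  w = wm P -> is_profile P w l (sm P) (fun=> (l, Qfree P l)) (fun x => x < V).
Proof.
move=> /andP[l0 ls] ->; exists 0 => x xV; exists l.
have h : Ol_strict (G (wm P)) x l (sm P) l.
  apply: Ol_strict_up; rewrite ?lexx ?(ltW ls)// => r /andP[lr rs] rl.
  rewrite !(Gflux_wm_free hP) ?(ltW ls)//.
  have : l < r by rewrite lt_neqAle eq_sym rl.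
  by nra.
split=> //; last exact: Ol_strictW.
by rewrite (state_on_free hP)// l0 ltW.
Qed.

Lemma vmax_itv : 0 <= V <= V.
Proof. by rewrite lexx ltW// (vmax_gt0 hP). Qed.

Lemma riemann_form ul ur : Omega P ul -> Omega P ur ->
  is_profile P (wbar P ul) ul.1 (rho P (wbar P ul) (speed P ur))
    (riemann P ul ur) (fun x => x < speed P ur) /\
  forall x, speed P ur <= x -> riemann P ul ur x = ur.
Proof.
move=> Ol_ Or_; rewrite /riemann.
case: ifPn => [|nf].
  move=> /andP[/set_mem fl /set_mem fr]; rewrite (Omega_f_speed hP fr).
  split; last by move=> x xV; rewrite /jump /Defs.glue ltNge xV.
  have [ls|sl] := ltP ul.1 (sm P).
    rewrite (wbar_f hP fl ls) (rho_wm_vmax hP).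
    case: ul fl ls {Ol_} => l ql [/= /andP[l0 _] ->] ls.
    have [|e h] := @is_profile_rest _ l _ (erefl (wm P)); first by rewrite l0.
    by exists e => x xV; rewrite /jump /Defs.glue xV; exact: h.
  have cl := Omega_f_c hP fl sl.
  have [w [l [Dl el ->]]] := Omega_cP hP cl.
  have -> : rho P w V = l.
    by rewrite -(Omega_f_speed hP fl) el -[speed P _]/(cspeed P w l) rho_cspeed.
  rewrite el; have [e h] := wave1_profile hP Dl Dl.
  exists e => x xV; have [y [ey O1 O2]] := h x I.
  exists y; split=> //; rewrite /jump /Defs.glue xV.
  by rewrite (Ol_refl O1) (state_on_D hP).
case: ifPn => [|nc].
  move=> /andP[/set_mem cl /set_mem cr].
  split; last by move=> x xV; rewrite /Defs.glue ltNge xV.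
  have Ww := wbar_range hP Ol_; have vV := Omega_speed hP Or_.
  rewrite /ustar.
  have -> : wcoord P ul = wbar P ul by rewrite (wcoord_c cl) (wbar_c cl).
  rewrite (get_state hP Ww vV); apply: is_profile_glue.
  have [w [l [Dl el ew]]] := Omega_cP hP cl; rewrite ew in Ww *; rewrite el.
  by apply: (wave1_profile hP) => //; exact: (rho_D hP).
case: ifPn => [|n3].
  move=> /andP[/set_mem[cl nfp] /set_mem[fr rs]].
  rewrite (Omega_f_speed hP fr); split; last by move=> x xV; rewrite /Defs.glue ltNge xV.
  have Ww := wbar_range hP Ol_.
  rewrite /psi1; have -> : wcoord P ul = wbar P ul by rewrite (wcoord_c cl) (wbar_c cl).
  rewrite (get_state hP Ww vmax_itv); apply: is_profile_glue.
  have [w [l [Dl el ew]]] := Omega_cP hP cl; rewrite ew in Ww *; rewrite el.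
  by apply: (wave1_profile hP) => //; exact: (rho_D hP _ vmax_itv).
have lf : ~ Omega_c P ul -> Omega_fm P ul.
  move=> cl; have fl : Omega_f P ul by case: Ol_.
  by split=> //=; rewrite ltNge; apply/negP => /(Omega_f_c hP fl).
have rf : ~ Omega_c P ur -> Omega_fm P ur.
  move=> cr; have fr : Omega_f P ur by case: Or_.
  by split=> //=; rewrite ltNge; apply/negP => /(Omega_f_c hP fr).
have cm u : Omega_c P u -> ~ Omega_f P u -> Omega_cm P u.
  by move=> cu fu; split=> // -[].
case: ifPn => [|n4]; last first.
  exfalso.
  have [cl|cl] := pselect (Omega_c P ul).
    have [cr|cr] := pselect (Omega_c P ur).
      by move/negP: nc; apply; apply/andP; split; apply/mem_set.
    have [fl|fl] := pselect (Omega_f P ul).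
      have [fr _] := rf cr.
      by move/negP: nf; apply; apply/andP; split; apply/mem_set.
    by move/negP: n3; apply; apply/andP; split; apply/mem_set; [exact: cm|exact: rf].
  have [fl ls] := lf cl.
  have [fr|fr] := pselect (Omega_f P ur).
    by move/negP: nf; apply; apply/andP; split; apply/mem_set.
  have cr : Omega_c P ur by case: Or_.
  by move/negP: n4; apply; apply/andP; split; apply/mem_set; [exact: lf|exact: cm].
move=> /andP[/set_mem[fl ls] /set_mem[cr _]].
have vV := Omega_speed hP Or_; have Ww := wm_range hP.
rewrite (wbar_f hP fl ls) /psi2m (get_state hP Ww vV).
have Dm := rho_D hP Ww vV.
case: ul fl ls {Ol_ nf nc n3 lf cm} => l ql [/= /andP[l0 _] ->] ls.
have lr : 0 <= l < sm P by rewrite l0.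
have [e h] := phase_profile hP lr Dm.
split; last first.
  move=> x xv; case: ifP => [_|/negbT]; rewrite /Defs.glue; first by rewrite ltNge xv.
  rewrite -ltNge -[lambda1 P (rho _ _ _, _)]/(clambda P _ _) => sl.
  have [sm_lt_m tb [p [pp -> ep]]] := tangent_point hP lr Dm sl.
  have Dp := Omega_c_interval hP (Omega_c_sm hP) Dm pp.
  have pl : l < p by case/andP: pp => + _; exact: lt_le_trans.
  have -> : Lambda P (l, Qfree P l) (p, wm P * p) = clambda P (wm P) p.
    by rewrite (Lambda_free hP lr Dp) ep; field; rewrite gt_eqF// subr_gt0.
  (* The transition of (R.5) travels at a slope [lambda1 < 0], hence to the left of [speed P ur]. *)
  have x0 : 0 <= x by case/andP: vV => + _ => /le_trans; apply.
  by rewrite ltNge (le_trans _ x0) ?ltNge ?xv// ltW// (clambda_lt0 hP).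
exists e => x xv; have [y [ey O1 O2]] := h x I; exists y; split=> //; rewrite -ey.
by case: ifP => _; rewrite /Defs.glue xv.
Qed.

End RiemannForm.

(** * Scalar profiles near x = 0 *)

Section NearZero.
Context {R : realType}.
Variable P : phase_data R.
Hypothesis hP : standing_hypotheses P.
Implicit Types (r q w y v x l m : R) (u : R * R).
Local Notation V := (vmax P).
Local Notation M := (rhomax P).
Local Notation D w r := (Omega_c P (r, w * r)).
Local Notation G := (Gflux P).

(** The constant is minus the larger end slope. Its being uniform ends every 1-wave at a speed
    bounded away from zero, so the solution is constant near x = 0. *)
Lemma flux_slope w l m : D w l -> D w m -> exists2 d, 0 < d &
  forall r1 r2, Num.min l m <= r1 -> r1 < r2 -> r2 <= Num.max l m ->
    G w r2 - G w r1 <= - d * (r2 - r1).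
Proof.
move=> Dl Dm; exists (- Num.max (clambda P w l) (clambda P w m)).
  by rewrite oppr_gt0 gt_max !(clambda_lt0 hP).
move=> r1 r2 l1 r12 r2m; rewrite opprK.
have b1 : Num.min l m <= r1 <= Num.max l m by rewrite l1 ltW// (lt_le_trans r12).
have b2 : Num.min l m <= r2 <= Num.max l m by rewrite r2m ltW// (le_lt_trans l1).
have D1 := D_between hP Dl Dm b1; have D2 := D_between hP Dl Dm b2.
have le_max r : Num.min l m <= r <= Num.max l m ->
    clambda P w r <= Num.max (clambda P w l) (clambda P w m).
  case: (leP l m) => lm; first exact: clambda_le_max.
  by rewrite maxC; exact: clambda_le_max.
rewrite !(Gflux_D hP)//; apply: le_trans (flow_slope hP D1 D2 r12) _.
by rewrite ler_pM2r ?subr_gt0// ge_max !le_max.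
Qed.

Lemma Ol_end_congested w l m : D w l -> D w m ->
  exists2 d, 0 < d & forall x, - d < x -> Ol (G w) x l m m.
Proof.
move=> Dl Dm; have [d d0 h] := flux_slope Dl Dm; exists d => // x dx.
have [lm|ml] := leP l m.
  rewrite (min_l lm) (max_r lm) in h.
  apply: Ol_up; rewrite ?lm ?lexx// => r.
    case/andP=> lr; rewrite le_eqVlt => /predU1P[->//|rm].
    have := h _ _ lr rm (lexx _).
    have : (x + d) * (m - r) > 0 by rewrite mulr_gt0; lra.
    lra.
  lra.
rewrite (min_r (ltW ml)) (max_l (ltW ml)) in h.
apply: Ol_down; rewrite ?(ltW ml) ?lexx// => r.
  case/andP; rewrite le_eqVlt => /predU1P[->//|mr rl].
  have := h _ _ (lexx _) mr rl.
  have : (x + d) * (r - m) > 0 by rewrite mulr_gt0; lra.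
  lra.
lra.
Qed.

Lemma Gflux_ge_right l m r : l < sm P -> D (wm P) m -> sm P <= r <= m ->
  G (wm P) m <= G (wm P) r.
Proof.
move=> ls Dm /andP[sr]; rewrite le_eqVlt => /predU1P[->//|rm].
have Dr : D (wm P) r.
  by apply: (Omega_c_interval hP (Omega_c_sm hP) Dm); rewrite sr ltW.
by rewrite !(Gflux_D hP)//; apply/ltW/(flow_decr hP).
Qed.

(** A drop of flow gives the transition chord the negative slope [- d']; [d] controls the congested
    part of the interval and [d'] the free part. *)
Lemma Ol_end_free l m : l < sm P -> D (wm P) m -> G (wm P) m < G (wm P) l ->
  exists2 d, 0 < d & forall x, - d < x -> x < V -> Ol (G (wm P)) x l m m.
Proof.
move=> ls Dm ml; have Ds := Omega_c_sm hP.
have [d d0 h] := flux_slope Ds Dm.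
have /andP[sm_m _] := D_bounds hP Dm; have lm : l < m := lt_le_trans ls sm_m.
pose d' := (G (wm P) l - G (wm P) m) / (m - l).
have d'0 : 0 < d' by rewrite divr_gt0 ?subr_gt0.
have ed' : G (wm P) l = G (wm P) m + d' * (m - l).
  by rewrite /d'; field; rewrite gt_eqF// subr_gt0.
clearbody d'.
exists (Num.min d d'); first by rewrite lt_min d0.
move=> x; rewrite ltrNl lt_min => /andP[xd xd'] xV.
rewrite (min_l sm_m) (max_r sm_m) in h.
apply: Ol_up; rewrite ?(ltW lm) ?lexx// => r; last lra.
case/andP=> lr rm; have [rs|sr] := leP r (sm P).
  have : (V - x) * (r - l) >= 0 by rewrite mulr_ge0; lra.
  have : (x + d') * (m - l) > 0 by rewrite mulr_gt0; lra.
  move: ed'; rewrite (Gflux_wm_free hP (ltW ls)) (Gflux_wm_free hP rs); lra.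
move: rm; rewrite le_eqVlt => /predU1P[->//|rm].
have := h _ _ (ltW sr) rm (lexx _).
have : (x + d) * (m - r) > 0 by rewrite mulr_gt0; lra.
lra.
Qed.

(** The extended flux of w_- increases up to [sm P] and decreases beyond, so on an interval it is
    smallest at an end. *)
Lemma Gflux_ge_left l m r : l < sm P -> D (wm P) m ->
  G (wm P) l <= G (wm P) m -> l <= r <= m -> G (wm P) l <= G (wm P) r.
Proof.
move=> ls Dm lm /andP[lr rm]; have V0 := vmax_gt0 hP.
have [rs|sr] := leP r (sm P).
  by rewrite (Gflux_wm_free hP (ltW ls)) (Gflux_wm_free hP rs) ler_pM2r.
by apply: le_trans lm _; apply: (Gflux_ge_right ls Dm); rewrite rm ltW.
Qed.

Lemma Ol_stay_free l m x : l < sm P -> D (wm P) m ->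
  G (wm P) l <= G (wm P) m -> x < 0 -> Ol_strict (G (wm P)) x l m l.
Proof.
move=> ls Dm lm x0.
have /andP[sm_m _] := D_bounds hP Dm; have lm' : l < m := lt_le_trans ls sm_m.
apply: Ol_strict_up; rewrite ?(ltW lm') ?lexx// => r rr rl.
have lr : l < r by rewrite lt_neqAle eq_sym rl; case/andP: rr.
have := Gflux_ge_left ls Dm lm rr.
have : x * (r - l) < 0 by rewrite nmulr_rlt0//; lra.
lra.
Qed.

(** A transition of nonnegative speed meets the condition of (R.4) automatically, as
    [lambda1 < 0]. *)
Lemma Ol_jump_free l m x : l < sm P -> D (wm P) m ->
  G (wm P) l <= G (wm P) m ->
  Ol (G (wm P)) x l m
    (if x < (G (wm P) m - G (wm P) l) / (m - l) then l else m).
Proof.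
move=> ls Dm Glm.
have /andP[sm_m _] := D_bounds hP Dm; have lm : l < m := lt_le_trans ls sm_m.
have [] := @Ol_jump _ (G (wm P)) x l m (ltac:(by rewrite lt_eqF)) => //.
rewrite (ltW lm) => r rr; apply: (chord_phase hP ls Dm) => //.
  by field; rewrite gt_eqF// subr_gt0.
apply: le_trans (ltW (clambda_lt0 hP Dm)) _.
by rewrite divr_ge0// subr_ge0// ltW.
Qed.

End NearZero.

(** * The constrained solver *)

Section CongestedTrace.
Context {R : realType}.
Variable P : phase_data R.
Hypothesis hP : standing_hypotheses P.
Implicit Types (r q w y v x l m phi : R) (u : R * R).
Local Notation V := (vmax P).
Local Notation M := (rhomax P).
Local Notation D w r := (Omega_c P (r, w * r)).
Local Notation G := (Gflux P).
Local Notation rm v := (rho P (wm P) v).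

(* \check u when F >= v * rm v; the maximum makes it depend continuously on
   (phi, v) also across the free case. It is a junk value when v = 0. *)
Definition congested_trace phi v :=
  get [set u | [/\ Omega_c P u, flow P u = Num.max phi (v * rm v) &
                   speed P u = v]].

(** The free state of flow [phi], followed by the transition to the state of speed [v] on w_-. The
    test is x < Lambda multiplied by the density difference, so that nothing is divided by zero; if
    [phi] is at least [v * rm v], it fails for 0 <= x <= v. *)
Definition right_profile phi v x :=
  if x * (rm v - phi / V) < v * rm v - phi then (phi / V, Qfree P (phi / V))
  else congested_trace phi v.

Lemma congested_uniq u u' v : 0 < v -> Omega_c P u -> Omega_c P u' ->
  speed P u = v -> speed P u' = v -> flow P u = flow P u' -> u = u'.
Proof.
move=> v0 Ou Ou'; have [w [r [Dr -> _]]] := Omega_cP hP Ou.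
have [w' [r' [Dr' -> _]]] := Omega_cP hP Ou'.
rewrite /flow/= => e e'; rewrite e e' => /(mulIf (lt0r_neq0 v0)) er.
rewrite -{}er in Dr' e' *; congr (_, _ * _).
by apply: (cspeed_w_inj hP (D_bounds hP Dr)); rewrite /cspeed e// e'.
Qed.

Lemma congested_traceE u phi v : 0 < v -> Omega_c P u -> speed P u = v ->
  flow P u = Num.max phi (v * rm v) -> congested_trace phi v = u.
Proof.
move=> v0 Ou su fu; rewrite /congested_trace; set A := [set _ | _].
have : A (get A) by apply: getPex; exists u.
by case=> Og fg sg; apply: (@congested_uniq _ _ v) => //; rewrite fg.
Qed.

(** The flow bound places the wanted density between those of speed [v] on w_- and on [w]. At this
    density the curve w_- is at most as fast as [v] and [w] at least as fast, so some curve between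
    them has speed [v]. *)
Lemma congested_traceP phi v w : 0 < v -> v <= V -> wrange P w ->
  phi <= v * rho P w v -> exists w' r, [/\ D w' r,
    congested_trace phi v = (r, w' * r), cspeed P w' r = v &
    r = Num.max (phi / v) (rm v)].
Proof.
move=> v0 vV Ww pw; pose r := Num.max (phi / v) (rm v).
have vv : 0 <= v <= V by rewrite vV ltW.
have Wm := wm_range hP.
have Dm := rho_D hP Wm vv; have Dw := rho_D hP Ww vv.
have mr : rm v <= r by rewrite le_max lexx orbT.
have rw : r <= rho P w v.
  rewrite ge_max ler_pdivrMr// mulrC pw/=; apply: (rho_le hP) => //.
  by case/andP: Ww.
have /andP[sm_r _] := D_bounds hP Dm; have /andP[_ rM] := D_bounds hP Dw.
have sr : sm P <= r <= M by rewrite (le_trans sm_r mr) (le_trans rw rM).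
have /andP[sr1 sr2] := sr; have r0 : 0 < r := lt_le_trans (sm_gt0 hP) sr1.
have c1 : cspeed P (wm P) r <= v.
  move: mr; rewrite le_eqVlt => /predU1P[<-|mr]; first by rewrite cspeed_rho.
  have := cspeed_decr hP Wm sm_r mr sr2.
  by rewrite cspeed_rho// => h; exact/ltW/h.
have c2 : v <= cspeed P w r.
  rewrite leNgt; apply/negP => h.
  move: rw; rewrite le_eqVlt => /predU1P[e|rw].
    by move: h; rewrite e cspeed_rho// ltxx.
  have := cspeed_decr hP Ww sr1 rw rM (le_trans (ltW h) vV).
  by rewrite cspeed_rho// => /(lt_trans h); rewrite ltxx.
have ww : wm P <= w by case/andP: Ww.
have [| |w'] := @IVT R (fun w => cspeed P w r) (wm P) w v ww.
- apply: continuous_in_subspaceT => z _.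
  by apply: (cspeed_cvg hP) => //; exact: cvg_cst.
- by rewrite ge_min c1 le_max c2 orbT.
rewrite in_itv/= => /andP[mw' w'w] cv; exists w', r.
have Dr : D w' r.
  apply/(Omega_cE hP); rewrite cv vv; split=> //.
  by rewrite /wrange mw' (le_trans w'w)//; case/andP: Ww.
split=> //; apply: congested_traceE => //.
rewrite /flow speed_D//= -/(cspeed P w' r) cv /r maxr_pMl ?ltW// divfK ?gt_eqF//.
by rewrite mulrC.
Qed.

(* V * demand u is the largest flow that u can emit through x = 0. *)
Definition demand u := if u.1 < sm P then u.1 else rho P (wbar P u) V.
Definition riemann_flow ul ur :=
  Num.min (V * demand ul) (speed P ur * rho P (wbar P ul) (speed P ur)).

Lemma right_profile_congested phi v x : 0 <= x -> x <= v -> v <= V ->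
  v * rm v <= phi -> right_profile phi v x = congested_trace phi v.
Proof.
move=> x0 xv vV vphi; rewrite /right_profile ifF//; apply/negbTE; rewrite -leNgt.
have V0 := vmax_gt0 hP.
have v0 : 0 <= v by lra.
have e : phi = phi / V * V by rewrite divfK ?gt_eqF.
set t := phi / V in e *; rewrite e in vphi *.
have [ | ] := leP t (rm v) => h.
  have : 0 <= x * (rm v - t) by rewrite mulr_ge0// subr_ge0.
  lra.
have m0 : 0 < rm v.
  by apply: (D_gt0 hP (rho_D hP (wm_range hP) _)); rewrite v0.
have : 0 <= (V - v) * t by rewrite mulr_ge0 ?subr_ge0// ltW// (lt_trans m0).
have : 0 <= (v - x) * (t - rm v) by rewrite mulr_ge0// subr_ge0// ltW.
lra.
Qed.

Lemma flux_le_max w v : wrange P w -> 0 <= v <= V ->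
  v * rho P w v <= V * rho P w V.
Proof.
move=> Ww vv; have Dv := rho_D hP Ww vv; have DV := rho_D hP Ww (vmax_itv hP).
have := rho_vmax_le hP Dv; rewrite le_eqVlt => /predU1P[e|].
  by rewrite e ler_wpM2r ?(ltW (D_gt0 hP Dv))//; case/andP: vv.
move=> /(flow_decr hP DV Dv); rewrite !cspeed_rho ?vmax_itv// => /ltW.
by rewrite mulrC (mulrC _ V).
Qed.

End CongestedTrace.

Section Traces.
Context {R : realType}.
Variable P : phase_data R.
Hypothesis hP : standing_hypotheses P.
Implicit Types (r q w y v x l m phi : R) (u : R * R).
Local Notation V := (vmax P).
Local Notation M := (rhomax P).
Local Notation D w r := (Omega_c P (r, w * r)).
Local Notation G := (Gflux P).
Local Notation rm v := (rho P (wm P) v).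

Lemma flow_D w r : flow P (r, w * r) = r * cspeed P w r.
Proof. by []. Qed.

Lemma demand_c w l : D w l -> demand P (l, w * l) = rho P w V.
Proof.
move=> Dl; rewrite /demand/= ltNge; have /andP[-> _] /= := D_bounds hP Dl.
by rewrite (wbar_D hP Dl).
Qed.

Lemma riemann_flow_c w l ur : D w l -> Omega P ur ->
  riemann_flow P (l, w * l) ur = speed P ur * rho P w (speed P ur).
Proof.
move=> Dl Or; rewrite /riemann_flow (demand_c Dl) (wbar_D hP Dl) min_r//.
exact: (flux_le_max hP (D_range hP Dl) (Omega_speed hP Or)).
Qed.

Lemma demand_free l : l < sm P -> demand P (l, Qfree P l) = l.
Proof. by move=> ls; rewrite /demand/= ls. Qed.

Lemma free_state u : Omega P u -> u.1 < sm P ->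
  [/\ u = (u.1, Qfree P u.1), 0 <= u.1 < sm P & wbar P u = wm P].
Proof.
move=> Ou us; have Of := Omega_lt_sm Ou us; split; last exact: wbar_f.
  by case: u Of {Ou us} => r q [_ /= ->].
by rewrite us andbT; case: Of => /andP[].
Qed.

Lemma Omega_case u : Omega P u ->
  (exists w r, [/\ D w r, u = (r, w * r) & wbar P u = w]) \/
  [/\ u = (u.1, Qfree P u.1), 0 <= u.1 < sm P & wbar P u = wm P].
Proof.
move=> Ou; have [us|su] := ltP u.1 (sm P);
  first by right; have := free_state Ou us; rewrite us.
by left; apply: (Omega_cP hP); exact: Omega_sm_le.
Qed.

Lemma G_rho w v : wrange P w -> 0 <= v <= V -> G w (rho P w v) = v * rho P w v.
Proof.
by move=> Ww vv; rewrite (Gflux_D hP (rho_D hP Ww vv)) (cspeed_rho hP)// mulrC.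
Qed.

Lemma riemann_left0 ul ur : Omega P ul -> Omega P ur ->
  exists d a, [/\ 0 < d, forall x, - d < x -> x < 0 -> riemann P ul ur x = a &
                  flow P a = riemann_flow P ul ur].
Proof.
move=> Oul Our; have [[e prof] _] := riemann_form hP Oul Our.
have vv := Omega_speed hP Our; have /andP[v0 vV] := vv.
set v := speed P ur in prof vv v0 vV *.
have V0 := vmax_gt0 hP.
have val y x : x < 0 -> Ol (G (wbar P ul)) x ul.1 (rho P (wbar P ul) v) y ->
    riemann P ul ur x = state_on P (wbar P ul) y.
  move=> x0 Oy; have [z [-> Oz _]] := prof x (lt_le_trans x0 v0).
  by rewrite (Ol_uniq Oy Oz).
have Ww := wbar_range hP Oul; have Dm := rho_D hP Ww vv.
case: (Omega_case Oul) => [[w [l [Dl el ew]]]|[el lr ew]].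
  rewrite ew in val Ww Dm *; rewrite el/= in val *.
  have [d d0 h] := Ol_end_congested hP Dl Dm.
  exists d, (state_on P w (rho P w v)); split=> //.
    by move=> x dx x0; apply: val => //; exact: h.
  by rewrite (state_on_D hP Dm) flow_D (cspeed_rho hP)// (riemann_flow_c Dl)// mulrC.
rewrite ew in val Ww Dm *; set l := ul.1 in val el lr *.
have /andP[l0 ls] := lr.
have [lm|ml] := leP (G (wm P) l) (G (wm P) (rm v)).
  exists 1, (state_on P (wm P) l); split=> //.
    by move=> x _ x0; apply: val => //; exact/Ol_strictW/(Ol_stay_free hP).
  rewrite (flow_state_on hP)//; last by right; rewrite l0 ltW.
  rewrite /riemann_flow ew -/v -G_rho// el demand_free//.
  by rewrite mulrC -(Gflux_wm_free hP (ltW ls)) min_l.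
have [d d0 h] := Ol_end_free hP ls Dm ml.
exists d, (state_on P (wm P) (rm v)); split=> //.
  move=> x dx x0; apply: val => //; apply: h => //; exact: lt_trans V0.
rewrite (flow_state_on hP)//; last by left.
rewrite /riemann_flow ew -/v -G_rho// el demand_free//.
by rewrite mulrC -(Gflux_wm_free hP (ltW ls)) min_r// ltW.
Qed.

(** From x = 0 on, either the waves before the contact are over and the state is fixed by its speed
    and flow, or ul is free with the smaller flow, so its own density is flow / V and a transition
    may follow. *)
Lemma riemann_right ul ur x : Omega P ul -> Omega P ur ->
  0 <= x -> x < speed P ur ->
  riemann P ul ur x = right_profile P (riemann_flow P ul ur) (speed P ur) x.
Proof.
move=> Oul Our x0 xv; have [[e prof] _] := riemann_form hP Oul Our.
have vv := Omega_speed hP Our; have /andP[v0' vV] := vv.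
have V0 := vmax_gt0 hP.
have [z [-> Oz _]] := prof x xv.
set v := speed P ur in prof vv xv v0' vV Oz *.
have v0 : 0 < v by lra.
have Ww := wbar_range hP Oul; have Dm := rho_D hP Ww vv.
have Drm := rho_D hP (wm_range hP) vv.
have cong w : wrange P w -> congested_trace P (v * rho P w v) v
    = state_on P w (rho P w v).
  move=> W; have Dw := rho_D hP W vv; rewrite (state_on_D hP Dw).
  apply: (congested_traceE hP v0 Dw); first exact: (cspeed_rho hP).
  rewrite flow_D (cspeed_rho hP)// mulrC max_l// ler_wpM2l//.
  by apply: (rho_le hP) => //; [exact: wm_range|case/andP: W].
have rp w : wrange P w -> right_profile P (v * rho P w v) v x
    = state_on P w (rho P w v).
  move=> W; rewrite (right_profile_congested hP) ?(ltW xv) ?cong//.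
  rewrite ler_wpM2l//.
  by apply: (rho_le hP) => //; [exact: wm_range|case/andP: W].
case: (Omega_case Oul) => [[w [l [Dl el ew]]]|[el lr ew]].
  rewrite ew in Oz Ww Dm *; rewrite el/= in Oz *.
  rewrite (riemann_flow_c Dl)// rp//; congr state_on.
  have [d d0 h] := Ol_end_congested hP Dl Dm.
  by apply: (Ol_uniq Oz); apply: h; lra.
rewrite ew in Oz Ww Dm *; set l := ul.1 in Oz el lr *.
have /andP[l0 ls] := lr.
have Gl := Gflux_wm_free hP (ltW ls).
rewrite /riemann_flow ew -/v el demand_free//.
have [lm|ml] := leP (V * l) (v * rm v); last first.
  rewrite rp//; congr state_on.
  have [|d d0 h] := Ol_end_free hP ls Dm; first by rewrite G_rho// Gl (mulrC l V).
  by apply: (Ol_uniq Oz); apply: h; lra.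
have := @Ol_jump_free _ _ hP l (rm v) x ls Dm.
rewrite G_rho// Gl (mulrC l V) => /(_ lm) /(Ol_uniq Oz) ->.
have lrm : 0 < rm v - l.
  by have /andP[h _] := D_bounds hP Dm; rewrite subr_gt0; exact: lt_le_trans h.
rewrite /right_profile (_ : V * l / V = l); last by field; rewrite gt_eqF.
rewrite ltr_pdivlMr//; case: ifP => _.
  by rewrite (state_on_free hP)// l0 ltW.
rewrite (state_on_D hP Dm); apply/esym/(congested_traceE hP v0 Dm).
  exact: (cspeed_rho hP).
by rewrite flow_D (cspeed_rho hP)// mulrC max_r.
Qed.

Lemma demand_bounds u : Omega P u -> 0 <= demand P u <= sp P.
Proof.
move=> Ou; case: (Omega_case Ou) => [[w [l [Dl -> ew]]]|[-> /andP[l0 ls] ew]].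
  have Ww := D_range hP Dl; have DV := rho_D hP Ww (vmax_itv hP).
  rewrite (demand_c Dl) (ltW (D_gt0 hP DV)) -(rho_wp_vmax hP).
  apply: (rho_le hP) => //; [exact: wp_range|exact: vmax_itv|].
  by case/andP: Ww.
by rewrite demand_free// l0 ltW// (lt_trans ls)// sm_lt_sp.
Qed.

Lemma riemann_flow_bounds ul ur : Omega P ul -> Omega P ur ->
  [/\ 0 <= riemann_flow P ul ur, riemann_flow P ul ur <= V * sp P &
   riemann_flow P ul ur <= speed P ur * rho P (wbar P ul) (speed P ur)].
Proof.
move=> Oul Our; have /andP[d0 ds] := demand_bounds Oul.
have vv := Omega_speed hP Our; have /andP[v0' vV] := vv.
have V0 := vmax_gt0 hP.
have Dm := rho_D hP (wbar_range hP Oul) vv.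
rewrite /riemann_flow le_min !ge_min lexx orbT; split=> //.
- by rewrite mulr_ge0 ?(ltW V0)//= mulr_ge0// ltW// (D_gt0 hP Dm).
- by rewrite ler_pM2l// ds.
Qed.

Lemma flow_free phi : 0 <= phi <= V * sp P ->
  [/\ Omega_f P (phi / V, Qfree P (phi / V)),
      speed P (phi / V, Qfree P (phi / V)) = V &
      flow P (phi / V, Qfree P (phi / V)) = phi].
Proof.
have V0 := vmax_gt0 hP; move=> /andP[p0 ps].
have pr : 0 <= phi / V <= sp P.
  by rewrite divr_ge0 ?(ltW V0)//= ler_pdivrMr// mulrC.
split=> //; first exact: (speed_free hP).
by rewrite /flow (speed_free hP)//= divfK// gt_eqF.
Qed.

Lemma right_profile_flow0 phi v w : 0 < v -> v <= V -> wrange P w ->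
  0 <= phi -> phi <= V * sp P -> phi <= v * rho P w v ->
  exists d a, [/\ 0 < d, forall x, 0 < x -> x < d -> right_profile P phi v x = a
                & flow P a = phi].
Proof.
move=> v0 vV Ww p0 ps pw; have V0 := vmax_gt0 hP.
have [pm|mp] := ltP phi (v * rm v); last first.
  exists v, (congested_trace P phi v); split=> //.
    by move=> x x0 xv; rewrite (right_profile_congested hP)// ltW.
  have [w' [r [Dr -> cv er]]] := congested_traceP hP v0 vV Ww pw.
  rewrite flow_D cv er max_l ?divfK ?gt_eqF//.
  by rewrite ler_pdivlMr// mulrC.
have vv : 0 <= v <= V by rewrite vV ltW.
have m0 := D_gt0 hP (rho_D hP (wm_range hP) vv).
have N0 : 0 < `|rm v - phi / V| + 1 by rewrite ltr_wpDl.
(* Within this distance the test in [right_profile] holds; the added 1 keeps the divisor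
   positive. *)
exists ((v * rm v - phi) / (`|rm v - phi / V| + 1)), (phi / V, Qfree P (phi / V)).
split.
- by rewrite divr_gt0 ?subr_gt0.
- move=> x x0; rewrite ltr_pdivlMr// => h; rewrite /right_profile ifT//.
  apply: le_lt_trans h; rewrite ler_pM2l//.
  by apply: le_trans (ler_norm _) _; rewrite lerDl.
- by have [] := @flow_free phi; rewrite ?p0.
Qed.

Lemma trace_const (g : R -> R * R) (F : set_system R) {FF : ProperFilter F} a :
  (\forall x \near F, g x = a) -> trace g F = a.
Proof.
move=> h; have ga : g x @[x --> F] --> a by exact: cvg_near_cst.
have : g x @[x --> F] --> trace g F.
  by apply: (@getPex _ [set u : R * R | g x @[x --> F] --> u]); exists a.
by move=> gt; apply: (cvg_unique _ gt ga).
Qed.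

Lemma near_at_left0 (Q : R -> Prop) (d : R) : 0 < d ->
  (forall x, - d < x -> x < 0 -> Q x) -> \forall x \near 0^'-, Q x.
Proof.
move=> d0 h; near=> x; apply: h; near: x; last exact: nbhs_left_lt.
by apply: nbhs_left_gt; rewrite oppr_lt0.
Unshelve. all: by end_near. Qed.

Lemma near_at_right0 (Q : R -> Prop) (d : R) : 0 < d ->
  (forall x, 0 < x -> x < d -> Q x) -> \forall x \near 0^'+, Q x.
Proof.
move=> d0 h; near=> x; apply: h; near: x; first exact: nbhs_right_gt.
exact: nbhs_right_lt.
Unshelve. all: by end_near. Qed.

Lemma trace_left ul ur : Omega P ul -> Omega P ur ->
  flow P (trace (riemann P ul ur) 0^'-) = riemann_flow P ul ur.
Proof.
move=> Oul Our; have [d [a [d0 h <-]]] := riemann_left0 Oul Our.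
by congr flow; apply: trace_const; exact: near_at_left0 d0 _.
Qed.

Lemma trace_right ul ur : Omega P ul -> Omega P ur ->
  flow P (trace (riemann P ul ur) 0^'+) = riemann_flow P ul ur.
Proof.
move=> Oul Our; have vv := Omega_speed hP Our; have /andP[v0' vV] := vv.
have [p0 ps pw] := riemann_flow_bounds Oul Our.
(* If ur is at rest, the range 0 <= x < v is empty; the right trace is ur itself and both flows
   vanish. *)
move: v0'; rewrite le_eqVlt => /predU1P[e|v0].
  have -> : riemann_flow P ul ur = 0.
    by apply/le_anti; rewrite p0 andbT (le_trans pw)// -e mul0r.
  have [_ h] := riemann_form hP Oul Our.
  rewrite (@trace_const _ _ _ ur); first by rewrite /flow -e mulr0.
  apply: (near_at_right0 ltr01) => x x0 _; apply: h.
  by rewrite -e ltW.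
have [d [a [d0 h ea]]] := right_profile_flow0 v0 vV (wbar_range hP Oul) p0 ps pw.
rewrite (@trace_const _ _ _ a)//.
apply: (@near_at_right0 _ (Num.min d (speed P ur))).
  by rewrite lt_min d0.
move=> x x0; rewrite lt_min => /andP[xd xv].
by rewrite riemann_right ?ltW//; exact: h.
Qed.

(** The two traces at x = 0 carry the same flow, so [D1] is one scalar inequality. *)
Lemma D1E F ul ur : Omega P ul -> Omega P ur ->
  D1 P F ul ur <-> riemann_flow P ul ur <= F.
Proof.
move=> Oul Our; rewrite /D1 trace_left// trace_right//.
by split=> [[]|h].
Qed.

End Traces.

(** * The constrained solver on either side of x = 0 *)

Section ConstrainedForm.
Context {R : realType}.
Variables (P : phase_data R) (F : R).
Hypothesis hP : standing_hypotheses P.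
Hypothesis hF : 0 < F < vmax P * sp P.
Implicit Types (r q w y v x l m phi : R) (u : R * R).
Local Notation V := (vmax P).
Local Notation M := (rhomax P).
Local Notation D w r := (Omega_c P (r, w * r)).
Local Notation G := (Gflux P).
Local Notation rm v := (rho P (wm P) v).

(* The density of \hat u if the state of speed v on the curve w has a flow larger
   than F, and that of the latter state otherwise. *)
Definition rho_cut w v :=
  get [set r | D w r /\ r * cspeed P w r = Num.min (v * rho P w v) F].

Definition cut_flow ul ur := Num.min (riemann_flow P ul ur) F.

Lemma flow_inj w r1 r2 : D w r1 -> D w r2 ->
  r1 * cspeed P w r1 = r2 * cspeed P w r2 -> r1 = r2.
Proof.
move=> D1 D2 e; have [h|h|//] := ltgtP r1 r2.
  by have := flow_decr hP D1 D2 h; rewrite e ltxx.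
by have := flow_decr hP D2 D1 h; rewrite e ltxx.
Qed.

Lemma rho_cutP w v : wrange P w -> 0 <= v <= V ->
  D w (rho_cut w v) /\
  rho_cut w v * cspeed P w (rho_cut w v) = Num.min (v * rho P w v) F.
Proof.
move=> Ww vv; have Dm := rho_D hP Ww vv; have m0 := D_gt0 hP Dm.
have F0 : 0 <= F by case/andP: hF => /ltW.
have /andP[v0 _] := vv.
have [r0 rr c0] := cspeed_zero hP Ww.
have D0 : D w r0 by apply/(Omega_cE hP); rewrite c0 lexx (ltW (vmax_gt0 hP)).
have mr0 : rho P w v <= r0.
  rewrite leNgt; apply/negP => h; have := flow_decr hP D0 Dm h.
  by rewrite c0 mulr0 (cspeed_rho hP)// ltNge mulr_ge0// ltW.
have [| |r] := @IVT R (fun r => r * cspeed P w r) (rho P w v) r0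
    (Num.min (v * rho P w v) F) mr0.
- apply: continuous_in_subspaceT => r; rewrite inE/= in_itv/= => /andP[mr _].
  apply: cvgM; first exact: cvg_id.
  by apply: (cspeed_continuous hP); exact: lt_le_trans mr.
- rewrite c0 mulr0 (cspeed_rho hP)// (mulrC _ v) ge_min le_max ge_min lexx/= andbT.
  by apply/orP; right; rewrite le_min F0 mulr_ge0// ltW.
rewrite in_itv/= => mr er.
have := @getPex _ [set r | D w r /\ r * cspeed P w r = Num.min (v * rho P w v) F].
apply; exists r; split=> //; exact: (Omega_c_interval hP Dm D0).
Qed.

Lemma rho_cutE w v r : wrange P w -> 0 <= v <= V -> D w r ->
  r * cspeed P w r = Num.min (v * rho P w v) F -> rho_cut w v = r.
Proof.
by move=> Ww vv Dr er; have [Dc ec] := rho_cutP Ww vv;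
  apply: (flow_inj Dc Dr); rewrite ec.
Qed.

Lemma constrained_left ul ur : Omega P ul -> Omega P ur ->
  is_profile P (wbar P ul) ul.1 (rho_cut (wbar P ul) (speed P ur))
    (constrained_riemann P F ul ur) (fun x => x < 0).
Proof.
move=> Oul Our; have vv := Omega_speed hP Our; have /andP[v0 vV] := vv.
have /andP[F0 FV] := hF.
have Ww := wbar_range hP Oul; have Dm := rho_D hP Ww vv.
have [e1 e2 e3] := riemann_flow_bounds hP Oul Our.
set w := wbar P ul in Ww Dm e3 *; set v := speed P ur in vv v0 vV Dm e3 *.
rewrite /constrained_riemann; case: asboolP => [/(D1E hP F Oul Our) PF|nD1].
  have [vmF|Fvm] := leP (v * rho P w v) F.
    have -> : rho_cut w v = rho P w v.
      by apply: rho_cutE; rewrite // (cspeed_rho hP)// mulrC min_l.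
    have [[e h] _] := riemann_form hP Oul Our.
    by exists e => x x0; apply: h; exact: lt_le_trans v0.
  (* Inside [D1] with a target of flow above F: a congested ul would let all that flow through, so
     ul is free with flow at most F and stays put for either target. *)
  case: (Omega_case hP Oul) => [[w' [l [Dl el ew]]]|[el lr ew]].
    move: PF; rewrite el (riemann_flow_c hP)// -/v -ew -/w.
    by rewrite leNgt Fvm.
  have /andP[l0 ls] := lr; rewrite /w ew in Ww Dm Fvm *.
  have [Dc ec] := rho_cutP Ww vv.
  have lF : G (wm P) ul.1 <= F.
    rewrite (Gflux_wm_free hP (ltW ls)); move: PF.
    rewrite /riemann_flow ew -/v ge_min => /orP[|]; last by rewrite leNgt Fvm.
    by rewrite el demand_free// mulrC.
  exists 0 => x x0; exists ul.1; split.
  - have [[e h] _] := riemann_form hP Oul Our.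
    have [y [-> Oy _]] := h x (lt_le_trans x0 v0).
    rewrite ew in Oy *; congr state_on; apply: (Ol_uniq Oy).
    apply/Ol_strictW/(Ol_stay_free hP) => //.
    by rewrite (G_rho hP Ww vv) (le_trans lF)// ltW.
  - apply/Ol_strictW/(Ol_stay_free hP) => //.
    by rewrite (Gflux_D hP Dc) ec le_min lF andbT (le_trans lF)// ltW.
  - move=> _; apply/(Ol_stay_free hP) => //.
    by rewrite (Gflux_D hP Dc) ec le_min lF andbT (le_trans lF)// ltW.
have FP : F < riemann_flow P ul ur.
  by rewrite ltNge; apply/negP => h; apply: nD1; apply/(D1E hP F Oul Our).
have Fvm : F < v * rho P w v := lt_le_trans FP e3.
have [Dc ec] := rho_cutP Ww vv; rewrite min_r in ec; last exact: ltW.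
have c0 : 0 < cspeed P w (rho_cut w v).
  by rewrite -(pmulr_rgt0 _ (D_gt0 hP Dc)) ec.
have -> : uhat P F ul = (rho_cut w v, w * rho_cut w v).
  rewrite /uhat; set A := [set _ | _].
  have : A (get A).
    apply: getPex; exists (rho_cut w v, w * rho_cut w v).
    by split=> //; rewrite (wcoord_D hP Dc).
  case=> Og; have [w' [r [Dr -> _]]] := Omega_cP hP Og.
  rewrite (wcoord_D hP Dr) flow_D => fr ew; rewrite -/(wbar P ul) -/w in ew.
  rewrite ew in Dr fr *; have -> // : r = rho_cut w v.
  by apply: (flow_inj Dr Dc); rewrite fr ec.
have Ouh : Omega P (rho_cut w v, w * rho_cut w v) by right.
have [[e h] _] := riemann_form hP Oul Ouh.
have es : rho P w (speed P (rho_cut w v, w * rho_cut w v)) = rho_cut w v.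
  exact: (rho_cspeed hP Dc).
rewrite es in h; exists e => x x0.
by rewrite /Defs.glue x0; apply: h; exact: lt_trans c0.
Qed.

Lemma flow_psi2m u : Omega P u ->
  flow P (psi2m P u) = speed P u * rm (speed P u).
Proof.
move=> Ou; have vv := Omega_speed hP Ou; have Ww := wm_range hP.
by rewrite /psi2m (get_state hP Ww vv) flow_D (cspeed_rho hP)// mulrC.
Qed.

(** This allows [riemann_right] to be applied to \check u and ur with flow F, whichever clause
    defines \check u. *)
Lemma ucheck_flow ul ur : Omega P ul -> Omega P ur ->
  F < riemann_flow P ul ur ->
  Omega P (ucheck P F ur) /\ riemann_flow P (ucheck P F ur) ur = F.
Proof.
move=> Oul Our FP; have vv := Omega_speed hP Our; have /andP[v0' vV] := vv.
have /andP[F0 FV] := hF; have V0 := vmax_gt0 hP.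
have Ww := wbar_range hP Oul; have Dm := rho_D hP Ww vv.
have [_ _ e3] := riemann_flow_bounds hP Oul Our.
have Fvm := lt_le_trans FP e3.
have v0 : 0 < speed P ur.
  by rewrite -(pmulr_lgt0 _ (D_gt0 hP Dm)) (lt_trans F0).
set v := speed P ur in vv v0 v0' vV Fvm e3 Dm *.
rewrite /ucheck (flow_psi2m Our) -/v; set A := [set _ | _].
have [Fm|mF] := ltP F (v * rm v).
  have [|Of sf ff] := @flow_free _ _ hP F; first by rewrite (ltW F0) (ltW FV).
  have : A (get A).
    by apply: getPex; exists (F / V, Qfree P (F / V)); rewrite /A/= Fm; split=> //; left.
  case=> Og fg; rewrite Fm => sg; split=> //.
  have eg : (get A).1 = F / V.
    by apply: (mulIf (lt0r_neq0 V0)); rewrite divfK ?gt_eqF// -fg /flow sg.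
  (* The free \check u lies strictly below [sm P], so its demand is its own density. *)
  have Fs : F / V < sm P.
    rewrite ltr_pdivrMr// mulrC -(rho_wm_vmax hP); apply: lt_le_trans Fm _.
    by apply: (flux_le_max hP) => //; exact: wm_range.
  have [e _ ew] := free_state hP Og (ltac:(by rewrite eg)).
  rewrite e eg /riemann_flow demand_free//.
  have -> : wbar P (F / V, Qfree P (F / V)) = wm P by rewrite -eg -e.
  by rewrite -/v mulrCA divff ?gt_eqF// mulr1 min_l// ltW.
have [w' [r [Dr _ cv er]]] := congested_traceP hP v0 vV Ww (ltW Fvm).
have er' : r = F / v by rewrite er max_l// ler_pdivlMr// mulrC.
have : A (get A).
  apply: getPex; exists (r, w' * r); rewrite /A/= ltNge mF; split=> //.
  - by right.
  - by rewrite flow_D cv er' divfK// gt_eqF.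
case=> Og fg; rewrite ltNge mF/= => sg; split=> //.
have eg : (get A).1 = F / v.
  by apply: (mulIf (lt0r_neq0 v0)); rewrite divfK ?gt_eqF// -fg /flow sg.
have cg : Omega_c P (get A).
  apply: (Omega_sm_le hP Og); rewrite eg ler_pdivlMr// mulrC.
  apply: le_trans mF; rewrite ler_wpM2l//.
  by have /andP[] := D_bounds hP (rho_D hP (wm_range hP) vv).
have [w2 [r2 [D2 e2 _]]] := Omega_cP hP cg.
rewrite e2 in fg sg *; rewrite (riemann_flow_c hP)// -/v.
have -> : rho P w2 v = r2 by rewrite -sg -[RHS](rho_cspeed hP D2).
by rewrite -fg flow_D -sg mulrC.
Qed.

Lemma constrained_right ul ur x : Omega P ul -> Omega P ur ->
  0 <= x -> x < speed P ur -> constrained_riemann P F ul ur x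
    = right_profile P (cut_flow ul ur) (speed P ur) x.
Proof.
move=> Oul Our x0 xv; rewrite /constrained_riemann /cut_flow.
case: asboolP => [/(D1E hP F Oul Our) PF|nD1].
  by rewrite (riemann_right hP)// min_l.
have FP : F < riemann_flow P ul ur.
  by rewrite ltNge; apply/negP => h; apply: nD1; apply/(D1E hP F Oul Our).
have [Ou fu] := ucheck_flow Oul Our FP.
by rewrite /Defs.glue ltNge x0/= (riemann_right hP)// fu min_r// ltW.
Qed.

Lemma constrained_end ul ur x : Omega P ul -> Omega P ur ->
  speed P ur <= x -> constrained_riemann P F ul ur x = ur.
Proof.
move=> Oul Our vx; have /andP[v0 _] := Omega_speed hP Our.
rewrite /constrained_riemann; case: asboolP => [_|nD1].
  by have [_ ->] := riemann_form hP Oul Our.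
have FP : F < riemann_flow P ul ur.
  by rewrite ltNge; apply/negP => h; apply: nD1; apply/(D1E hP F Oul Our).
have [Ou _] := ucheck_flow Oul Our FP.
rewrite /Defs.glue ltNge (le_trans v0 vx)/=.
by have [_ ->] := riemann_form hP Ou Our.
Qed.

End ConstrainedForm.

(** * Consistency *)

Section Consistency.
Context {R : realType}.
Variables (P : phase_data R) (F : R).
Hypothesis hP : standing_hypotheses P.
Hypothesis hF : 0 < F < vmax P * sp P.
Implicit Types (r q w y v x l m phi : R) (u : R * R).
Local Notation V := (vmax P).
Local Notation M := (rhomax P).
Local Notation D w r := (Omega_c P (r, w * r)).
Local Notation G := (Gflux P).
Local Notation rm v := (rho P (wm P) v).
Local Notation T := (constrained_riemann P F).
Local Notation cond phi v x := (x * (rm v - phi / V) < v * rm v - phi).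

Lemma rm_gt0 v : 0 <= v <= V -> 0 < rm v.
Proof. by move=> vv; exact: (D_gt0 hP (rho_D hP (wm_range hP) vv)). Qed.

(** When the test holds, both terms of the quotient defining the transition speed are positive;
    hence the test also holds for smaller nonnegative x. *)
Lemma cond_lt phi v x : 0 <= x -> x <= v -> v <= V -> cond phi v x ->
  phi < v * rm v /\ phi / V < rm v.
Proof.
move=> x0 xv vV; have V0 := vmax_gt0 hP.
have m0 : 0 < rm v by apply: rm_gt0; rewrite vV andbT (le_trans x0).
have e : phi = phi / V * V by rewrite divfK ?gt_eqF.
set t := phi / V in e *; rewrite e => h.
have tm : t < rm v.
  rewrite ltNge; apply/negP => mt.
  have : 0 <= (V - v) * t by rewrite mulr_ge0 ?subr_ge0// (le_trans (ltW m0)).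
  have : 0 <= (v - x) * (t - rm v) by rewrite mulr_ge0// subr_ge0.
  lra.
split=> //; have : 0 <= x * (rm v - t) by rewrite mulr_ge0// subr_ge0 ltW.
lra.
Qed.

Lemma condN_mono phi v x y : 0 <= x -> x <= y -> y <= v -> v <= V ->
  cond phi v y -> cond phi v x.
Proof.
move=> x0 xy yv vV h.
have [_ h'] := cond_lt (le_trans x0 xy) yv vV h.
by apply: le_lt_trans h; rewrite ler_wpM2r// subr_ge0 ltW.
Qed.

Lemma right_profile_vmax phi x : 0 <= phi <= V * sp P -> 0 <= x -> x < V ->
  right_profile P phi V x = (phi / V, Qfree P (phi / V)).
Proof.
move=> pp x0 xV; have V0 := vmax_gt0 hP; rewrite /right_profile (rho_wm_vmax hP).
case: ifP => // /negbT; rewrite -leNgt => h.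
have [Of sf ff] := flow_free hP pp.
have e : phi = phi / V * V by rewrite divfK ?gt_eqF.
have sp : sm P <= phi / V.
  set t := phi / V in e h *; rewrite e in h; rewrite leNgt; apply/negP => ts.
  have : 0 < (V - x) * (sm P - t) by rewrite mulr_gt0 ?subr_gt0.
  lra.
apply: (congested_traceE hP V0 (Omega_f_c hP Of sp) sf).
rewrite ff (rho_wm_vmax hP) max_l// mulrC -ler_pdivlMr//.
Qed.

Lemma cut_flow_bounds ul ur : Omega P ul -> Omega P ur ->
  [/\ 0 <= cut_flow P F ul ur <= V * sp P &
    cut_flow P F ul ur <= speed P ur * rho P (wbar P ul) (speed P ur)].
Proof.
move=> Oul Our; have [h1 h2 h3] := riemann_flow_bounds hP Oul Our.
have /andP[F0 FV] := hF.
rewrite /cut_flow; split; last by rewrite ge_min h3.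
by rewrite le_min h1 (ltW F0) ge_min h2.
Qed.

Lemma profile_range u m y x : Omega P u -> D (wbar P u) m ->
  Ol (G (wbar P u)) x u.1 m y ->
  D (wbar P u) y \/ [/\ wbar P u = wm P, u.1 < sm P, 0 <= y & y < sm P].
Proof.
move=> Ou Dm /Ol_between yb.
case: (Omega_case hP Ou) => [[w [l [Dl el ew]]]|[el /andP[l0 ls] ew]].
  by left; rewrite ew el/= in Dm yb *; exact: D_between Dl Dm yb.
have /andP[sm_m _] := D_bounds hP Dm.
have lm : u.1 <= m by rewrite (le_trans (ltW ls)).
rewrite (min_l lm) (max_r lm) in yb; have /andP[ly ym] := yb.
have [ys|sy] := ltP y (sm P); first by right; rewrite (le_trans l0).
left; rewrite ew in Dm *; apply: (Omega_c_interval hP (Omega_c_sm hP) Dm).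
by rewrite sy.
Qed.

(** For x < V the function to be minimised increases strictly along the free branch, so no free
    value other than the datum can occur. *)
Lemma profile_free u m y x : Omega P u -> D (wbar P u) m -> x < V ->
  Ol (G (wbar P u)) x u.1 m y -> y < sm P -> y = u.1.
Proof.
move=> Ou Dm xV Oy ys.
have ls : u.1 < sm P.
  case: (profile_range Ou Dm Oy) => [/(D_bounds hP)/andP[h _]|[]//].
  by move: ys; rewrite ltNge h.
have ew : wbar P u = wm P := wbar_f hP (Omega_lt_sm Ou ls) ls.
have /andP[sm_m _] := D_bounds hP Dm.
have lm : u.1 <= m by rewrite (le_trans (ltW ls)).
move: Oy; rewrite /Ol lm ew => -[/andP[ly _] h _].
have := h u.1; rewrite lexx ly => /(_ isT).
rewrite (Gflux_wm_free hP (ltW ls)) (Gflux_wm_free hP (ltW ys)) => h'.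
apply/le_anti; rewrite ly andbT leNgt; apply/negP => yl.
have : 0 < (V - x) * (y - u.1) by rewrite mulr_gt0 ?subr_gt0.
lra.
Qed.

Lemma wbar_state_on w r : D w r \/ [/\ w = wm P, 0 <= r & r < sm P] ->
  wbar P (state_on P w r) = w.
Proof.
case=> [Dr|[-> r0 rs]]; first by rewrite (state_on_D hP Dr) (wbar_D hP Dr).
rewrite (state_on_free hP) ?r0 ?ltW// (wbar_f hP)//=; split=> //=.
by rewrite r0 (le_trans (ltW rs))// ltW// sm_lt_sp.
Qed.

Lemma demand_le_vmax u : Omega P u -> demand P u <= rho P (wbar P u) V.
Proof.
move=> Ou; case: (Omega_case hP Ou) => [[w [l [Dl -> ew]]]|[el /andP[l0 ls] ew]].
  by rewrite (demand_c hP Dl) (wbar_D hP Dl).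
by rewrite ew (rho_wm_vmax hP) el demand_free// ltW.
Qed.

Lemma rho_cut_eq w v v' : wrange P w -> 0 <= v <= V -> 0 <= v' <= V ->
  Num.min (v * rho P w v) F = Num.min (v' * rho P w v') F ->
  rho_cut P F w v = rho_cut P F w v'.
Proof.
move=> Ww vv vv' e; have [Dc ec] := rho_cutP hP hF Ww vv'.
by apply: (rho_cutE hP hF Ww vv Dc); rewrite ec.
Qed.

Lemma consistentII_neg ul um ur xb x : Omega P ul -> Omega P um -> Omega P ur ->
  xb < 0 -> T ul um xb = um -> T um ur xb = um ->
  T ul ur x = Defs.glue xb (T ul um) (T um ur) x.
Proof.
move=> Oul Oum Our xb0 T1 T2.
have vv := Omega_speed hP Our; have vvm := Omega_speed hP Oum.
have Ww := wbar_range hP Oul; have V0 := vmax_gt0 hP.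
have [e1 L1] := constrained_left hP hF Oul Oum.
have [e2 L2] := constrained_left hP hF Oum Our.
have [e3 L3] := constrained_left hP hF Oul Our.
have [D1 g1] := rho_cutP hP hF Ww vvm.
have [D3 g3] := rho_cutP hP hF Ww vv.
set w := wbar P ul in Ww D1 g1 D3 g3 L1 L3 *.
have [yb [eyb Oyb _]] := L1 _ xb0.
have yr := profile_range Oul D1 Oyb.
have ey : um.1 = yb by rewrite -T1 eyb.
have ew : wbar P um = w.
  rewrite -T1 eyb; apply: wbar_state_on.
  by case: yr => [?|[? _ ? ?]]; [left|right].
rewrite ew in L2.
have [yc [eyc Oyc _]] := L2 _ xb0.
have eyc' : yc = yb by rewrite -ey -T2 eyc.
rewrite ey eyc' in Oyc.
have [gl1 gl2] := Ol_glue Oyb Oyc.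
have [x0|x0] := ltP x 0.
  have [z [-> Oz _]] := L3 _ x0; rewrite /Defs.glue; case: ltP => xx.
    have [z1 [-> Oz1 _]] := L1 _ x0; congr state_on.
    by apply: (Ol_uniq Oz); exact: gl1.
  have [z1 [-> Oz1 _]] := L2 _ x0; congr state_on.
  by rewrite ey in Oz1; apply: (Ol_uniq Oz); exact: gl2.
rewrite /Defs.glue ltNge (le_trans (ltW xb0) x0)/=.
have [vx|xv] := leP (speed P ur) x; first by rewrite !(constrained_end hP hF).
rewrite !(constrained_right hP hF)//; congr right_profile.
case: yr => [Dy|[ew' ls y0 ys]]; last first.
  suff -> : um = ul by [].
  have eyl := profile_free Oul D1 (lt_trans xb0 V0) Oyb ys.
  by rewrite [RHS](Omega_state hP Oul) -T1 eyb eyl.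
have eum : um = (yb, w * yb) by rewrite -T1 eyb (state_on_D hP Dy).
case: (Omega_case hP Oul) => [[w' [l [Dl el ew']]]|[el /andP[l0 ls] ew']].
  rewrite /cut_flow eum el !(riemann_flow_c hP)//.
  by rewrite -(wbar_D hP Dl) -el.
(* Here ul is free and [um] is congested: what remains is that the demand of ul does not bind, that
   is, the cut target has no more flow than ul. It follows from the optimality of [yb] at the
   negative speed [xb] in both problems. *)
rewrite /cut_flow eum (riemann_flow_c hP)// /riemann_flow -/w -minA -g3.
rewrite min_r// /demand ls (mulrC V) -(Gflux_wm_free hP (ltW ls)) -(Gflux_D hP D3).
rewrite -[wm P]ew' -/w.
have /andP[sy _] := D_bounds hP Dy; have /andP[s3 _] := D_bounds hP D3.
have /andP[s1 _] := D_bounds hP D1.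
have lm1 : ul.1 <= rho_cut P F w (speed P um) by rewrite (le_trans (ltW ls)).
move: Oyb; rewrite /Ol lm1 => -[/andP[ly _] h1 _].
have {}h1 := h1 ul.1 (ltac:(by rewrite lexx)).
have Gl : G w yb <= G w ul.1.
  have : xb * (yb - ul.1) <= 0 by rewrite mulr_le0_ge0// ?subr_ge0// ltW.
  lra.
have [y3|y3] := leP yb (rho_cut P F w (speed P ur)).
  apply: le_trans Gl; move: y3; rewrite le_eqVlt => /predU1P[<-//|y3].
  by rewrite !(Gflux_D hP)//; apply/ltW/(flow_decr hP).
move: Oyc; rewrite /Ol lt_geF// => -[_ _ h2].
have {}h2 := h2 (rho_cut P F w (speed P ur)) (ltac:(by rewrite lexx y3)).
have : xb * (rho_cut P F w (speed P ur) - ul.1) <= 0.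
  by rewrite mulr_le0_ge0// ?subr_ge0 ?(ltW xb0)// (le_trans (ltW ls)).
lra.
Qed.

Lemma consistentII_pos ul um ur xb x : Omega P ul -> Omega P um -> Omega P ur ->
  0 <= xb -> T ul um xb = um -> T um ur xb = um ->
  T ul ur x = Defs.glue xb (T ul um) (T um ur) x.
Proof.
move=> Oul Oum Our xb0 T1 T2.
have vv := Omega_speed hP Our; have vvm := Omega_speed hP Oum.
have Ww := wbar_range hP Oul; have V0 := vmax_gt0 hP.
have /andP[v0' vV] := vv.
have [vxb|xbv] := leP (speed P ur) xb.
  have eum : um = ur by rewrite -T2 (constrained_end hP hF).
  rewrite /Defs.glue eum; case: ltP => // xbx.
  by rewrite !(constrained_end hP hF)// (le_trans vxb).
have xend : speed P ur <= x -> T ul ur x = Defs.glue xb (T ul um) (T um ur) x.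
  move=> vx; rewrite /Defs.glue ltNge (le_trans (ltW xbv) vx)/=.
  by rewrite !(constrained_end hP hF).
have [/xend//|xv] := leP (speed P ur) x.
have v0 : 0 < speed P ur := le_lt_trans xb0 xbv.
set v := speed P ur in vv v0' vV xbv xv v0 *.
have Dv := rho_D hP Ww vv; have DV := rho_D hP Ww (vmax_itv hP).
have := T2; rewrite (constrained_right hP hF)// -/v.
set p2 := cut_flow P F um ur => e2.
set p1 := cut_flow P F ul um.
have [/andP[p20 p2s] p2v] := cut_flow_bounds Oum Our; rewrite -/p2 -/v in p20 p2s p2v.
have [/andP[p10 p1s] p1v] := cut_flow_bounds Oul Oum; rewrite -/p1 in p10 p1s p1v.
have rmw : v * rm v <= v * rho P (wbar P ul) v.
  rewrite ler_wpM2l//; apply: (rho_le hP) => //; first exact: wm_range.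
  by case/andP: Ww.
(* Either [um] is the free state ahead of the transition to ur, or it lies behind that transition
   and has the speed of ur. *)
have [c2|c2] := boolP (cond p2 v xb).
  have eum : um = (p2 / V, Qfree P (p2 / V)).
    by rewrite -e2 /right_profile c2.
  have [Of2 sf2 ff2] := @flow_free _ _ hP p2 (ltac:(by rewrite p20)).
  have sum : speed P um = V by rewrite eum.
  have xbV : xb < V by exact: lt_le_trans vV.
  have T1x y : 0 <= y -> y < V -> T ul um y = (p1 / V, Qfree P (p1 / V)).
    move=> y0 yV; rewrite (constrained_right hP hF)// ?sum//.
    by rewrite right_profile_vmax// p10.
  have e12 : p1 = p2.
    have : p1 / V = p2 / V.
      by have := T1; rewrite (T1x _ xb0 xbV) eum => -[].
    by apply: mulIf; rewrite invr_eq0 gt_eqF.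
  have [p2m p2m'] := cond_lt xb0 (ltW xbv) vV c2.
  have ep1 : p1 = Num.min (V * demand P ul) F.
    rewrite /p1 /cut_flow /riemann_flow sum; congr Num.min.
    by rewrite min_l// ler_pM2l// demand_le_vmax.
  have e3 : cut_flow P F ul ur = p1.
    rewrite /cut_flow /riemann_flow -/v -minA (minC _ F) minA -ep1 min_l//.
    by rewrite e12 (le_trans (ltW p2m)).
  have [x0|x0] := leP 0 x.
    rewrite (constrained_right hP hF)// e3 -/v /Defs.glue; case: ltP => xx.
      rewrite T1x//; last exact: lt_trans xbV.
      by rewrite e12 /right_profile (condN_mono x0 (ltW xx) (ltW xbv) vV c2).
    by rewrite (constrained_right hP hF)// e12.
  rewrite /Defs.glue (lt_le_trans x0 xb0).
  have [ea La] := constrained_left hP hF Oul Oum.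
  have [eb Lb] := constrained_left hP hF Oul Our.
  have [y1 [-> O1 _]] := La _ x0; have [y2 [-> O2 _]] := Lb _ x0.
  congr state_on; rewrite sum in O1; rewrite -/v in O2.
  (* The targets for the speeds [v] and V may differ. If F binds, both have flow F. Otherwise ul is
     free, since the demand of a congested ul would be at least its flow at speed [v], and it stays
     put for either target. *)
  have [FV|VF] := leP F (V * demand P ul).
    have e : rho_cut P F (wbar P ul) v = rho_cut P F (wbar P ul) V.
      apply: (rho_cut_eq Ww vv (vmax_itv hP)); rewrite !min_r//.
        by apply: le_trans FV _; rewrite ler_pM2l// demand_le_vmax.
      apply: le_trans rmw; apply/ltW/(le_lt_trans _ p2m).
      by rewrite -e12 ep1 min_r.
    by rewrite e in O2; exact: (Ol_uniq O2).
  rewrite min_l in ep1; last exact: ltW.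
  case: (Omega_case hP Oul) => [[w' [l [Dl el ew']]]|[el /andP[l0 ls] ew']].
    exfalso; have := flux_le_max hP Ww vv; rewrite leNgt => /negP; apply.
    apply: lt_le_trans rmw; apply: le_lt_trans p2m.
    by rewrite -e12 ep1 el (demand_c hP Dl) (wbar_D hP Dl).
  have Gl : G (wm P) ul.1 = p1.
    by rewrite ep1 (Gflux_wm_free hP (ltW ls)) el demand_free// mulrC.
  have stay v' : 0 <= v' <= V -> p1 <= v' * rho P (wbar P ul) v' ->
      Ol_strict (G (wbar P ul)) x ul.1 (rho_cut P F (wbar P ul) v') ul.1.
    move=> vv' pv'; rewrite ew' in Ww pv' *; have [Dc ec] := rho_cutP hP hF Ww vv'.
    apply: (Ol_stay_free hP) => //; rewrite (Gflux_D hP Dc) ec Gl le_min pv'/=.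
    by rewrite ep1 ltW.
  have -> : y2 = ul.1.
    apply: (Ol_uniq O2); apply/Ol_strictW/stay => //.
    by rewrite e12; exact: (le_trans (ltW p2m)).
  apply/esym; apply: (Ol_uniq O1); apply/Ol_strictW/stay; first exact: vmax_itv.
  by rewrite -sum.
have eum : um = congested_trace P p2 v.
  by rewrite -e2 /right_profile (negbTE c2).
have [w' [r [Dr er cv err]]] := congested_traceP hP v0 vV (wbar_range hP Oum) p2v.
have sum : speed P um = v by rewrite eum er.
have fum : v * rm v <= flow P um.
  rewrite eum er flow_D cv err.
  by rewrite mulrC ler_wpM2r// le_max lexx orbT.
have e3 : cut_flow P F ul ur = p1.
  by rewrite /p1 /cut_flow /riemann_flow sum.
have [x0|x0] := leP 0 x; last first.
  rewrite /Defs.glue (lt_le_trans x0 xb0).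
  have [ea La] := constrained_left hP hF Oul Oum.
  have [eb Lb] := constrained_left hP hF Oul Our.
  have [y1 [-> O1 _]] := La _ x0; have [y2 [-> O2 _]] := Lb _ x0.
  by congr state_on; rewrite sum in O1; exact: (Ol_uniq O2).
rewrite (constrained_right hP hF)// e3 -/v /Defs.glue; case: ltP => xx.
  by rewrite (constrained_right hP hF)// ?sum.
rewrite (constrained_right hP hF)// -/v -/p2.
have := T1; rewrite (constrained_right hP hF)// ?sum// -/p1 => e1.
(* Ahead of its transition the first profile would show a flow [p1] below [v * rm v], less than the
   flow of [um]. *)
have c1 : ~~ cond p1 v xb.
  apply/negP => c1; have [h _] := cond_lt xb0 (ltW xbv) vV c1.
  have [_ _ ff1] := @flow_free _ _ hP p1 (ltac:(by rewrite p10)).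
  move: fum; rewrite -e1 /right_profile c1 ff1.
  by rewrite leNgt h.
have st p : ~~ cond p v xb -> right_profile P p v x = congested_trace P p v.
  move=> c; rewrite /right_profile ifF//; apply/negbTE; apply: contra c.
  exact: (condN_mono xb0 xx (ltW xv) vV).
rewrite !st// -eum -e1 /right_profile.
by rewrite (negbTE c1).
Qed.

Lemma consistentII_constrained : consistentII (Omega P) T.
Proof.
move=> ul um ur xb Oul Oum Our T1 T2 x; have [xb0|xb0] := ltP xb 0.
  exact: consistentII_neg.
exact: consistentII_pos.
Qed.

Lemma not_consistentI_constrained : ~ consistentI (Omega P) T.
Proof.
move=> CI; pose u := (sp P, wp P * sp P).
have V0 := vmax_gt0 hP; have /andP[F0 FV] := hF.
have Du := Omega_c_sp hP; have Ou : Omega P u by right.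
have su : speed P u = V := cspeed_sp hP.
have suV : speed P u <= V by rewrite su.
(* At x = V the solution has already returned to [u], so (I) would force the value [u] at x = 0 as
   well, where the constraint leaves a free state of flow F. *)
have [_ /(_ 0)] := CI u u u V Ou Ou Ou (constrained_end hP hF Ou Ou suV).
rewrite /Defs.glue V0 (constrained_right hP hF)// ?su//.
have -> : cut_flow P F u u = F.
  rewrite /cut_flow (riemann_flow_c hP)// -/u su (rho_wp_vmax hP).
  by rewrite min_r// ltW.
rewrite right_profile_vmax ?(ltW F0) ?(ltW FV)// => -[e _].
by move: FV; rewrite -e mulrCA divff ?gt_eqF// mulr1 ltxx.
Qed.

End Consistency.

(** * Boundedness and continuity *)

Section Boundedness.
Context {R : realType}.
Variables (P : phase_data R) (F : R).
Hypothesis hP : standing_hypotheses P.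
Hypothesis hF : 0 < F < vmax P * sp P.
Implicit Types (r q w y v x l m phi : R) (u : R * R).
Local Notation V := (vmax P).
Local Notation M := (rhomax P).
Local Notation D w r := (Omega_c P (r, w * r)).
Local Notation G := (Gflux P).
Local Notation rm v := (rho P (wm P) v).
Local Notation T := (constrained_riemann P F).
Local Notation mu := (@lebesgue_measure R).

Lemma Lfun_bounded (f : R -> R) (C : R) : measurable_fun setT f ->
  (forall x, `|f x| <= C) -> f \in Lfun mu +oo%E.
Proof.
move=> mf fC; rewrite inE; apply/andP; split; rewrite inE//=.
rewrite /finite_norm unlock /Lnorm; case: ifPn => // _.
apply: (@le_lt_trans _ _ C%:E); last exact: ltry.
by apply/ess_supP; apply: aeW => x /=; rewrite lee_fin.
Qed.

Lemma Qext_continuous : continuous (Qext P).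
Proof. by move=> r; apply: (Qext_cvg hP); exact: cvg_id. Qed.

Lemma Omega_bounded : exists C, forall u, Omega P u ->
  `|u.1| <= C /\ `|u.2| <= C.
Proof.
have sp0 : 0 < sp P := lt_trans (sm_gt0 hP) (sm_lt_sp hP).
have [c _ cmax] := @EVT_max R (fun r => `|Qext P r|) 0 (sp P) (ltW sp0)
  (ltac:(by apply: continuous_subspaceT => r; apply: cvg_norm; exact: Qext_continuous)).
have M0 := ltW (rhomax_gt0 hP).
have k0 : 0 <= (`|wm P| + `|wp P|) * M by rewrite mulr_ge0// addr_ge0.
exists (M + `|Qext P c| + (`|wm P| + `|wp P|) * M) => u Ou.
have /andP[u0 uM] := Omega_rho hP Ou.
split; first by rewrite ger0_norm// -addrA ler_wpDr// addr_ge0.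
case: Ou => [[us ->]|Oc].
  rewrite -(Qext_Qfree us) -addrA ler_wpDl// ler_wpDr//.
  by apply: cmax; rewrite in_itv.
have [w [r [Dr eu _]]] := Omega_cP hP Oc; rewrite eu/=.
rewrite ler_wpDl ?addr_ge0// normrM; apply: ler_pM => //.
  have /andP[w1 w2] := D_range hP Dr.
  have := ler_norm (wp P); have := ler_norm (- wm P); rewrite normrN.
  have := normr_ge0 (wm P); have := normr_ge0 (wp P).
  by rewrite ler_norml; lra.
by have := uM; rewrite eu/= ger0_norm// ltW// (D_gt0 hP Dr).
Qed.

Lemma constrained_Omega ul ur x : Omega P ul -> Omega P ur ->
  Omega P (T ul ur x).
Proof.
move=> Oul Our; have vv := Omega_speed hP Our; have /andP[v0 vV] := vv.
have [x0|x0] := ltP x 0.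
  have [e L] := constrained_left hP hF Oul Our; have [y [-> Oy _]] := L _ x0.
  have [D1 _] := rho_cutP hP hF (wbar_range hP Oul) vv.
  case: (profile_range hP Oul D1 Oy) => [Dy|[-> _ y0 ys]].
    by rewrite (state_on_D hP Dy); right.
  rewrite (state_on_free hP) ?y0 ?ltW//; left; split=> //=.
  by rewrite y0 (le_trans (ltW ys))// ltW// sm_lt_sp.
have [vx|xv] := leP (speed P ur) x; first by rewrite (constrained_end hP hF).
rewrite (constrained_right hP hF)// /right_profile.
have [c1 c2] := cut_flow_bounds hP hF Oul Our; case: ifP => _.
  by left; have [] := flow_free hP c1.
have v0' := le_lt_trans x0 xv.
have [w [r [Dr -> _ _]]] := congested_traceP hP v0' vV (wbar_range hP Oul) c2.
by right.
Qed.

Lemma measurable_step (g : R -> R) (v k c a b d : R) :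
  measurable_fun setT g -> measurable_fun setT
  (fun x => if x < 0 then g x else if x < v then
     (if x * k < c then a else b) else d).
Proof.
move=> mg; apply: measurable_fun_ifT => //.
  by apply: measurable_fun_ltr => //; exact: measurable_cst.
apply: measurable_fun_ifT => //.
  by apply: measurable_fun_ltr => //; exact: measurable_cst.
apply: measurable_fun_ifT => //.
by apply: measurable_fun_ltr => //; apply: measurable_funM.
Qed.

Lemma constrained_measurable ul ur : Omega P ul -> Omega P ur ->
  measurable_fun setT (fun x => (T ul ur x).1) /\
  measurable_fun setT (fun x => (T ul ur x).2).
Proof.
move=> Oul Our; have vv := Omega_speed hP Our.
have [e L] := constrained_left hP hF Oul Our.
set w := wbar P ul in L; set l := ul.1 in L.
set m := rho_cut P F w (speed P ur) in L.
(* The left density, continued by its target so as to be monotone on the whole line and therefore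
   measurable. *)
pose Z x := if x < 0 then (T ul ur x).1 else m.
have ZL x : x < 0 -> T ul ur x = state_on P w (Z x) /\ Ol (G w) x l m (Z x).
  by move=> x0; rewrite /Z x0; have [y [-> Oy _]] := L _ x0.
have mZ : measurable_fun setT Z.
  have [lm|ml] := leP l m.
    apply: nondecreasing_measurable => // x1 x2 x12.
    have [x20|x20] := ltP x2 0.
      have x10 := le_lt_trans x12 x20.
      have [_ O1] := ZL _ x10; have [_ O2] := ZL _ x20.
      by have := Ol_mono x12 O1 O2; rewrite lm.
    rewrite {2}/Z ltNge x20/=; have [x10|x10] := ltP x1 0; last first.
      by rewrite /Z ltNge x10.
    have [_ /Ol_between] := ZL _ x10; rewrite (min_l lm) (max_r lm).
    by case/andP.
  apply: nonincreasing_measurable => // x1 x2 x12.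
  have [x20|x20] := ltP x2 0.
    have x10 := le_lt_trans x12 x20.
    have [_ O1] := ZL _ x10; have [_ O2] := ZL _ x20.
    by have := Ol_mono x12 O1 O2; rewrite lt_geF.
  rewrite {1}/Z ltNge x20/=; have [x10|x10] := ltP x1 0; last first.
    by rewrite /Z ltNge x10.
  have [_ /Ol_between] := ZL _ x10; rewrite (min_r (ltW ml)) (max_l (ltW ml)).
  by case/andP.
have TE x : T ul ur x = if x < 0 then state_on P w (Z x) else
    if x < speed P ur then right_profile P (cut_flow P F ul ur) (speed P ur) x
    else ur.
  case: ltP => x0; first by have [] := ZL _ x0.
  case: ltP => xv; first by rewrite (constrained_right hP hF).
  by rewrite (constrained_end hP hF).
split.
  set f := (X in measurable_fun _ X).
  pose p := cut_flow P F ul ur; pose v := speed P ur.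
  rewrite (_ : f = fun x => if x < 0 then Z x else if x < v then
     (if x * (rm v - p / V) < v * rm v - p then p / V
      else (congested_trace P p v).1) else ur.1).
    exact: measurable_step.
  apply/funext => x; rewrite /f TE; case: ltP => // x0; case: ltP => // xv.
  by rewrite /right_profile -/p -/v; case: ifP.
set f := (X in measurable_fun _ X).
pose p := cut_flow P F ul ur; pose v := speed P ur.
rewrite (_ : f = fun x => if x < 0 then (state_on P w (Z x)).2 else if x < v then
     (if x * (rm v - p / V) < v * rm v - p then Qfree P (p / V)
      else (congested_trace P p v).2) else ur.2).
  apply: measurable_step; rewrite /state_on/=.
  apply: measurable_funD.
    apply: measurable_funB => //.
    apply: (@measurableT_comp _ _ _ _ _ _ (Qext P)).
      by apply: continuous_measurable_fun; exact: Qext_continuous.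
    by apply: measurable_minr.
  apply: measurable_funM => //.
  by apply: measurable_maxr.
apply/funext => x; rewrite /f TE; case: ltP => // x0; case: ltP => // xv.
by rewrite /right_profile -/p -/v; case: ifP.
Qed.

Lemma Linfty_constrained : Linfty_solver (Omega P) T.
Proof.
move=> ul ur Oul Our; have [C hC] := Omega_bounded.
have [m1 m2] := constrained_measurable Oul Our.
split; first by move=> x; exact: constrained_Omega.
  by apply: (Lfun_bounded (C := C)) => // x;
    have [] := hC _ (constrained_Omega x Oul Our).
by apply: (Lfun_bounded (C := C)) => // x;
    have [] := hC _ (constrained_Omega x Oul Our).
Qed.

End Boundedness.

(** * Convergence of the scalar data and of the minimisers *)

Section SequentialContinuity.
Context {R : realType}.

Lemma le_cvg {T} {U : set_system T} {PU : ProperFilter U} (f g : T -> R)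
    (a b : R) :
  f t @[t --> U] --> a -> g t @[t --> U] --> b ->
  (\forall t \near U, f t <= g t) -> a <= b.
Proof.
move=> fa gb fg; rewrite -subr_ge0.
apply: (cvgr_to_ge (cvgB gb fa)).
by apply: filterS fg => t; rewrite subr_ge0.
Qed.

(** At the threshold the sequence may alternate between the branches, so both must converge there,
    to the same limit. *)
Lemma piecewise_cvg {T} {U : set_system T} {FU : Filter U} {V : topologicalType}
    (s : T -> R) (s0 c : R) (f g : T -> V) (a b : V) :
  s t @[t --> U] --> s0 ->
  (s0 <= c -> f t @[t --> U] --> a) -> (c <= s0 -> g t @[t --> U] --> b) ->
  (s0 = c -> a = b) ->
  (if s t < c then f t else g t) @[t --> U] --> (if s0 < c then a else b).
Proof.
move=> sc fa gb ab; case: ltgtP => [sc'|cs|e].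
- apply: cvg_trans (fa (ltW sc')); apply: near_eq_cvg.
  have : \forall t \near U, s t < c by apply: cvgr_lt sc _ sc'.
  by apply: filterS => t ->.
- apply: cvg_trans (gb (ltW cs)); apply: near_eq_cvg.
  have : \forall t \near U, c < s t by apply: cvgr_gt sc _ cs.
  by apply: filterS => t h; rewrite ltNge ltW.
have {}fa := fa (ltac:(by rewrite e)); have {}gb := gb (ltac:(by rewrite e)).
rewrite (ab e) in fa; move=> A nA.
have h1 : U (f @^-1` A) := fa _ nA; have h2 : U (g @^-1` A) := gb _ nA.
suff : U ((fun t => if s t < c then f t else g t) @^-1` A) by [].
by apply: filterS (filterI h1 h2) => t [/= At Bt]; rewrite /preimage/=; case: ifP.
Qed.

Lemma cvg_sub_filter {T} {F U : set_system T} {V : topologicalType}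
    (f : T -> V) (a : V) : F `<=` U ->
  f t @[t --> F] --> a -> f t @[t --> U] --> a.
Proof. by move=> FU fa A nA; apply: FU; exact: fa. Qed.

Variables (P : phase_data R) (F : R).
Hypothesis hP : standing_hypotheses P.
Hypothesis hF : 0 < F < vmax P * sp P.
Implicit Types (r q y x phi : R).
Local Notation V := (vmax P).
Local Notation M := (rhomax P).
Local Notation D w r := (Omega_c P (r, w * r)).
Local Notation G := (Gflux P).
Local Notation rm v := (rho P (wm P) v).
Local Notation T := (constrained_riemann P F).

Lemma cspeed_lim_D (U : set_system nat) {PU : ProperFilter U} (w r : nat -> R)
    (w0 r0 : R) :
  w t @[t --> U] --> w0 -> r t @[t --> U] --> r0 ->
  wrange P w0 -> (\forall n \near U, D (w n) (r n)) ->
  D w0 r0.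
Proof.
move=> ww rr Ww Dn.
have bnd (h : nat -> R) (h0 a b : R) : h t @[t --> U] --> h0 ->
    (\forall n \near U, a <= h n <= b) -> a <= h0 <= b.
  move=> hh hn; apply/andP; split.
    by apply: (cvgr_to_ge hh); apply: filterS hn => n /andP[].
  by apply: (cvgr_to_le hh); apply: filterS hn => n /andP[].
have sr : sm P <= r0 <= M.
  by apply: (bnd _ _ _ _ rr); apply: filterS Dn => n /(D_bounds hP).
apply/(Omega_cE hP); split=> //.
apply: (bnd (fun n => cspeed P (w n) (r n))).
  apply: (cspeed_cvg hP) => //; apply: lt_le_trans (sm_gt0 hP) _.
  by case/andP: sr.
by apply: filterS Dn => n /(D_speed hP).
Qed.

Lemma rho_cvg (w v : nat -> R) (w0 v0 : R) :
  (forall n, wrange P (w n)) -> (forall n, 0 <= v n <= V) ->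
  wrange P w0 -> 0 <= v0 <= V ->
  w n @[n --> \oo] --> w0 -> v n @[n --> \oo] --> v0 ->
  rho P (w n) (v n) @[n --> \oo] --> rho P w0 v0.
Proof.
move=> Wn vn W0 vv ww vc; apply: (compact_unique_cvg (a := sm P) (b := M)).
  by apply: nearW => n; exact: (D_bounds hP (rho_D hP (Wn n) (vn n))).
move=> U PU FU c' rc.
have Dc : D w0 c'.
  apply: (cspeed_lim_D (cvg_sub_filter FU ww) rc W0).
  by apply: nearW => n; exact: (rho_D hP).
apply: (cspeed_inj hP Dc (rho_D hP W0 vv)); rewrite (cspeed_rho hP)//.
have c0 := D_gt0 hP Dc.
have h : cspeed P (w n) (rho P (w n) (v n)) @[n --> U] --> cspeed P w0 c'.
  exact: (cspeed_cvg hP c0 (cvg_sub_filter FU ww) rc).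
have h2 : cspeed P (w n) (rho P (w n) (v n)) @[n --> U] --> v0.
  apply: cvg_trans (cvg_sub_filter FU vc).
  by apply: near_eq_cvg; apply: nearW => n; rewrite (cspeed_rho hP).
exact: (cvg_unique (@Rhausdorff R) h h2).
Qed.

Lemma rho_cut_cvg (w v : nat -> R) (w0 v0 : R) :
  (forall n, wrange P (w n)) -> (forall n, 0 <= v n <= V) ->
  wrange P w0 -> 0 <= v0 <= V ->
  w n @[n --> \oo] --> w0 -> v n @[n --> \oo] --> v0 ->
  rho_cut P F (w n) (v n) @[n --> \oo] --> rho_cut P F w0 v0.
Proof.
move=> Wn vn W0 vv ww vc; apply: (compact_unique_cvg (a := sm P) (b := M)).
  apply: nearW => n; have [Dc _] := rho_cutP hP hF (Wn n) (vn n).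
  exact: (D_bounds hP Dc).
move=> U PU FU c' rc.
have Dc : D w0 c'.
  apply: (cspeed_lim_D (cvg_sub_filter FU ww) rc W0).
  by apply: nearW => n; have [] := rho_cutP hP hF (Wn n) (vn n).
apply/esym; apply: (rho_cutE hP hF) => //.
have c0 := D_gt0 hP Dc.
have h : rho_cut P F (w n) (v n) * cspeed P (w n) (rho_cut P F (w n) (v n))
    @[n --> U] --> c' * cspeed P w0 c'.
  by apply: (cvgM rc); exact: (cspeed_cvg hP c0 (cvg_sub_filter FU ww) rc).
have h2 : Num.min (v n * rho P (w n) (v n)) F @[n --> \oo]
    --> Num.min (v0 * rho P w0 v0) F.
  by apply: cvg_minr; [apply: cvgM => //; exact: rho_cvg|exact: cvg_cst].
apply: (cvg_unique (@Rhausdorff R) h); apply: cvg_trans (cvg_sub_filter FU h2).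
apply: near_eq_cvg; apply: nearW => n.
by have [_ <-] := rho_cutP hP hF (Wn n) (vn n).
Qed.

(** A limit [c] of optimisers does at least as well as [y0] in the limit problem, so strictness
    forces them to agree. If the limit interval is a point, the directions may alternate and
    squeezing decides. *)
Lemma Ol_cvg x (w l m y : nat -> R) (w0 l0 m0 y0 : R) :
  (forall n, 0 <= l n <= M) -> (forall n, 0 <= m n <= M) ->
  w n @[n --> \oo] --> w0 -> l n @[n --> \oo] --> l0 ->
  m n @[n --> \oo] --> m0 ->
  (forall n, Ol (G (w n)) x (l n) (m n) (y n)) ->
  Ol_strict (G w0) x l0 m0 y0 -> y n @[n --> \oo] --> y0.
Proof.
move=> lM mM ww ll mm On O0.
apply: (compact_unique_cvg (a := 0) (b := M)).
  apply: nearW => n; have := Ol_between (On n); have := lM n; have := mM n.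
  by case: (leP (l n) (m n)) => _ /andP[a1 a2] /andP[b1 b2] /andP[c1 c2];
    apply/andP; split; lra.
move=> U PU FU c yc.
have wU := cvg_sub_filter FU ww; have lU := cvg_sub_filter FU ll.
have mU := cvg_sub_filter FU mm.
have /andP[c1 c2] : Num.min l0 m0 <= c <= Num.max l0 m0.
  apply/andP; split.
    apply: (le_cvg (cvg_minr lU mU) yc); apply: nearW => n.
    by case/andP: (Ol_between (On n)).
  apply: (le_cvg yc (cvg_maxr lU mU)); apply: nearW => n.
  by case/andP: (Ol_between (On n)).
have /andP[y1 y2] := Ol_between (Ol_strictW O0).
apply/eqP/negPn/negP => cy.
have [lm|ml|e] := ltgtP l0 m0; last first.
- by move: cy c1 c2 y1 y2; rewrite e minxx maxxx; case: ltgtP; lra.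
- rewrite (min_r (ltW ml)) (max_l (ltW ml)) in c1 c2 y1 y2.
  move: O0; rewrite /Ol_strict lt_geF// => -[_ /(_ c)].
  rewrite c1 c2 => /(_ isT cy); rewrite ltNge => /negP; apply.
  (* [y0] may fall outside the moving interval; its projection is an admissible competitor and tends
     to [y0]. *)
  pose r n := Num.max (m n) (Num.min y0 (l n)).
  have rU : r n @[n --> U] --> y0.
    rewrite -[X in _ --> X](_ : Num.max m0 (Num.min y0 l0) = y0); last first.
      by rewrite min_l// max_r.
    by apply: cvg_maxr => //; apply: cvg_minr => //; exact: cvg_cst.
  have Gx (z : nat -> R) (z0 : R) : z n @[n --> U] --> z0 ->
      G (w n) (z n) - x * z n @[n --> U] --> G w0 z0 - x * z0.
    move=> zz; apply: cvgB; first exact: (Gflux_cvg hP).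
    by apply: cvgM => //; exact: cvg_cst.
  apply: (le_cvg (Gx _ _ rU) (Gx _ _ yc)).
  have : \forall n \near U, l n - m n > 0.
    by apply: cvgr_gt (cvgB lU mU) _ _; rewrite subr_gt0.
  apply: filterS => n; rewrite subr_gt0 => mln.
  have := Ol_weak (On n); rewrite lt_geF//; apply.
  by rewrite /r le_max lexx/= ge_max (ltW mln) ge_min lexx orbT.
- rewrite (min_l (ltW lm)) (max_r (ltW lm)) in c1 c2 y1 y2.
  move: O0; rewrite /Ol_strict ltW// => -[_ /(_ c)].
  rewrite c1 c2 => /(_ isT cy); rewrite ltNge => /negP; apply.
  pose r n := Num.max (l n) (Num.min y0 (m n)).
  have rU : r n @[n --> U] --> y0.
    rewrite -[X in _ --> X](_ : Num.max l0 (Num.min y0 m0) = y0); last first.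
      by rewrite min_l// max_r.
    by apply: cvg_maxr => //; apply: cvg_minr => //; exact: cvg_cst.
  have Gx (z : nat -> R) (z0 : R) : z n @[n --> U] --> z0 ->
      G (w n) (z n) - x * z n @[n --> U] --> G w0 z0 - x * z0.
    move=> zz; apply: cvgB; first exact: (Gflux_cvg hP).
    by apply: cvgM => //; exact: cvg_cst.
  apply: (le_cvg (Gx _ _ yc) (Gx _ _ rU)).
  have : \forall n \near U, m n - l n > 0.
    by apply: cvgr_gt (cvgB mU lU) _ _; rewrite subr_gt0.
  apply: filterS => n; rewrite subr_gt0 => lmn.
  have := Ol_weak (On n); rewrite ltW//; apply.
  by rewrite /r le_max lexx/= ge_max (ltW lmn) ge_min lexx orbT.
Qed.

Section Sequence.
Variables (u0 : R * R) (us : nat -> R * R).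
Hypothesis Ou : Omega P u0.
Hypothesis Ous : forall n, Omega P (us n).
Hypothesis uc : us n @[n --> \oo] --> u0.

Lemma cvg_rho : (us n).1 @[n --> \oo] --> u0.1.
Proof. by apply: (cvg_comp _ _ uc); exact: cvg_fst. Qed.

Lemma cvg_q : (us n).2 @[n --> \oo] --> u0.2.
Proof. by apply: (cvg_comp _ _ uc); exact: cvg_snd. Qed.

(** Below [sm P], vacuum included, the speed is locally the constant V on [Omega]; elsewhere the
    density is positive and the formulas are continuous. *)
Lemma cvg_speed : speed P (us n) @[n --> \oo] --> speed P u0.
Proof.
have [us0|su] := ltP u0.1 (sm P).
  rewrite (Omega_f_speed hP (Omega_lt_sm Ou us0)).
  have h : \forall n \near \oo, V = speed P (us n).
    have : \forall n \near \oo, (us n).1 < sm P by apply: cvgr_lt cvg_rho _ us0.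
    by apply: filterS => n h; rewrite (Omega_f_speed hP (Omega_lt_sm (Ous n) h)).
  by apply: cvg_trans (near_eq_cvg h) _; exact: cvg_cst.
have u1 : 0 < u0.1 := lt_le_trans (sm_gt0 hP) su.
have e : (fun n => speed P (us n)) = fun n => speed P ((us n).1, (us n).2).
  by apply/funext => n; rewrite -surjective_pairing.
rewrite [X in X @ _](e) [X in _ --> speed P X]surjective_pairing.
exact: (speed_cvg hP u1 cvg_rho cvg_q).
Qed.

Lemma wbarE u : Omega P u -> wbar P u = if u.1 < sm P then wm P else u.2 / u.1.
Proof.
move=> Ou'; case: ltP => h; first exact: (wbar_f hP (Omega_lt_sm Ou' h)).
exact/wbar_c/(Omega_sm_le hP).
Qed.

Lemma cvg_wbar : wbar P (us n) @[n --> \oo] --> wbar P u0.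
Proof.
rewrite (_ : (fun n => _) =
  fun n => if (us n).1 < sm P then wm P else (us n).2 / (us n).1); last first.
  by apply/funext => n; exact: wbarE.
rewrite (wbarE Ou); apply: piecewise_cvg => [|_|su|e].
- exact: cvg_rho.
- exact: cvg_cst.
- apply: cvgM; first exact: cvg_q.
  by apply: cvgV; [rewrite gt_eqF// (lt_le_trans (sm_gt0 hP))|exact: cvg_rho].
have Oc := Omega_sm_le hP Ou (ltac:(by rewrite e)).
have Ds : D (u0.2 / u0.1) (sm P) by rewrite -e -(Omega_c_eta hP Oc).
by rewrite (D_sm hP Ds).
Qed.

Lemma cvg_demand : demand P (us n) @[n --> \oo] --> demand P u0.
Proof.
have VV := vmax_itv hP.
apply: piecewise_cvg => [|_|_|e]; [exact: cvg_rho|exact: cvg_rho| |].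
  apply: rho_cvg => //; [|exact: (wbar_range hP)|exact: cvg_wbar|exact: cvg_cst].
  by move=> n; exact: (wbar_range hP).
have Oc := Omega_sm_le hP Ou (ltac:(by rewrite e)).
have Ds : D (u0.2 / u0.1) (sm P) by rewrite -e -(Omega_c_eta hP Oc).
by rewrite (wbar_c Oc) (D_sm hP Ds) (rho_wm_vmax hP).
Qed.

End Sequence.
End SequentialContinuity.

Section Continuity.
Context {R : realType}.
Variables (P : phase_data R) (F : R).
Hypothesis hP : standing_hypotheses P.
Hypothesis hF : 0 < F < vmax P * sp P.
Implicit Types (r q y x phi : R).
Local Notation V := (vmax P).
Local Notation M := (rhomax P).
Local Notation D w r := (Omega_c P (r, w * r)).
Local Notation G := (Gflux P).
Local Notation rm v := (rho P (wm P) v).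
Local Notation T := (constrained_riemann P F).
Local Notation mu := (@lebesgue_measure R).

Variables (ul ur : R * R) (uls urs : nat -> R * R).
Hypotheses (Oul : Omega P ul) (Our : Omega P ur).
Hypotheses (Ouls : forall n, Omega P (uls n)) (Ours : forall n, Omega P (urs n)).
Hypothesis lc : uls n @[n --> \oo] --> ul.
Hypothesis rc : urs n @[n --> \oo] --> ur.

Let vn n := speed P (urs n).
Let v := speed P ur.
Let wn n := wbar P (uls n).
Let w := wbar P ul.
Let pn n := cut_flow P F (uls n) (urs n).
Let p := cut_flow P F ul ur.

Let vn_itv n : 0 <= vn n <= V := Omega_speed hP (Ours n).
Let v_itv : 0 <= v <= V := Omega_speed hP Our.
Let wn_range n : wrange P (wn n) := wbar_range hP (Ouls n).
Let w_range : wrange P w := wbar_range hP Oul.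
Let vc : vn n @[n --> \oo] --> v := cvg_speed hP Our Ours rc.
Let wc : wn n @[n --> \oo] --> w := cvg_wbar hP Oul Ouls lc.

Let rmc : rm (vn n) @[n --> \oo] --> rm v.
Proof.
apply: (rho_cvg hP (w := fun=> wm P)) => //; last exact: cvg_cst.
  by move=> _; exact: wm_range.
exact: wm_range.
Qed.

Let pc : pn n @[n --> \oo] --> p.
Proof.
apply: cvg_minr; last exact: cvg_cst.
apply: cvg_minr.
  by apply: cvgM; [exact: cvg_cst|exact: (cvg_demand hP)].
by apply: cvgM => //; exact: rho_cvg.
Qed.

(** The density has an explicit continuous formula. The parameter w has none: it stays in a compact
    interval, and the limit density and positive limit speed determine its limit. *)
Lemma congested_trace_cvg : 0 < v ->
  congested_trace P (pn n) (vn n) @[n --> \oo] --> congested_trace P p v.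
Proof.
move=> v0; have /andP[_ vV] := v_itv.
have [_ pv] := cut_flow_bounds hP hF Oul Our.
have [w' [r [Dr -> cv er]]] := congested_traceP hP v0 vV w_range pv.
pose An n := congested_trace P (pn n) (vn n).
have vn0 : \forall n \near \oo, 0 < vn n by apply: cvgr_gt vc _ v0.
have An_spec : \forall n \near \oo, exists w'n, [/\ D w'n (An n).1,
    An n = ((An n).1, w'n * (An n).1), cspeed P w'n (An n).1 = vn n &
    (An n).1 = Num.max (pn n / vn n) (rm (vn n))].
  apply: filterS vn0 => n vn0; have /andP[_ vnV] := vn_itv n.
  have [_ pvn] := cut_flow_bounds hP hF (Ouls n) (Ours n).
  have [w'' [r' [Dr' e' cv' er']]] := congested_traceP hP vn0 vnV (wn_range n) pvn.
  by exists w''; rewrite /An e'.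
have rAc : (An n).1 @[n --> \oo] --> r.
  have h : Num.max (pn n / vn n) (rm (vn n)) @[n --> \oo] --> r.
    rewrite er; apply: cvg_maxr => //; apply: cvgM => //.
    by apply: cvgV => //; rewrite gt_eqF.
  apply: cvg_trans h; apply: near_eq_cvg.
  by apply: filterS An_spec => n [w'' [_ _ _ ->]].
have r0 := D_gt0 hP Dr.
pose wA n := (An n).2 / (An n).1.
have wA_spec : \forall n \near \oo, [/\ D (wA n) (An n).1,
    An n = ((An n).1, wA n * (An n).1) & cspeed P (wA n) (An n).1 = vn n].
  apply: filterS An_spec => n [w'' [D'' e'' c'' _]].
  have -> // : wA n = w''.
  by rewrite /wA {1}e'' /= mulfK// gt_eqF// (D_gt0 hP D'').
have wAc : wA n @[n --> \oo] --> w'.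
  apply: (compact_unique_cvg (a := wm P) (b := wp P)).
    by apply: filterS wA_spec => n [/(D_range hP)].
  move=> U PU FU c' cc.
  have rU := cvg_sub_filter FU rAc.
  have Wc : wrange P c'.
    apply/andP; split.
      by apply: (cvgr_to_ge cc); apply: FU;
        apply: filterS wA_spec => n [/(D_range hP)/andP[]].
    by apply: (cvgr_to_le cc); apply: FU;
        apply: filterS wA_spec => n [/(D_range hP)/andP[]].
  have hs : cspeed P (wA n) (An n).1 @[n --> U] --> cspeed P c' r.
    exact: (cspeed_cvg hP r0 cc rU).
  have hs2 : cspeed P (wA n) (An n).1 @[n --> U] --> v.
    apply: cvg_trans (cvg_sub_filter FU vc); apply: near_eq_cvg; apply: FU.
    by apply: filterS wA_spec => n [].
  have e := cvg_unique (@Rhausdorff R) hs hs2.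
  apply: (cspeed_w_inj hP (D_bounds hP Dr)); first by rewrite e.
  by rewrite e cv.
have h : ((An n).1, wA n * (An n).1) @[n --> \oo] --> (r, w' * r).
  by apply: cvg_pairR => //; exact: cvgM.
apply: cvg_trans h; apply: near_eq_cvg.
by apply: filterS wA_spec => n [_ <-].
Qed.

Let e_right := (v * rm v - p) / (rm v - p / V).

Lemma right_profile_cvg x : 0 < x -> x < v -> x != e_right ->
  right_profile P (pn n) (vn n) x @[n --> \oo] --> right_profile P p v x.
Proof.
move=> x0 xv xe; have V0 := vmax_gt0 hP; have /andP[_ vV] := v_itv.
have v0 : 0 < v by exact: lt_trans xv.
pose s n := x * (rm (vn n) - pn n / V) - (vn n * rm (vn n) - pn n).
pose s0 := x * (rm v - p / V) - (v * rm v - p).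
have sc : s n @[n --> \oo] --> s0.
  apply: cvgB.
    apply: cvgM; first exact: cvg_cst.
    by apply: cvgB => //; apply: cvgM => //; exact: cvg_cst.
  by apply: cvgB => //; exact: cvgM.
rewrite /right_profile.
rewrite [X in X @ _](_ : _ = fun n => if s n < 0
    then (pn n / V, Qfree P (pn n / V)) else congested_trace P (pn n) (vn n)).
  rewrite -subr_lt0 -/s0; apply: piecewise_cvg sc _ _ _.
  - move=> _; have fE u1 u2 : Omega P u1 -> Omega P u2 ->
        Qfree P (cut_flow P F u1 u2 / V) = Qext P (cut_flow P F u1 u2 / V).
      move=> O1 O2; have [/andP[c1 c2] _] := cut_flow_bounds hP hF O1 O2.
      by rewrite Qext_Qfree// (divr_ge0 c1 (ltW V0))/= ler_pdivrMr// mulrC.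
    have pVc : pn n / V @[n --> \oo] --> p / V by apply: cvgM => //; exact: cvg_cst.
    apply: cvg_pairR => //; rewrite fE//.
    apply: cvg_trans (Qext_cvg hP pVc); apply: near_eq_cvg; apply: nearW => n.
    by rewrite /pn -fE.
  - by move=> _; exact: congested_trace_cvg.
  (* Equality away from [e_right] leaves only a vanishing density difference. Then [p / V = rm v]
     and [p = v * rm v] give v = V, where both branches are the same state. *)
  move=> s00.
  have [rp|rp] := eqVneq (rm v - p / V) 0; last first.
    case/eqP: xe; rewrite /e_right; apply: (mulIf rp).
    by rewrite divfK//; move: s00; rewrite /s0; lra.
  have pV : p / V = rm v by apply/eqP; rewrite eq_sym -subr_eq0 rp.
  have pv : p = v * rm v by move: s00; rewrite /s0 rp; lra.
  have vE : v = V.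
    have m0 := rm_gt0 hP v_itv.
    apply: (mulIf (lt0r_neq0 m0)); rewrite -pv -pV mulrCA divff ?mulr1//.
    exact: lt0r_neq0.
  have rs : rm v = sm P by rewrite vE (rho_wm_vmax hP).
  have [c1 c2] := cut_flow_bounds hP hF Oul Our.
  have [Of sf ff] := flow_free hP c1.
  apply/esym/(congested_traceE hP v0); rewrite -/p in Of sf ff.
  - by apply: (Omega_f_c hP Of); rewrite pV rs.
  - by rewrite sf vE.
  - by rewrite ff -pv maxxx.
by apply/funext => n; rewrite /s subr_lt0.
Qed.

Lemma constrained_cvg_ae : exists N : set R, finite_set N /\
  forall x, ~ N x -> T (uls n) (urs n) x @[n --> \oo] --> T ul ur x.
Proof.
have [e L] := constrained_left hP hF Oul Our.
(* The location of the constraint, the contact to ur, the jump on the left, and the transition on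
   the right. *)
exists [set 0; v; e; e_right]; split=> [|x xN].
  by rewrite !finite_setU; do ![split]; exact: finite_set1.
have x_neq y : [set 0; v; e; e_right] y -> x != y.
  by move=> Ny; apply/eqP => xy; apply: xN; rewrite xy.
have x0 : x != 0 by apply: x_neq; do 3 left.
have xv : x != v by apply: x_neq; do 2 left; right.
have xe : x != e by apply: x_neq; left; right.
have xr : x != e_right by apply: x_neq; right.
have /andP[v0 vV] := v_itv.
have [x_lt0|x_gt0|e0] := ltgtP x 0; last by rewrite e0 eqxx in x0.
  have [y [-> _ /(_ xe) Oy]] := L _ x_lt0.
  have Tn n : T (uls n) (urs n) x = state_on P (wn n) (T (uls n) (urs n) x).1 /\
      Ol (G (wn n)) x (uls n).1 (rho_cut P F (wn n) (vn n)) (T (uls n) (urs n) x).1.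
    have [en Ln] := constrained_left hP hF (Ouls n) (Ours n).
    by have [yn [-> On _]] := Ln _ x_lt0.
  have yc : (T (uls n) (urs n) x).1 @[n --> \oo] --> y.
    have mc := rho_cut_cvg hP hF wn_range vn_itv w_range v_itv wc vc.
    apply: (Ol_cvg hP _ _ wc (cvg_rho lc) mc _ Oy).
    - by move=> n; exact: (Omega_rho hP (Ouls n)).
    - move=> n; have [Dc _] := rho_cutP hP hF (wn_range n) (vn_itv n).
      have /andP[_ ->] := D_bounds hP Dc.
      by rewrite andbT ltW// (D_gt0 hP Dc).
    - by move=> n; have [] := Tn n.
  apply: cvg_trans (state_on_cvg hP wc yc); apply: near_eq_cvg.
  by apply: nearW => n; have [<-] := Tn n.
have [x_ltv|x_gtv|ev] := ltgtP x v; last by rewrite ev eqxx in xv.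
  rewrite (constrained_right hP hF) ?(ltW x_gt0)//.
  apply: cvg_trans (right_profile_cvg x_gt0 x_ltv xr); apply: near_eq_cvg.
  have : \forall n \near \oo, x < vn n by apply: cvgr_gt vc _ x_ltv.
  by apply: filterS => n xvn; rewrite (constrained_right hP hF) ?(ltW x_gt0).
rewrite (constrained_end hP hF) ?(ltW x_gtv)//.
apply: cvg_trans rc; apply: near_eq_cvg.
have : \forall n \near \oo, vn n < x by apply: cvgr_lt vc _ x_gtv.
by apply: filterS => n xvn; rewrite (constrained_end hP hF) ?(ltW xvn).
Qed.

Lemma constrained_L1loc :
  L1loc_cvg (fun n => T (uls n) (urs n)) (T ul ur).
Proof.
move=> K cK.
have mK : measurable K := compact_measurable cK.
have [C hC] := Omega_bounded hP.
have [N [finN hN]] := constrained_cvg_ae.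
have meas f1 f2 : Omega P f1 -> Omega P f2 ->
    measurable_fun setT (fun x => (T f1 f2 x).1) /\
    measurable_fun setT (fun x => (T f1 f2 x).2).
  exact: constrained_measurable.
have [m1 m2] := meas _ _ Oul Our.
have normE n x : `|T (uls n) (urs n) x - T ul ur x| =
    Num.max `|(T (uls n) (urs n) x).1 - (T ul ur x).1|
            `|(T (uls n) (urs n) x).2 - (T ul ur x).2| by [].
pose d n x : R := `|T (uls n) (urs n) x - T ul ur x|.
have mf n : measurable_fun K (EFin \o d n).
  apply/measurable_EFinP.
  apply: (@measurable_funS _ _ _ _ setT) => //.
  have [n1 n2] := meas _ _ (Ouls n) (Ours n).
  rewrite (_ : d n = fun x => Num.max `|(T (uls n) (urs n) x).1 - (T ul ur x).1|
            `|(T (uls n) (urs n) x).2 - (T ul ur x).2|); last exact/funext.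
  apply: measurable_maxr; apply: measurableT_comp => //;
    exact: measurable_funB.
have bnd n x : d n x <= 2 * C.
  have [a1 a2] := hC _ (constrained_Omega hP hF x (Ouls n) (Ours n)).
  have [b1 b2] := hC _ (constrained_Omega hP hF x Oul Our).
  rewrite /d normE ge_max; apply/andP; split.
    by apply: le_trans (ler_normB _ _) _; lra.
  by apply: le_trans (ler_normB _ _) _; lra.
have [] := @dominated_convergence _ _ R mu K mK (fun n => EFin \o d n)
  (cst 0%E) (cst (2 * C)%:E) mf.
- exact: measurable_cst.
- exists N; split.
  + apply: countable_measurable; last exact: finite_set_countable.
    by move=> t; exact: measurable_set1.
  + apply: countable_lebesgue_measure0; exact: finite_set_countable.
  + move=> x /=; apply: contra_notP => Nx Kx.
    apply: cvg_EFin; first exact: nearW.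
    apply: (iffRL (@norm_cvg0P _ _ _ _ _ _)).
    exact: (iffRL (subr_cvg0 _ _) (hN _ Nx)).
- apply/integrableP; split; first exact: measurable_cst.
  under eq_integral do rewrite /=.
  rewrite integral_cst// lte_mul_pinfty//; exact: compact_finite_measure.
- by apply: aeW => x n _ /=; rewrite lee_fin /d normr_id; exact: bnd.
- by move=> _ _; rewrite integral0.
Qed.

End Continuity.

Theorem proposition3p4 (R : realType) (P : phase_data R) (F : R)
    (hP : standing_hypotheses P) (hF : 0 < F < vmax P * sp P) :
  [/\ Linfty_solver (Omega P) (constrained_riemann P F),
      L1loc_continuous (Omega P) (constrained_riemann P F),
      ~ consistent (Omega P) (constrained_riemann P F),
      consistentII (Omega P) (constrained_riemann P F) &
      ~ consistentI (Omega P) (constrained_riemann P F)].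
Proof.
have nI := not_consistentI_constrained hP hF.
split=> //.
- exact: Linfty_constrained.
- by move=> ul ur uls urs Oul Our Ouls Ours lc rc; exact: constrained_L1loc.
- by case.
- exact: consistentII_constrained.
Qed.
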